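(* Let $\kappa$ be an inaccessible cardinal with $V_\kappa \models V = \mathrm{HOD}$, and let $C \subseteq \kappa$ be the canonical Cohen generic defined below. Then the two models $(V_\kappa,\mathrm{Def}(V_\kappa))$ and $(V_\kappa,\mathrm{Def}(V_\kappa;C))$ of $\mathsf{GB}$ are bi-interpretable.
   Context: Models of class theory are two-sorted $(M,\mathcal{X})$, $M$ the sets, $\mathcal{X}$ the classes. $\mathsf{GB}$ consists of $\mathsf{ZFC}$ for sets (schemata allowing class parameters), Class Extensionality, Class Replacement, and Comprehension for formulas quantifying only over sets (class parameters allowed). $\mathrm{Def}(V_\kappa)$ (resp. $\mathrm{Def}(V_\kappa;C)$) is the collection of subsets of $V_\kappa$ first-order definable with parameters over $V_\kappa$ (resp. over $(V_\kappa,\in,C)$). The HOD-order on $V_\kappa$: order sets $x$ first by the least $\beta$, then the least formula $\phi(v_1,v_2)$, then the least ordinal $\alpha$ such that $x$ is the unique element satisfying $\phi(\cdot,\alpha)$ in $V_\beta$; this is a definable global well-order. Definition of $C$: let $\langle D_\xi : \xi<\kappa\rangle$ enumerate the dense subclasses of $\mathrm{Add}(\kappa,1)$ (functions from ordinals below $\kappa$ to $2$, ordered by extension) lying in $\mathrm{Def}(V_\kappa)$, ordered by the HOD-least pair (formula, parameters) defining them; set $p_0=\emptyset$, $p_{\xi+1}$ the HOD-least condition strengthening $p_\xi$ that lies in $D_\xi$, $p_\eta = \bigcup_{\xi<\eta}p_\xi$ for limit $\eta$, and $C = \bigcup_{\xi<\kappa} p_\xi$. Two models $\mathcal{M},\mathcal{N}$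 are bi-interpretable if there are interpretations $\mathcal{I}$ of $\mathcal{N}$ in $\mathcal{M}$ and $\mathcal{J}$ of $\mathcal{M}$ in $\mathcal{N}$ (i.e. copies of the one structure definable inside the other) such that $\mathcal{M}$ defines an isomorphism between $\mathcal{M}$ and its copy of $\mathcal{M}$ obtained by interpreting $\mathcal{J}$ inside the $\mathcal{I}$-copy of $\mathcal{N}$, and likewise $\mathcal{N}$ defines an isomorphism between $\mathcal{N}$ and the corresponding copy of $\mathcal{N}$. *)

(* Defs.v *)
From Stdlib Require Import Arith Cantor Fin Relations.

Set Implicit Arguments.
Unset Strict Implicit.

Record mstruct : Type := MStruct { car :> Type; mem : car -> car -> Prop }.
Arguments mem {m} _ _.
Infix "\in" := mem (at level 70, no associativity).

Section Basic.
Variable M : mstruct.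
Implicit Types x y z a b : M.

Definition is_empty x := forall z, ~ z \in x.
Definition incl x y := forall z, z \in x -> z \in y.
Definition is_upair x y p := forall z, z \in p <-> z = x \/ z = y.
Definition is_union x u := forall z, z \in u <-> exists y, y \in x /\ z \in y.
Definition is_power x p := forall z, z \in p <-> incl z x.
Definition is_succ x y := forall z, z \in y <-> z \in x \/ z = x.

Definition is_opair x y p :=
  exists s d, is_upair x x s /\ is_upair x y d /\ is_upair s d p.

Fixpoint is_num (n : nat) x : Prop :=
  match n with
  | 0 => is_empty x
  | S m => exists y, is_num m y /\ is_succ y x
  end.

Definition transitive_set x := forall y, y \in x -> incl y x.
(** Adequate in the presence of Foundation, which holds wherever this is used. *)
Definition ordinal x :=
  transitive_set x /\ forall y, y \in x -> transitive_set y.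

Definition limit_ordinal x :=
  ordinal x /\ ~ is_empty x /\ ~ exists y, is_succ y x.

(** [in_V al x] says that [x] belongs to [V_al], where [V_al] is the union
    over [be < al] of the powersets of [V_be]. *)
Inductive in_V (al x : M) : Prop :=
| In_V be : be \in al -> (forall y, y \in x -> in_V be y) -> in_V al x.

Definition Vset (al : M) : mstruct :=
  @MStruct {u : M | in_V al u}
    (fun u v => proj1_sig u \in proj1_sig v).

Definition functional (R : M -> M -> Prop) :=
  forall x y y', R x y -> R x y' -> y = y'.

(** [K1] and [K2] say which predicates are admitted in Separation and which
    relations in Replacement. *)
Record ZFC_schema (K1 : (M -> Prop) -> Prop) (K2 : (M -> M -> Prop) -> Prop)
  : Prop := {
  zfc_extensionality : forall x y, (forall z, z \in x <-> z \in y) -> x = y;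
  zfc_foundation : forall x, ~ is_empty x ->
    exists y, y \in x /\ forall z, z \in x -> ~ z \in y;
  zfc_pairing : forall x y, exists p, is_upair x y p;
  zfc_union : forall x, exists u, is_union x u;
  zfc_power : forall x, exists p, is_power x p;
  zfc_infinity : exists w, (exists e, is_empty e /\ e \in w) /\
    forall x, x \in w -> exists y, is_succ x y /\ y \in w;
  zfc_choice : forall x,
    (forall y, y \in x -> ~ is_empty y) ->
    (forall y y' z, y \in x -> y' \in x -> z \in y -> z \in y' -> y = y') ->
    exists t, forall y, y \in x -> exists! z, z \in y /\ z \in t;
  zfc_separation : forall P, K1 P ->
    forall a, exists b, forall z, z \in b <-> z \in a /\ P z;
  zfc_replacement : forall R, K2 R -> functional R ->
    forall a, exists b, forall z, z \in b <-> exists x, x \in a /\ R x z }.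

(** The ambient universe of sets: Separation and Replacement for all
    predicates of the metatheory. *)
Definition ZFC : Prop := ZFC_schema (fun _ => True) (fun _ => True).

Definition card_le x y := exists f : M -> M,
  (forall z, z \in x -> f z \in y) /\
  (forall z z', z \in x -> z' \in x -> f z = f z' -> z = z').
Definition card_lt x y := card_le x y /\ ~ card_le y x.

Definition cardinal x := ordinal x /\ forall al, al \in x -> card_lt al x.
Definition uncountable x := ~ exists f : M -> nat,
  forall z z', z \in x -> z' \in x -> f z = f z' -> z = z'.
Definition no_short_cofinal_map x := forall al, al \in x ->
  forall f : M -> M, (forall xi, xi \in al -> f xi \in x) ->
  exists be, be \in x /\ forall xi, xi \in al -> f xi \in be.
Definition strong_limit x := forall la p,
  la \in x -> is_power la p -> card_lt p x.

Definition inaccessible x :=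
  cardinal x /\ uncountable x /\ no_short_cofinal_map x /\ strong_limit x.

End Basic.

(** [P] is the type of additional unary predicate symbols and [A] the type of
    free variables; the variable bound by [All] is [None]. *)

Inductive form (P A : Set) : Set :=
| Eq (x y : A)
| Mem (x y : A)
| Pred (c : P) (x : A)
| Neg (f : form P A)
| Conj (f g : form P A)
| All (f : form P (option A)).

Definition cons_env (A : Set) (M : Type) (x : M) (e : A -> M) (v : option A) : M :=
  match v with None => x | Some a => e a end.

Fixpoint sat (M : mstruct) (P A : Set) (I : P -> M -> Prop)
    (e : A -> M) (f : form P A) {struct f} : Prop :=
  match f with
  | Eq _ x y => e x = e y
  | Mem _ x y => e x \in e y
  | Pred c x => I c (e x)
  | Neg f => ~ sat I e f
  | Conj f g => sat I e f /\ sat I e g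
  | All f => forall x : M, sat I (cons_env x e) f
  end.

Definition no_pred (M : mstruct) (c : Empty_set) : M -> Prop :=
  match c with end.

Definition fin_val (n : nat) (i : Fin.t n) : nat := proj1_sig (Fin.to_nat i).

(** Goedel numbers of formulas in the language with membership only, relative
    to a numbering [v] of the free variables. *)
Fixpoint goedel (A : Set) (v : A -> nat) (f : form Empty_set A) {struct f} : nat :=
  match f with
  | Eq _ x y => 5 * Cantor.to_nat (v x, v y)
  | Mem _ x y => 5 * Cantor.to_nat (v x, v y) + 1
  | Pred c _ => match c with end
  | Neg f => 5 * goedel v f + 2
  | Conj f g => 5 * Cantor.to_nat (goedel v f, goedel v g) + 3
  | All f => 5 * goedel (cons_env 0 (fun a => S (v a))) f + 4
  end.

Definition goedel1 (n : nat) (f : form Empty_set (option (Fin.t n))) : nat :=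
  goedel (cons_env 0 (fun i => S (fin_val i))) f.

Section Definability.
Variable M : mstruct.

Definition defines (P : Set) (I : P -> M -> Prop) (n : nat)
    (f : form P (option (Fin.t n))) (a : Fin.t n -> M) (X : M -> Prop) : Prop :=
  forall x, X x <-> sat I (cons_env x a) f.

Definition definable (P : Set) (I : P -> M -> Prop) (X : M -> Prop) : Prop :=
  exists n (f : form P (option (Fin.t n))) a, defines I f a X.

Definition Def : (M -> Prop) -> Prop := definable (@no_pred M).
Definition DefWith (C : M -> Prop) : (M -> Prop) -> Prop :=
  definable (fun _ : unit => C).

(** [x] is the unique element of [V_be] satisfying [f(x, al)] in [V_be]. *)
Definition od_by (x be : M) (f : form Empty_set (option (Fin.t 1))) (al : M) :=
  ordinal be /\ ordinal al /\
  exists x' al' : Vset be, proj1_sig x' = x /\ proj1_sig al' = al /\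
    forall y : Vset be,
      sat (@no_pred (Vset be)) (cons_env y (fun _ => al')) f <-> y = x'.

(** These notions, the HOD-order included, are evaluated inside [M], so
    [V_eq_HOD (Vset kappa)] says that [V_kappa] satisfies [V = HOD].  The
    formulas and the finite [mem]-chains are those of the metatheory, which for
    [V_kappa] are the internal ones: a universe satisfying [ZFC] is
    well-founded. *)
Definition OD (x : M) := exists be f al, od_by x be f al.
Definition HOD (x : M) := forall y, clos_refl_trans M mem y x -> OD y.
Definition V_eq_HOD := forall x, HOD x.

Definition lt_triple (be : M) (f : form Empty_set (option (Fin.t 1))) (al : M)
    (be' : M) (f' : form Empty_set (option (Fin.t 1))) (al' : M) : Prop :=
  be \in be' \/
  (be = be' /\ (goedel1 f < goedel1 f' \/
               (goedel1 f = goedel1 f' /\ al \in al'))).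

Definition least_od_by (x be : M) f (al : M) :=
  od_by x be f al /\
  forall be' f' al', od_by x be' f' al' -> ~ lt_triple be' f' al' be f al.

Definition hod_lt (x y : M) := exists be f al be' f' al',
  least_od_by x be f al /\ least_od_by y be' f' al' /\
  lt_triple be f al be' f' al'.

Definition hod_least (Q : M -> Prop) (x : M) :=
  Q x /\ forall y, Q y -> ~ hod_lt y x.

Definition condition (p : M) := exists al, ordinal al /\
  (forall z, z \in p -> exists xi i,
     xi \in al /\ (is_num 0 i \/ is_num 1 i) /\ is_opair xi i z) /\
  (forall xi, xi \in al -> exists! i, exists z, is_opair xi i z /\ z \in p).

Definition dense (D : M -> Prop) :=
  (forall p, D p -> condition p) /\
  (forall p, condition p -> exists q, D q /\ incl p q).

Definition is_seq (n : nat) (a : Fin.t n -> M) (s : M) := forall z, z \in s <->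
  exists (i : Fin.t n) k, is_num (fin_val i) k /\ is_opair k (a i) z.

(** [c] is the pair of the Goedel number of a formula and of the finite
    sequence of parameters with which it defines [X].  These pairs are compared
    as elements of [M], so that [hod_lt] has order type [kappa] on them when
    [M] is [V_kappa]. *)
Definition class_code (X : M -> Prop) (c : M) :=
  exists n (f : form Empty_set (option (Fin.t n))) a k s,
    defines (@no_pred M) f a X /\
    is_num (goedel1 f) k /\ is_seq a s /\ is_opair k s c.

Definition dense_code (D : M -> Prop) (c : M) :=
  dense D /\ hod_least (class_code D) c.

(** [D] is [D_xi]: [f] is an isomorphism of [xi] with the codes of the dense
    classes that precede [D]. *)
Definition nth_dense (xi : M) (D : M -> Prop) := ordinal xi /\
  exists c, dense_code D c /\ exists f : M -> M,
    (forall eta eta', eta \in xi -> eta' \in xi -> eta \in eta' ->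
       hod_lt (f eta) (f eta')) /\
    (forall d, (exists eta, eta \in xi /\ f eta = d) <->
       (exists D', dense_code D' d) /\ hod_lt d c).

(** [generic_seq xi p] says that [p] is [p_xi]. *)
Inductive generic_seq : M -> M -> Prop :=
| generic_zero xi p : is_empty xi -> is_empty p -> generic_seq xi p
| generic_succ xi xi' p q D :
    generic_seq xi p -> is_succ xi xi' -> nth_dense xi D ->
    hod_least (fun r => condition r /\ incl p r /\ D r) q ->
    generic_seq xi' q
| generic_limit eta p (f : M -> M) :
    limit_ordinal eta -> (forall xi, xi \in eta -> generic_seq xi (f xi)) ->
    (forall z, z \in p <-> exists xi, xi \in eta /\ z \in f xi) ->
    generic_seq eta p.

Definition generic_function (z : M) := exists xi p, generic_seq xi p /\ z \in p.

(** The subset of [kappa] whose characteristic function is the union of the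
    conditions [p_xi]. *)
Definition canonical_generic (al : M) := exists i z,
  is_num 1 i /\ is_opair al i z /\ generic_function z.

End Definability.

Inductive sort : Set := set_sort | class_sort.

(** Structures carry their own equality, so that interpreted structures need
    not be quotiented. *)
Record structure : Type := Structure {
  elt :> sort -> Type;
  eqr : forall s, elt s -> elt s -> Prop;
  memr : forall s, elt set_sort -> elt s -> Prop }.

Definition ctx := sort -> Set.
Definition env (A : ctx) (S : structure) : Type := forall s, A s -> S s.

Definition ext (s : sort) (A : ctx) : ctx := fun t =>
  match s, t with
  | set_sort, set_sort => option (A set_sort)
  | class_sort, class_sort => option (A class_sort)
  | set_sort, class_sort => A class_sort
  | class_sort, set_sort => A set_sort
  end.

Definition ext_env (S : structure) (s : sort) (A : ctx) :
    S s -> env A S -> env (ext s A) S :=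
  match s return S s -> env A S -> env (ext s A) S with
  | set_sort => fun x e t =>
      match t with
      | set_sort => cons_env x (e set_sort)
      | class_sort => e class_sort
      end
  | class_sort => fun x e t =>
      match t with
      | set_sort => e set_sort
      | class_sort => cons_env x (e class_sort)
      end
  end.

Inductive cform (A : ctx) : Set :=
| CEq (s : sort) (x y : A s)
| CMem (s : sort) (x : A set_sort) (y : A s)
| CNeg (f : cform A)
| CConj (f g : cform A)
| CAll (s : sort) (f : cform (ext s A)).

Fixpoint csat (S : structure) (A : ctx) (e : env A S) (f : cform A) {struct f} : Prop :=
  match f with
  | CEq x y => eqr (e _ x) (e _ y)
  | CMem x y => memr (e _ x) (e _ y)
  | CNeg f => ~ csat e f
  | CConj f g => csat e f /\ csat e g
  | CAll f => forall x, csat (ext_env x e) f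
  end.

Fixpoint first_order (A : ctx) (f : cform A) : Prop :=
  match f with
  | CEq _ _ | CMem _ _ => True
  | CNeg f => first_order f
  | CConj f g => first_order f /\ first_order g
  | @CAll _ s f => s = set_sort /\ first_order f
  end.

Definition fin_ctx (d : sort -> nat) : ctx := fun s => Fin.t (d s).

Definition class_structure (M : mstruct) (X : (M -> Prop) -> Prop) : structure :=
  @Structure
    (fun s => match s with set_sort => car M | class_sort => {A : M -> Prop | X A} end)
    (fun s => eq)
    (fun s => match s with
              | set_sort => fun x y => x \in y
              | class_sort => fun x A => proj1_sig A x
              end).

Section GB.
Variables (M : mstruct) (X : (M -> Prop) -> Prop).
Let S := class_structure X.

Definition fo_predicate (P : M -> Prop) : Prop :=
  exists d (f : cform (ext set_sort (fin_ctx d))) (e : env (fin_ctx d) S),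
    first_order f /\
    forall x : M, P x <-> csat (@ext_env S set_sort _ x e) f.

Definition fo_relation (R : M -> M -> Prop) : Prop :=
  exists d (f : cform (ext set_sort (ext set_sort (fin_ctx d))))
         (e : env (fin_ctx d) S),
    first_order f /\
    forall x y : M, R x y <->
      csat (@ext_env S set_sort _ x (@ext_env S set_sort _ y e)) f.

Record GB : Prop := {
  gb_zfc : ZFC_schema fo_predicate fo_relation;
  gb_class_extensionality : forall A B : S class_sort,
    (forall x : S set_sort, memr x A <-> memr x B) -> A = B;
  gb_class_replacement : forall F : S class_sort,
    let R := fun x y : M => exists p : M,
      is_opair x y p /\ memr (p : S set_sort) F in
    functional R ->
    forall a : M, exists b : M, forall z : M,
      z \in b <-> exists x : M, x \in a /\ R x z;
  gb_comprehension : forall P, fo_predicate P ->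
    exists A : S class_sort, forall x : S set_sort, memr x A <-> P x }.

End GB.

(** An element of sort [s] is represented by a tuple having [dim s t] entries
    of sort [t] for each [t], up to the equivalence given by [eq_form].  That
    this is an equivalence relation, and a congruence, on the domain follows
    from the existence of an isomorphism with a structure where equality is
    genuine.  Interpretations and definable isomorphisms are parameter-free. *)

Definition ctx_sum (A B : ctx) : ctx := fun t => (A t + B t)%type.

Definition env_sum (S : structure) (A B : ctx) (e : env A S) (e' : env B S) :
    env (ctx_sum A B) S :=
  fun t v => match v with inl a => e t a | inr b => e' t b end.

Record interpretation : Set := Interpretation {
  dim : sort -> sort -> nat;
  dom_form : forall s, cform (fin_ctx (dim s));
  eq_form : forall s, cform (ctx_sum (fin_ctx (dim s)) (fin_ctx (dim s)));
  mem_form : forall s,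
    cform (ctx_sum (fin_ctx (dim set_sort)) (fin_ctx (dim s))) }.

Definition interpreted (I : interpretation) (S : structure) : structure :=
  @Structure
    (fun s => {e : env (fin_ctx (dim I s)) S | csat e (dom_form I s)})
    (fun s x y => csat (env_sum (proj1_sig x) (proj1_sig y)) (eq_form I s))
    (fun s x y => csat (env_sum (proj1_sig x) (proj1_sig y)) (mem_form I s)).

(** [F] is the graph of an isomorphism between the quotients of [S] and [T] by
    their equalities. *)
Record is_isomorphism (S T : structure) (F : forall s, S s -> T s -> Prop) : Prop := {
  iso_total : forall s x, exists y, F s x y;
  iso_surjective : forall s y, exists x, F s x y;
  iso_compatible : forall s x y x' y',
    eqr x x' -> eqr y y' -> F s x y -> F s x' y';
  iso_eq : forall s x y x' y',
    F s x y -> F s x' y' -> (eqr x x' <-> eqr y y');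
  iso_mem : forall s x y x' y',
    F set_sort x y -> F s x' y' -> (memr x x' <-> memr y y') }.

Definition interprets (I : interpretation) (S T : structure) : Prop :=
  exists F, @is_isomorphism (interpreted I S) T F.

(** The entries in [S] of a tuple of tuples from [S]. *)
Definition flat_ctx (I J : interpretation) (s : sort) : ctx :=
  fun u => {t : sort & (Fin.t (dim J s t) * Fin.t (dim I t u))%type}.

Definition flatten (I J : interpretation) (S : structure) (s : sort)
    (y : interpreted J (interpreted I S) s) : env (flat_ctx I J s) S :=
  fun u v => proj1_sig (proj1_sig y (projT1 v) (fst (projT2 v))) u (snd (projT2 v)).

Definition defines_isomorphism (I J : interpretation) (S : structure) : Prop :=
  exists f : forall s, cform (ext s (flat_ctx I J s)),
    @is_isomorphism S (interpreted J (interpreted I S))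
      (fun s x y => csat (ext_env x (flatten y)) (f s)).

Definition bi_interpretable (S T : structure) : Prop :=
  exists I J : interpretation,
    interprets I S T /\ interprets J T S /\
    defines_isomorphism I J S /\ defines_isomorphism J I T.

(* Main.v *)
(** Inside [(V, Def V)] truth in [(V, \in)] is definable: the satisfaction relation for formulas
    up to a given number is a class in [Def V], all formula numbers are standard, and the recursion
    clauses determine the class.  Hence the enumeration of the dense classes, the sequence [p_xi]
    and [C] are definable as well.  Since Add(kappa, 1) adds no sets, forcing for formulas about
    [(V, \in, C)] is given by a recursion over elements of [V] and is definable in the same way;
    since [C] meets every dense class in [Def V], a formula holds in [(V, \in, C)] iff some [p_xi]
    forces it.  So [(V, Def V)] interprets [(V, Def (V; C))], a class being represented by a formula
    number and parameters, while [(V, Def (V; C))] recognises the classes of [Def V] as those coded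
    by means of truth in [(V, \in)].  Both composites are the identity on sets and relate a class
    to its codes. *)

From Stdlib Require Import Arith Lia Relations ClassicalEpsilon FunctionalExtensionality
  PropExtensionality.
Require Import Defs.

Set Implicit Arguments.
Unset Strict Implicit.

(** * Set theory in a second-order model *)

(** Two kinds of definability have to be kept apart. The truth lemma needs the dense classes that
    decide a given formula to lie in [Def M], so forcing must be first-order definable for each
    fixed formula. The interpretations need forcing as one relation with the formula number as a
    variable, which, as in Tarski's theorem on truth, goes beyond first-order formulas. The
    abstraction [notion] yields the closure properties once for both. Sets are handled through
    predicates of the metatheory: Separation and Replacement hold for all of them in [U] and, by
    inaccessibility, in [V_kappa]. Hence membership is well-founded in the metatheory, and
    inductions on formulas, ordinals and the HOD-order are ordinary inductions. The second-order
    definitions ask of the classes only that they include [Def M]. The same formulas therefore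
    define the generic sequence and forcing in both structures, and even in the larger one a code is
    evaluated through forcing. *)

Lemma choice_fun (A B : Type) (R : A -> B -> Prop) :
  (forall x, exists y, R x y) -> exists f : A -> B, forall x, R x (f x).
Proof.
  intros H. exists (fun x => proj1_sig (constructive_indefinite_description _ (H x))).
  intros x. apply (proj2_sig (constructive_indefinite_description _ (H x))).
Qed.

Lemma choice_on (A B : Type) (b0 : B) (P : A -> Prop) (R : A -> B -> Prop) :
  (forall x, P x -> exists y, R x y) -> exists f : A -> B, forall x, P x -> R x (f x).
Proof.
  intros H. apply (choice_fun (R := fun x y => P x -> R x y)). intros x.
  destruct (classic (P x)) as [p|n].
  - destruct (H x p) as [y hy]. exists y; auto.
  - exists b0. tauto.
Qed.

Lemma wf_minimal (A : Type) (R : A -> A -> Prop) (P : A -> Prop) :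
  well_founded R -> (exists x, P x) -> exists x, P x /\ forall y, P y -> ~ R y x.
Proof.
  intros W [x px]. revert px. induction (W x) as [x _ IH]. intros px.
  destruct (classic (exists y, P y /\ R y x)) as [[y [py r]]|n].
  - exact (IH y r py).
  - exists x. split; [exact px|]. intros y py r. apply n. eauto.
Qed.

Section Sets.
Variable M : mstruct.
Hypothesis ZM : ZFC M.
Implicit Types x y z a b s t al be : M.
Implicit Types P Q : M -> Prop.

(** The schemata hold for all predicates of the metatheory, so set existence is treated as a closure
    property of predicates, without internal formulas. *)
Definition small (P : M -> Prop) := exists b : M, forall z, z \in b <-> P z.

Lemma set_ext x y : (forall z, z \in x <-> z \in y) -> x = y.
Proof. apply (zfc_extensionality ZM). Qed.

Lemma small_mem a : small (fun z => z \in a).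
Proof. exists a. tauto. Qed.

Lemma small_eq P Q : small P -> (forall z, Q z <-> P z) -> small Q.
Proof. intros [b hb] H. exists b. intros z. rewrite hb, H. tauto. Qed.

Lemma small_sub P Q : small P -> (forall z, Q z -> P z) -> small Q.
Proof.
  intros [b hb] H. destruct (zfc_separation ZM (P := Q) I b) as [c hc].
  exists c. intros z. rewrite hc, hb. split; [tauto|auto].
Qed.

Lemma small_rel P (R : M -> M -> Prop) : small P ->
  (forall x y y', P x -> R x y -> R x y' -> y = y') ->
  small (fun z => exists x, P x /\ R x z).
Proof.
  intros [b hb] F.
  destruct (zfc_replacement ZM (R := fun x y => P x /\ R x y) I) with (a := b) as [c hc].
  - intros x y y' [h h1] [_ h2]. eauto.
  - exists c. intros z. rewrite hc. split; intros [x h]; exists x; rewrite hb in *; tauto.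
Qed.

Lemma small_image P (f : M -> M) : small P -> small (fun z => exists x, P x /\ z = f x).
Proof. intros H. apply small_rel; auto. intros; congruence. Qed.

(** Metatheoretic choice picks a set with extension [Q x] for each index [x]; Replacement collects
    these sets and Union joins them. *)
Lemma small_Union P (Q : M -> M -> Prop) : small P ->
  (forall x, P x -> small (Q x)) -> small (fun z => exists x, P x /\ Q x z).
Proof.
  intros HP H. assert (exists m : M, True) as [m _].
  { destruct (zfc_infinity ZM) as [w _]. eauto. }
  destruct (choice_on m H) as [f hf].
  destruct (small_image f HP) as [c hc].
  destruct (zfc_union ZM c) as [u hu]. exists u. intros z. rewrite (hu z). split.
  - intros [y [h1 h2]]. apply hc in h1. destruct h1 as [x [h1 ->]].
    exists x. split; auto. apply hf; auto.
  - intros [x [h1 h2]]. exists (f x). split; [apply hc; eauto|]. apply hf; auto.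
Qed.

Lemma small_pair x y : small (fun z => z = x \/ z = y).
Proof. destruct (zfc_pairing ZM x y) as [p hp]. exists p. exact hp. Qed.

Lemma small_or P Q : small P -> small Q -> small (fun z => P z \/ Q z).
Proof.
  intros [p hp] [q hq]. destruct (zfc_pairing ZM p q) as [c hc].
  destruct (zfc_union ZM c) as [u hu]. exists u. intros z. rewrite (hu z). split.
  - intros [y [h1 h2]]. apply hc in h1. destruct h1 as [->| ->]; [left; now apply hp|right; now apply hq].
  - intros [h|h]; [exists p|exists q]; split; try (apply hc; auto); [now apply hp|now apply hq].
Qed.

Lemma small_single x : small (fun z => z = x).
Proof. eapply small_eq. exact (small_pair x x). tauto. Qed.

Lemma small_empty : small (fun _ => False).
Proof.
  destruct (zfc_infinity ZM) as [w _]. eapply small_sub; [exact (small_mem w)|]. tauto.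
Qed.

Lemma small_pow P : small P -> small (fun x => forall z, z \in x -> P z).
Proof.
  intros [p hp]. destruct (zfc_power ZM p) as [q hq]. exists q. intros x.
  rewrite (hq x). split; intros h z hz; apply hp; auto.
Qed.

Definition setof (P : M -> Prop) (H : small P) : M :=
  proj1_sig (constructive_indefinite_description _ H).

Lemma in_setof P (H : small P) z : z \in setof H <-> P z.
Proof. apply (proj2_sig (constructive_indefinite_description _ H)). Qed.

Lemma mem_irrefl x : ~ x \in x.
Proof.
  destruct (small_single x) as [s hs]. intros h.
  destruct (zfc_foundation ZM (x := s)) as [y [h1 h2]].
  - intros E. apply (E x). apply hs; auto.
  - apply hs in h1. subst y. apply (h2 x); [apply hs; auto|exact h].
Qed.

Lemma mem_asym x y : x \in y -> ~ y \in x.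
Proof.
  destruct (small_pair x y) as [s hs]. intros h h'.
  destruct (zfc_foundation ZM (x := s)) as [z [h1 h2]].
  - intros E. apply (E x). apply hs; auto.
  - apply hs in h1. destruct h1; subst z; eapply h2; eauto; apply hs; auto.
Qed.

Definition empty : M := setof small_empty.
Definition succ x : M := setof (small_or (small_mem x) (small_single x)).
Definition upair x y : M := setof (small_pair x y).
Definition opair x y : M := upair (upair x x) (upair x y).

Lemma in_empty z : ~ z \in empty.
Proof. intros h. apply in_setof in h. exact h. Qed.
Lemma in_succ x z : z \in succ x <-> z \in x \/ z = x.
Proof. apply in_setof. Qed.
Lemma in_upair x y z : z \in upair x y <-> z = x \/ z = y.
Proof. apply in_setof. Qed.

Lemma is_emptyE x : is_empty x <-> x = empty.
Proof.
  split.
  - intros h. apply set_ext. intros z. split; intros h'; [destruct (h z h')|destruct (in_empty h')].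
  - intros -> z. apply in_empty.
Qed.

Lemma is_succE x y : is_succ x y <-> y = succ x.
Proof.
  split.
  - intros h. apply set_ext. intros z. rewrite (h z), in_succ. tauto.
  - intros -> z. apply in_succ.
Qed.

Lemma is_upairE x y p : is_upair x y p <-> p = upair x y.
Proof.
  split.
  - intros h. apply set_ext. intros z. rewrite (h z), in_upair. tauto.
  - intros -> z. apply in_upair.
Qed.

Lemma is_opairE x y p : is_opair x y p <-> p = opair x y.
Proof.
  split.
  - intros [s [d [h1 [h2 h3]]]]. rewrite is_upairE in *. now subst.
  - intros ->. exists (upair x x), (upair x y). now rewrite !is_upairE.
Qed.

Lemma upair_inj x y x' y' : upair x y = upair x' y' ->
  (x = x' /\ y = y') \/ (x = y' /\ y = x').
Proof.
  intros h. assert (H : forall z, z = x \/ z = y <-> z = x' \/ z = y').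
  { intros z. rewrite <- !in_upair, h. tauto. }
  destruct (proj1 (H x) (or_introl eq_refl)); destruct (proj1 (H y) (or_intror eq_refl));
  destruct (proj2 (H x') (or_introl eq_refl)); destruct (proj2 (H y') (or_intror eq_refl));
  subst; auto.
Qed.

Lemma opair_inj x y x' y' : opair x y = opair x' y' -> x = x' /\ y = y'.
Proof.
  intros h. apply upair_inj in h. destruct h as [[h1 h2]|[h1 h2]];
  apply upair_inj in h1; apply upair_inj in h2;
  destruct h1 as [[]|[]]; destruct h2 as [[]|[]]; subst; auto.
Qed.

Lemma succ_inj x y : succ x = succ y -> x = y.
Proof.
  intros h. destruct (proj1 (in_succ y x)) as [h1|h1]; auto.
  { rewrite <- h. apply in_succ; auto. }
  destruct (proj1 (in_succ x y)) as [h2|h2]; auto.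
  { rewrite h. apply in_succ; auto. }
  destruct (mem_asym h1 h2).
Qed.

Fixpoint num (n : nat) : M := match n with 0 => empty | S m => succ (num m) end.

Lemma is_numE n x : is_num n x <-> x = num n.
Proof.
  revert x. induction n as [|n IH]; intros x; simpl.
  - apply is_emptyE.
  - split.
    + intros [y [h1 h2]]. apply IH in h1. apply is_succE in h2. now subst.
    + intros ->. exists (num n). rewrite IH, is_succE. auto.
Qed.

Lemma in_num n x : x \in num n <-> exists m, m < n /\ x = num m.
Proof.
  induction n as [|n IH]; simpl.
  - split; [intros h; destruct (in_empty h)|intros [m [h _]]; lia].
  - rewrite in_succ, IH. split.
    + intros [[m [h ->]]| ->]; [exists m|exists n]; split; auto with arith.
    + intros [m [h ->]]. destruct (Nat.eq_dec m n); [subst; auto|].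
      left. exists m. split; auto; lia.
Qed.

Lemma num_inj n m : num n = num m -> n = m.
Proof.
  assert (H : forall n m, n < m -> num n <> num m).
  { intros i j h e. apply (@mem_irrefl (num j)). rewrite <- e at 1. apply in_num. eauto. }
  intros e. destruct (lt_eq_lt_dec n m) as [[h|h]|h]; auto; edestruct H; eauto.
Qed.

Lemma num_lt n m : num n \in num m <-> n < m.
Proof.
  rewrite in_num. split.
  - intros [k [h e]]. apply num_inj in e. lia.
  - eauto.
Qed.

(** Separation is applied to the predicate of being the numeral of a natural number of the
    metatheory; hence the omega of [M] is standard. *)
Lemma small_num : small (fun z => exists n, z = num n).
Proof.
  destruct (zfc_infinity ZM) as [w [[e [he hw]] h]].
  eapply small_sub; [exact (small_mem w)|]. intros z [n ->].
  induction n as [|n IH]; simpl.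
  - apply is_emptyE in he. now subst.
  - destruct (h _ IH) as [y [h1 h2]]. apply is_succE in h1. now subst.
Qed.

Lemma small_nat (f : nat -> M) : small (fun z => exists n, z = f n).
Proof.
  eapply small_eq.
  - apply (small_rel (R := fun x z => exists n, x = num n /\ z = f n) small_num).
    intros x y y' _ [n [-> ->]] [m [e ->]]. apply num_inj in e. now subst.
  - intros z. split; [intros [n ->]; eauto 6|intros [x [_ [n [_ ->]]]]; eauto].
Qed.

Lemma small_nat_Union (Q : nat -> M -> Prop) :
  (forall n, small (Q n)) -> small (fun z => exists n, Q n z).
Proof.
  intros H. eapply small_eq.
  - apply (small_Union (P := fun z => exists n, z = num n)
             (Q := fun x z => exists n, x = num n /\ Q n z) small_num).
    intros x [n ->]. apply small_eq with (1 := H n). intros z. split; [|eauto].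
    intros [m [e h]]. apply num_inj in e. now subst.
  - intros z; split; [intros [n h]; eauto 6|intros [x [_ [n [_ h]]]]; eauto].
Qed.

Lemma trcl x : exists t, transitive_set t /\ x \in t.
Proof.
  pose (step := fun y => setof (zfc_union ZM y)).
  assert (hs : forall y z, z \in step y <-> exists u, u \in y /\ z \in u)
    by (intros; apply in_setof).
  pose (T := fun n => nat_rect (fun _ => M) (setof (small_single x)) (fun _ y => step y) n).
  destruct (small_nat_Union (Q := fun n z => z \in T n)) as [t ht].
  { intros n. apply small_mem. }
  exists t. split.
  - intros y hy z hz. apply ht in hy. destruct hy as [n hn]. apply ht. exists (S n).
    simpl. apply hs. eauto.
  - apply ht. exists 0. simpl. apply in_setof. auto.
Qed.

(** Separation admits the predicate [~ Acc], so Foundation applies to the set of bad elements of a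
    transitive set around [x]. *)
Lemma mem_wf : well_founded (fun x y => x \in y).
Proof.
  intros x. destruct (trcl x) as [t [ht hx]].
  apply NNPP. intros n.
  destruct (small_sub (P := fun z => z \in t)
    (Q := fun z => z \in t /\ ~ Acc (fun x y => x \in y) z) (small_mem t)) as [s hs].
  { tauto. }
  destruct (zfc_foundation ZM (x := s)) as [y [h1 h2]].
  - intros E. apply (E x). apply hs. auto.
  - apply hs in h1. destruct h1 as [h1 h3]. apply h3. constructor. intros z hz.
    apply NNPP. intros h4. apply (h2 z); [|exact hz]. apply hs. split; auto. apply (ht y); auto.
Qed.

Lemma ordinal_mem x y : ordinal x -> y \in x -> ordinal y.
Proof.
  intros [h1 h2] h. split; [auto|]. intros z hz. apply h2. apply (h1 y); auto.
Qed.

Lemma ordinal_trans x y z : ordinal x -> y \in x -> z \in y -> z \in x.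
Proof. intros [h1 _] h h'. apply (h1 y); auto. Qed.

Lemma ordinal_total x y : ordinal x -> ordinal y -> x \in y \/ x = y \/ y \in x.
Proof.
  revert y. induction (mem_wf x) as [x _ IHx]. intros y.
  induction (mem_wf y) as [y _ IHy]. intros ox oy.
  apply NNPP. intros n. apply n. right. left. apply set_ext. intros z. split; intros h.
  - destruct (IHx z h y) as [h'|[h'|h']]; eauto using ordinal_mem; exfalso; apply n.
    + subst z. auto.
    + right. right. eauto using ordinal_trans.
  - destruct (IHy z h) as [h'|[h'|h']]; eauto using ordinal_mem; exfalso; apply n.
    + left. eauto using ordinal_trans.
    + subst z; auto.
Qed.

Lemma ordinal_empty : ordinal empty.
Proof. split; intros y h; destruct (in_empty h). Qed.

Lemma ordinal_succ x : ordinal x -> ordinal (succ x).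
Proof.
  intros o. split.
  - intros y hy z hz. apply in_succ. left. apply in_succ in hy. destruct hy as [hy| ->]; auto.
    eauto using ordinal_trans.
  - intros y hy. apply in_succ in hy. destruct hy as [hy| ->]; [|exact (proj1 o)].
    exact (proj1 (ordinal_mem o hy)).
Qed.

Lemma ordinal_num n : ordinal (num n).
Proof. induction n; simpl; auto using ordinal_empty, ordinal_succ. Qed.

Lemma ordinal_cases x : ordinal x ->
  x = empty \/ (exists y, y \in x /\ x = succ y) \/ limit_ordinal x.
Proof.
  intros o. destruct (classic (is_empty x)) as [e|n].
  { left. now apply is_emptyE. }
  destruct (classic (exists y, is_succ y x)) as [[y h]|n'].
  - right. left. apply is_succE in h. subst. exists y. split; auto. apply in_succ. auto.
  - right. right. split; auto.
Qed.

Lemma limit_succ x y : limit_ordinal x -> y \in x -> succ y \in x.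
Proof.
  intros [o [_ n]] h. destruct (ordinal_total (x := succ y) (y := x)) as [h'|[h'|h']]; auto.
  - apply ordinal_succ. eauto using ordinal_mem.
  - exfalso. apply n. exists y. apply is_succE. auto.
  - exfalso. apply in_succ in h'. destruct h' as [h'| ->]; [eapply mem_asym|eapply mem_irrefl]; eauto.
Qed.

Lemma ordinal_of_elems x : (forall y, y \in x -> ordinal y) ->
  (forall y z, y \in x -> z \in y -> z \in x) -> ordinal x.
Proof. intros h1 h2. split; [intros y hy z hz; eauto|]. intros y hy. exact (proj1 (h1 y hy)). Qed.

Lemma in_V_mono al be x : ordinal al -> be \in al -> in_V be x -> in_V al x.
Proof.
  intros o h1 h2. revert al o h1. induction h2 as [be x ga h1 h2 IH]. intros al o h.
  apply In_V with (be := ga); auto. eauto using ordinal_trans.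
Qed.

Lemma in_V_sub al x y : in_V al x -> incl y x -> in_V al y.
Proof. intros [be h1 h2] h. apply In_V with (be := be); auto. Qed.

Lemma in_V_mem al x y : ordinal al -> in_V al x -> y \in x -> in_V al y.
Proof. intros o h. destruct h as [be h1 h2]. intros hy. eauto using in_V_mono. Qed.

Lemma small_V al : small (in_V al).
Proof.
  induction (mem_wf al) as [al _ IH].
  eapply small_eq.
  - apply (small_Union (P := fun be => be \in al)
       (Q := fun be x => forall y, y \in x -> in_V be y) (small_mem al)).
    intros be h. apply small_pow. auto.
  - intros x. split.
    + intros [be h1 h2]. eauto.
    + intros [be [h1 h2]]. eapply In_V; eauto.
Qed.

Lemma small_seq (E : nat -> M) : small (fun z => exists n, z = opair (num n) (E n)).
Proof. exact (small_nat (fun n => opair (num n) (E n))). Qed.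

(** Assignments are sequences of length omega, so one kind of object serves formulas with any number
    of free variables. *)
Definition seqc (E : nat -> M) : M := setof (small_seq E).

Lemma in_seqc E z : z \in seqc E <-> exists n, z = opair (num n) (E n).
Proof. apply in_setof. Qed.

Lemma opair_seqc E n x : opair (num n) x \in seqc E <-> x = E n.
Proof.
  rewrite in_seqc. split.
  - intros [m e]. apply opair_inj in e. destruct e as [e ->]. apply num_inj in e. now subst.
  - intros ->. eauto.
Qed.

Lemma seqc_inj E E' : seqc E = seqc E' -> forall n, E n = E' n.
Proof. intros e n. apply opair_seqc. rewrite <- e. now apply opair_seqc. Qed.

Lemma env_of_Fin n (a : Fin.t n -> M) : exists E : nat -> M, forall i, E (fin_val i) = a i.
Proof.
  exists (fun i => match lt_dec i n with left h => a (Fin.of_nat_lt h) | right _ => empty end).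
  intros i. destruct (lt_dec (fin_val i) n) as [l|l].
  - f_equal. apply Fin.to_nat_inj. rewrite Fin.to_nat_of_nat. reflexivity.
  - exfalso. apply l. unfold fin_val. destruct (Fin.to_nat i). auto.
Qed.

Lemma small_prod P Q : small P -> small Q ->
  small (fun z => exists x y, P x /\ Q y /\ z = opair x y).
Proof.
  intros HP HQ. eapply small_eq.
  - apply (small_Union (P := P) (Q := fun x z => exists y, Q y /\ z = opair x y) HP).
    intros x _. apply (small_image (opair x) HQ).
  - intros z. split.
    + intros [x [y [h1 [h2 h3]]]]. eauto 6.
    + intros [x [h1 [y [h2 h3]]]]. eauto 6.
Qed.

End Sets.

(** * [V_kappa] is a second-order model *)

Section Inaccessible.
Variable U : mstruct.
Hypothesis ZU : ZFC U.
Variable kappa : U.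
Hypothesis Hk : inaccessible kappa.
Implicit Types x y z al be ga p : U.

Let ordinal_kappa : ordinal kappa.
Proof. apply Hk. Qed.

Lemma empty_in_inaccessible : empty ZU \in kappa.
Proof.
  destruct (ordinal_total ZU (ordinal_empty ZU) ordinal_kappa) as [h|[h|h]]; auto.
  - exfalso. destruct Hk as [_ [uc _]]. apply uc. exists (fun _ => 0).
    rewrite <- h. intros z z' hz. destruct (in_empty hz).
  - destruct (in_empty h).
Qed.

(** Regularity applied to the constant map [be] on a nonempty ordinal gives something above [be]. If
    no element of [kappa] is nonempty, [kappa] has at most one element and is countable. *)
Lemma inaccessible_no_max be : be \in kappa -> exists ga, ga \in kappa /\ be \in ga.
Proof.
  intros h. destruct (classic (exists al z, al \in kappa /\ z \in al)) as [[al [z [h1 h2]]]|n].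
  - destruct Hk as [_ [_ [reg _]]].
    destruct (reg al h1 (fun _ => be)) as [ga [h3 h4]]; auto.
    exists ga. split; auto. apply (h4 z h2).
  - exfalso. destruct Hk as [_ [uc _]]. apply uc. exists (fun _ => 0).
    assert (E : forall z, z \in kappa -> z = empty ZU).
    { intros z hz. apply is_emptyE. intros y hy. apply n. eauto. }
    intros z z' hz hz' _. rewrite (E z hz), (E z' hz'). auto.
Qed.

Lemma inaccessible_succ be : be \in kappa -> succ ZU be \in kappa.
Proof.
  intros h. apply limit_succ; auto. split; [auto|]. split.
  - intros e. exact (e _ h).
  - intros [y hy]. apply is_succE with (ZM := ZU) in hy.
    assert (hy' : y \in kappa) by (rewrite hy; apply in_succ; auto).
    destruct (inaccessible_no_max hy') as [ga [h1 h2]].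
    rewrite hy in h1. apply in_succ in h1. destruct h1 as [h1| ->].
    + apply (mem_asym ZU h1 h2).
    + apply (mem_irrefl ZU h2).
Qed.

(** Otherwise all elements of [kappa] are numerals, which makes [kappa] countable. *)
Lemma omega_in_inaccessible : exists w, w \in kappa /\ forall z, z \in w <-> exists n, z = num ZU n.
Proof.
  destruct (small_num ZU) as [w hw]. exists w. split; [|auto].
  assert (ow : ordinal w).
  { apply ordinal_of_elems.
    - intros y hy. apply hw in hy. destruct hy as [n ->]. apply ordinal_num.
    - intros y z hy hz. apply hw in hy. destruct hy as [n ->]. apply in_num in hz.
      destruct hz as [m [_ ->]]. apply hw. eauto. }
  destruct (ordinal_total ZU ow ordinal_kappa) as [h|h]; auto. exfalso.
  assert (E : forall z, z \in kappa -> exists n, z = num ZU n).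
  { intros z hz. apply hw. destruct h as [->|h]; auto. eauto using ordinal_trans. }
  destruct (choice_on 0 E) as [f hf].
  destruct Hk as [_ [uc _]]. apply uc. exists f. intros z z' hz hz' e.
  rewrite (hf z hz), (hf z' hz'). congruence.
Qed.

Lemma card_le_trans x y z : card_le x y -> card_le y z -> card_le x z.
Proof. intros [f [f1 f2]] [g [g1 g2]]. exists (fun u => g (f u)). split; auto. Qed.

(** Enumerate [x] without repetition by recursion on ordinals: [g al] is an element of [x] not
    listed before stage [al]. Either some stage below [kappa] exhausts [x], or [g] is injective on
    [kappa]. *)
Lemma card_le_inaccessible x :
  card_le kappa x \/ exists al, al \in kappa /\ card_le x al.
Proof.
  pose (F := fun (al : U) (rec : forall be, be \in al -> U) =>
    epsilon (inhabits x) (fun z => z \in x /\ forall be (h : be \in al), rec be h <> z)).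
  pose (g := Fix (mem_wf ZU) (fun _ => U) F).
  assert (hg : forall al, g al = F al (fun be _ => g be)).
  { intros al. unfold g. rewrite Fix_eq; auto. intros al' r r' e.
    f_equal. apply functional_extensionality_dep. intros be.
    apply functional_extensionality_dep. intros h. apply e. }
  assert (hg' : forall al, (exists z, z \in x /\ forall be, be \in al -> g be <> z) ->
    g al \in x /\ forall be, be \in al -> g be <> g al).
  { intros al h. rewrite hg. unfold F.
    apply (epsilon_spec (inhabits x) (fun z => z \in x /\ forall be, be \in al -> g be <> z) h). }
  destruct (classic (exists al, al \in kappa /\ forall z, z \in x -> exists be, be \in al /\ g be = z))
    as [[al [h1 h2]]|n].
  - right. exists al. split; auto.
    destruct (choice_on x h2) as [f hf]. exists f. split.
    + intros z hz. apply hf; auto.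
    + intros z z' hz hz' e. rewrite <- (proj2 (hf z hz)), <- (proj2 (hf z' hz')). congruence.
  - left. assert (h : forall al, al \in kappa -> g al \in x /\ forall be, be \in al -> g be <> g al).
    { intros al hal. apply hg'. apply NNPP. intros n'. apply n. exists al. split; auto.
      intros z hz. apply NNPP. intros n''. apply n'. exists z. split; auto.
      intros be hbe e. apply n''. eauto. }
    exists g. split; [intros z hz; apply h; auto|].
    intros z z' hz hz' e.
    destruct (ordinal_total ZU (ordinal_mem ordinal_kappa hz) (ordinal_mem ordinal_kappa hz'))
      as [h'|[h'|h']]; auto; exfalso.
    + exact (proj2 (h z' hz') z h' e).
    + exact (proj2 (h z hz) z' h' (eq_sym e)).
Qed.

(** Equivalent to [~ card_le kappa p] by the next two lemmas. This form passes to unions, the other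
    one to power sets. *)
Definition regular_over p := forall f : U -> U, (forall z, z \in p -> f z \in kappa) ->
  exists be, be \in kappa /\ forall z, z \in p -> f z \in be.

(** If [kappa] injects into the range of [f], choosing preimages injects it into [p]. Otherwise the
    range injects into some [al] in [kappa]; the inverse map, with value [empty] off the image, is
    bounded by regularity of [kappa]. *)
Lemma regular_of_not_card_le p : ~ card_le kappa p -> regular_over p.
Proof.
  intros n f hf. destruct (small_image ZU f (small_mem p)) as [Y hY].
  destruct (card_le_inaccessible Y) as [[g [g1 g2]]|[al [hal [e [e1 e2]]]]].
  - exfalso. apply n.
    destruct (choice_on (B := U) p (P := fun y => y \in Y) (R := fun y z => z \in p /\ y = f z)) as [h hh].
    { intros y hy. apply hY in hy. destruct hy as [z hz]. eauto. }
    exists (fun al => h (g al)). split.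
    + intros z hz. apply hh; auto.
    + intros z z' hz hz' E. apply g2; auto.
      rewrite (proj2 (hh _ (g1 z hz))), (proj2 (hh _ (g1 z' hz'))). congruence.
  - destruct (choice_fun (R := fun xi y => (y \in Y /\ e y = xi) \/
       ((~ exists y, y \in Y /\ e y = xi) /\ y = empty ZU))) as [k hk].
    { intros xi. destruct (classic (exists y, y \in Y /\ e y = xi)) as [[y h]|h]; eauto. }
    destruct Hk as [_ [_ [reg _]]].
    destruct (reg al hal k) as [be [h1 h2]].
    { intros xi _. destruct (hk xi) as [[h _]|[_ ->]].
      - apply hY in h. destruct h as [z [hz ->]]. auto.
      - apply empty_in_inaccessible. }
    exists be. split; auto. intros z hz.
    assert (hy : f z \in Y) by (apply hY; eauto).
    destruct (hk (e (f z))) as [[h3 h4]|[h3 _]].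
    + apply e2 in h4; auto. rewrite <- h4. apply h2. auto.
    + exfalso. eauto.
Qed.

(** The inverse of an injection [g] of [kappa] into [p] would be bounded by some [be], yet it takes
    the value [be] at [g be]. *)
Lemma not_card_le_of_regular p : regular_over p -> ~ card_le kappa p.
Proof.
  intros r [g [g1 g2]].
  destruct (choice_fun (R := fun z al => (al \in kappa /\ g al = z) \/
       ((~ exists al, al \in kappa /\ g al = z) /\ al = empty ZU))) as [k hk].
  { intros z. destruct (classic (exists al, al \in kappa /\ g al = z)) as [[y h]|h]; eauto. }
  destruct (r k) as [be [h1 h2]].
  { intros z _. destruct (hk z) as [[h _]|[_ ->]]; auto. apply empty_in_inaccessible. }
  destruct (hk (g be)) as [[h3 h4]|[h3 _]]; [|eauto].
  apply g2 in h4; auto. apply (@mem_irrefl U ZU be). rewrite <- h4 at 1. auto.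
Qed.

Lemma regular_sub p q : regular_over p -> incl q p -> regular_over q.
Proof.
  intros r h f hf.
  destruct (r (fun z => epsilon (inhabits z) (fun y => (z \in q /\ y = f z) \/ (~ z \in q /\ y = empty ZU))))
    as [be [h1 h2]].
  - intros z _.
    assert (E : exists y, (z \in q /\ y = f z) \/ (~ z \in q /\ y = empty ZU)).
    { destruct (classic (z \in q)); eauto. }
    destruct (epsilon_spec (inhabits z) _ E) as [[h' ->]|[_ ->]]; auto.
    apply empty_in_inaccessible.
  - exists be. split; auto. intros z hz. specialize (h2 z (h z hz)).
    assert (E : exists y, (z \in q /\ y = f z) \/ (~ z \in q /\ y = empty ZU)) by eauto.
    destruct (epsilon_spec (inhabits z) _ E) as [[h' e]|[h' _]]; [|tauto].
    rewrite e in h2. auto.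
Qed.

(** Bound [f] on each piece, then bound the bounds. *)
Lemma regular_Union I (X : U -> U) p : regular_over I ->
  (forall i, i \in I -> regular_over (X i)) ->
  (forall z, z \in p -> exists i, i \in I /\ z \in X i) -> regular_over p.
Proof.
  intros rI rX hp f hf.
  destruct (choice_on (B := U) p (P := fun i => i \in I)
    (R := fun i b => b \in kappa /\ forall z, z \in X i -> z \in p -> f z \in b)) as [b hb].
  - intros i hi. destruct (small_sub ZU (Q := fun z => z \in X i /\ z \in p) (small_mem p)) as [q hq].
    { tauto. }
    destruct (@regular_sub (X i) q (rX i hi)) with (f := f) as [be [h1 h2]].
    + intros z hz. apply hq in hz. tauto.
    + intros z hz. apply hq in hz. apply hf; tauto.
    + exists be. split; auto. intros z h h'. apply h2. apply hq. auto.
  - destruct (rI b) as [c [h1 h2]]. { intros i hi; apply hb; auto. }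
    exists c. split; auto. intros z hz. destruct (hp z hz) as [i [hi h]].
    apply (ordinal_trans (y := b i)); eauto using ordinal_mem. apply hb; auto.
Qed.

(** [V_al] is the union of the power sets of the [V_be] with [be] in [al]. By induction [V_be]
    injects into some [la] in [kappa], and as [kappa] is a strong limit the power set of [la] is too
    small to receive [kappa]. *)
Lemma regular_V al v : al \in kappa -> (forall z, z \in v <-> in_V al z) -> regular_over v.
Proof.
  revert v. induction (mem_wf ZU al) as [al _ IH]. intros v hal hv.
  pose (V := fun be => setof (small_V ZU be)).
  assert (hV : forall be z, z \in V be <-> in_V be z) by (intros; apply in_setof).
  pose (PV := fun be => setof (small_pow ZU (small_V ZU be))).
  assert (hPV : forall be x, x \in PV be <-> forall y, y \in x -> in_V be y) by (intros; apply in_setof).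
  apply (@regular_Union al PV).
  - destruct Hk as [_ [_ [reg _]]]. intros f hf. exact (reg al hal f hf).
  - intros be hbe.
    assert (hbe' : be \in kappa) by eauto using ordinal_trans.
    pose proof (IH be hbe (V be) hbe' (hV be)) as r. apply not_card_le_of_regular in r.
    destruct (card_le_inaccessible (V be)) as [h|[la [hla [e [e1 e2]]]]]; [tauto|].
    destruct (zfc_power ZU la) as [p hp].
    assert (hlt : card_lt p kappa) by (apply Hk with (la := la); auto).
    apply regular_of_not_card_le. intros hle. apply hlt.
    eapply card_le_trans; [exact hle|].
    pose (g := fun S => setof (small_image ZU e (small_mem S))).
    assert (hg : forall S z, z \in g S <-> exists x, x \in S /\ z = e x) by (intros; apply in_setof).
    exists g. split.
    + intros S hS. apply hp. intros z hz. apply hg in hz. destruct hz as [x [hx ->]].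
      apply e1. apply hV. apply (proj1 (hPV be S)); auto.
    + assert (H : forall S S', S \in PV be -> S' \in PV be -> g S = g S' -> forall z, z \in S -> z \in S').
      { intros S S' hS hS' E z hz. assert (h : e z \in g S') by (rewrite <- E; apply hg; eauto).
        apply hg in h. destruct h as [x [hx ex]].
        apply e2 in ex; [now subst|apply hV; apply (proj1 (hPV be S) hS); auto|
          apply hV; apply (proj1 (hPV be S') hS'); auto]. }
      intros S S' hS hS' E. apply (set_ext ZU). intros z. split; eauto.
  - intros z hz. apply hv in hz. destruct hz as [be h1 h2]. exists be. split; auto.
    apply hPV. auto.
Qed.

Lemma in_V_inaccessible x : in_V kappa x -> exists be, be \in kappa /\ in_V be x.
Proof.
  intros [be h1 h2]. exists (succ ZU be). split; [apply inaccessible_succ; auto|].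
  apply In_V with (be := be); auto. apply in_succ; auto.
Qed.

Lemma regular_in_V x : in_V kappa x -> regular_over x.
Proof.
  intros h. destruct (in_V_inaccessible h) as [be [h1 h2]].
  destruct (small_V ZU be) as [v hv].
  apply (regular_sub (regular_V h1 hv)). intros z hz. apply hv.
  eapply in_V_mem; eauto using ordinal_mem.
Qed.

Let V := Vset kappa.

Lemma Vset_inj (x y : V) : proj1_sig x = proj1_sig y -> x = y.
Proof.
  destruct x as [x hx], y as [y hy]. simpl. intros ->.
  now rewrite (proof_irrelevance _ hx hy).
Qed.

Lemma Vset_down (x : V) z : z \in proj1_sig x -> in_V kappa z.
Proof. destruct x as [x hx]. simpl. eauto using in_V_mem. Qed.

Lemma Vset_small (P : V -> Prop) ga : ga \in kappa ->
  (forall z : V, P z -> in_V ga (proj1_sig z)) -> exists b : V, forall z : V, z \in b <-> P z.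
Proof.
  intros hga h.
  destruct (small_sub ZU (Q := fun u => exists z : V, P z /\ u = proj1_sig z) (small_V ZU ga)) as [b hb].
  { intros u [z [hz ->]]. auto. }
  assert (hb' : in_V kappa b).
  { apply In_V with (be := ga); auto. intros y hy. apply hb in hy. destruct hy as [z [hz ->]]. auto. }
  exists (exist _ b hb'). intros z. change (proj1_sig z \in b <-> P z). rewrite hb. split.
  - intros [z' [h1 h2]]. apply Vset_inj in h2. now subst.
  - eauto.
Qed.

Lemma Vset_pair_bound (x y : V) : exists ga, ga \in kappa /\ in_V ga (proj1_sig x) /\ in_V ga (proj1_sig y).
Proof.
  destruct x as [x hx], y as [y hy]. simpl.
  destruct (in_V_inaccessible hx) as [a [a1 a2]]. destruct (in_V_inaccessible hy) as [b [b1 b2]].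
  assert (oa : ordinal a) by eauto using ordinal_mem.
  assert (ob : ordinal b) by eauto using ordinal_mem.
  destruct (ordinal_total ZU oa ob) as [h|[h|h]].
  - exists b. eauto using in_V_mono.
  - subst b. eauto.
  - exists a. eauto using in_V_mono.
Qed.

(** By [Vset_small] each axiom amounts to bounding the ranks of the intended elements below [kappa].
    For most axioms the bound comes from the ranks of the given sets; Infinity uses that omega is in
    [kappa], Replacement uses regularity. *)
Lemma ZFC_Vset : ZFC V.
Proof.
  split.
  - intros x y h. apply Vset_inj. apply (set_ext ZU). intros z. split; intros hz.
    + apply (h (exist _ z (Vset_down hz))). exact hz.
    + apply (h (exist _ z (Vset_down hz))). exact hz.
  - intros x hx. destruct (zfc_foundation ZU (x := proj1_sig x)) as [y [h1 h2]].
    + intros e. apply hx. intros z hz. exact (e _ hz).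
    + exists (exist _ y (Vset_down h1)). split; [exact h1|]. intros z hz. apply (h2 (proj1_sig z) hz).
  - intros x y. destruct (Vset_pair_bound x y) as [ga [h1 [h2 h3]]].
    apply (Vset_small (P := fun z : V => z = x \/ z = y) h1). intros z [->| ->]; auto.
  - intros x. destruct (Vset_pair_bound x x) as [ga [h1 [h2 _]]].
    apply (Vset_small (P := fun z : V => exists y : V, y \in x /\ z \in y) h1). intros z [y [h3 h4]].
    eapply in_V_mem; [eauto using ordinal_mem| |exact h4].
    eapply in_V_mem; [eauto using ordinal_mem| |exact h3]. auto.
  - intros x. destruct (Vset_pair_bound x x) as [ga [h1 [h2 _]]].
    apply (Vset_small (P := fun z : V => incl z x) h1). intros z hz.
    apply (in_V_sub h2). intros y hy. apply (hz (exist _ y (Vset_down hy))). exact hy.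
  - destruct omega_in_inaccessible as [w [hw1 hw]].
    assert (ow : ordinal w) by eauto using ordinal_mem.
    assert (hin : forall n, in_V w (num ZU n)).
    { intros n. induction n as [n IH] using (well_founded_induction lt_wf).
      apply In_V with (be := num ZU n); [apply hw; eauto|].
      assert (H : forall m, m < n -> in_V (num ZU n) (num ZU m)).
      { intros m. induction m as [m IHm] using (well_founded_induction lt_wf). intros hm.
        apply In_V with (be := num ZU m); [apply num_lt; auto|].
        intros y hy. apply in_num in hy. destruct hy as [k [hk ->]].
        clear - hk. revert k hk. induction m as [|m IH]; [lia|]. intros k hk.
        apply In_V with (be := num ZU m); [apply num_lt; auto|].
        intros y hy. apply in_num in hy. destruct hy as [j [hj ->]].
        apply IH. lia. }
      intros y hy. apply in_num in hy. destruct hy as [m [hm ->]]. auto. }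
    destruct (@Vset_small (fun z : V => exists n, proj1_sig z = num ZU n) w hw1) as [b hb].
    { intros z [n ->]. auto. }
    assert (hin' : forall n, in_V kappa (num ZU n)) by (intros; eauto using in_V_mono).
    exists b. split.
    + exists (exist _ (num ZU 0) (hin' 0)). split.
      * intros z hz. exact (in_empty hz).
      * apply hb. exists 0. auto.
    + intros x hx. apply hb in hx. destruct hx as [n hn].
      exists (exist _ (num ZU (S n)) (hin' (S n))). split.
      * intros z. change (proj1_sig z \in succ ZU (num ZU n) <-> proj1_sig z \in proj1_sig x \/ z = x).
        rewrite in_succ, hn. split; (intros [h|h]; [auto|]).
        -- right. apply Vset_inj. congruence.
        -- right. subst z. auto.
      * apply hb. exists (S n). auto.
  - intros x h1 h2.
    destruct (zfc_choice ZU (x := proj1_sig x)) as [t ht].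
    + intros y hy e. apply (h1 (exist _ y (Vset_down hy)) hy). intros z hz. exact (e _ hz).
    + intros y y' z hy hy' hz hz'.
      assert (hz0 : in_V kappa z) by (apply (@Vset_down (exist _ y (Vset_down hy)) z hz)).
      pose proof (h2 (exist _ y (Vset_down hy)) (exist _ y' (Vset_down hy')) (exist _ z hz0) hy hy' hz hz') as e.
      now inversion e.
    + destruct (Vset_pair_bound x x) as [ga [g1 [g2 _]]].
      destruct (@Vset_small (fun z : V => proj1_sig z \in t /\ exists y : V, y \in x /\ z \in y) ga g1) as [b hb].
      { intros z [_ [y [h3 h4]]].
        eapply in_V_mem; [eauto using ordinal_mem| |exact h4].
        eapply in_V_mem; [eauto using ordinal_mem| |exact h3]. auto. }
      exists b. intros y hy. destruct (ht (proj1_sig y) hy) as [z [[z1 z2] z3]].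
      exists (exist _ z (Vset_down z1)). split; [split; [exact z1|]|].
      * apply hb. split; [exact z2|]. exists y. split; auto.
      * intros z' [h3 h4]. apply Vset_inj. simpl. apply z3. split; [exact h3|].
        apply hb in h4. tauto.
  - intros P _ a. destruct (Vset_pair_bound a a) as [ga [h1 [h2 _]]].
    apply (Vset_small (P := fun z : V => z \in a /\ P z) h1). intros z [h3 _].
    eapply in_V_mem; [eauto using ordinal_mem| |exact h3]. auto.
  - intros R _ F a.
    (* [f u] bounds the rank of the image of [u], and is [empty] where there is no image; regularity
       over [a] then bounds all values of [f]. *)
    destruct (choice_on (B := U) kappa (P := fun u => u \in proj1_sig a)
      (R := fun u be => be \in kappa /\ forall x z : V, proj1_sig x = u -> R x z -> in_V be (proj1_sig z)))
      as [f hf].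
    + intros u hu. destruct (classic (exists x z : V, proj1_sig x = u /\ R x z)) as [[x [z [e r]]]|n].
      * destruct (in_V_inaccessible (proj2_sig z)) as [be [b1 b2]]. exists be. split; auto.
        intros x' z' e' r'. assert (x' = x) by (apply Vset_inj; congruence). subst x'.
        now rewrite (F _ _ _ r' r).
      * exists (empty ZU). split; [apply empty_in_inaccessible|]. intros x z e r. exfalso. eauto.
    + destruct (regular_in_V (proj2_sig a) (f := f)) as [ga [g1 g2]].
      { intros z hz. apply hf; auto. }
      apply (Vset_small (P := fun z : V => exists x : V, x \in a /\ R x z) g1).
      intros z [x [h1 h2]]. apply in_V_mono with (be := f (proj1_sig x)); eauto using ordinal_mem.
      apply (proj2 (hf _ h1) x z eq_refl h2).
Qed.

End Inaccessible.

(** * Formulas with numbered variables *)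

(** De Bruijn formulas with natural numbers as variables. A single type replaces the family
    [form Empty_set A], so codes can be decoded without knowing the type of the free variables. *)
Inductive raw : Set :=
| rEq (i j : nat)
| rMem (i j : nat)
| rNeg (r : raw)
| rConj (r r' : raw)
| rAll (r : raw).

Fixpoint code (r : raw) : nat :=
  match r with
  | rEq i j => 5 * Cantor.to_nat (i, j)
  | rMem i j => 5 * Cantor.to_nat (i, j) + 1
  | rNeg r => 5 * code r + 2
  | rConj r r' => 5 * Cantor.to_nat (code r, code r') + 3
  | rAll r => 5 * code r + 4
  end.

Fixpoint fv_below (n : nat) (r : raw) : Prop :=
  match r with
  | rEq i j | rMem i j => i < n /\ j < n
  | rNeg r => fv_below n r
  | rConj r r' => fv_below n r /\ fv_below n r'
  | rAll r => fv_below (S n) r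
  end.

Lemma to_nat_bounds i j : i <= Cantor.to_nat (i, j) /\ j <= Cantor.to_nat (i, j).
Proof. pose proof (Cantor.to_nat_non_decreasing i j). lia. Qed.

Lemma code_inj r r' : code r = code r' -> r = r'.
Proof.
  revert r'. induction r; intros r' e; destruct r'; cbn [code] in e; try lia.
  - assert (E : Cantor.to_nat (i, j) = Cantor.to_nat (i0, j0)) by lia.
    apply Cantor.to_nat_inj in E. congruence.
  - assert (E : Cantor.to_nat (i, j) = Cantor.to_nat (i0, j0)) by lia.
    apply Cantor.to_nat_inj in E. congruence.
  - f_equal. apply IHr. lia.
  - assert (E : Cantor.to_nat (code r1, code r2) = Cantor.to_nat (code r'1, code r'2)) by lia.
    apply Cantor.to_nat_inj in E. injection E. intros. f_equal; auto.
  - f_equal. apply IHr. lia.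
Qed.

(** The residue modulo 5 tells the constructor. As every number codes a formula, the internal side
    needs no predicate for well-formed codes. *)
Lemma code_onto n : exists r, code r = n.
Proof.
  induction n as [n IH] using (well_founded_induction lt_wf).
  pose proof (Nat.div_mod_eq n 5) as h. pose proof (Nat.mod_upper_bound n 5) as h'.
  destruct (Cantor.of_nat (n / 5)) as [i j] eqn:e.
  assert (e' : Cantor.to_nat (i, j) = n / 5) by (rewrite <- e; apply Cantor.cancel_to_of).
  destruct (Nat.eq_dec (n mod 5) 0); [exists (rEq i j); cbn [code]; lia|].
  destruct (Nat.eq_dec (n mod 5) 1); [exists (rMem i j); cbn [code]; lia|].
  destruct (IH (n / 5)) as [r hr]; [lia|].
  destruct (Nat.eq_dec (n mod 5) 2); [exists (rNeg r); cbn [code]; lia|].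
  destruct (Nat.eq_dec (n mod 5) 4); [exists (rAll r); cbn [code]; lia|].
  pose proof (to_nat_bounds i j).
  destruct (IH i) as [r1 h1]; [lia|]. destruct (IH j) as [r2 h2]; [lia|].
  exists (rConj r1 r2). cbn [code]. rewrite h1, h2. lia.
Qed.

Lemma fv_below_mono n m r : n <= m -> fv_below n r -> fv_below m r.
Proof.
  revert n m. induction r; cbn; intros n m h H; try lia.
  - eauto.
  - destruct H; eauto.
  - apply IHr with (n := S n); auto; lia.
Qed.

Lemma fv_below_exists r : exists n, fv_below n r.
Proof.
  induction r; cbn.
  - exists (S (i + j)); lia.
  - exists (S (i + j)); lia.
  - auto.
  - destruct IHr1 as [n h], IHr2 as [m h']. exists (n + m).
    split; [apply fv_below_mono with (n := n)|apply fv_below_mono with (n := m)]; auto; lia.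
  - destruct IHr as [n h]. exists n. apply fv_below_mono with (n := n); auto.
Qed.

Fixpoint raw_of (A : Set) (v : A -> nat) (f : form Empty_set A) {struct f} : raw :=
  match f with
  | Eq _ x y => rEq (v x) (v y)
  | Mem _ x y => rMem (v x) (v y)
  | Pred c _ => match c with end
  | Neg f => rNeg (raw_of v f)
  | Conj f g => rConj (raw_of v f) (raw_of v g)
  | All f => rAll (raw_of (cons_env 0 (fun a => S (v a))) f)
  end.

Lemma code_raw_of (A : Set) (v : A -> nat) f : code (raw_of v f) = goedel v f.
Proof.
  revert v. induction f; intros v; cbn [raw_of code goedel]; auto.
  - destruct c.
  - rewrite IHf1, IHf2. reflexivity.
Qed.

Lemma raw_of_onto r : forall (A : Set) (v : A -> nat) n,
  (forall i, i < n -> exists a, v a = i) -> fv_below n r -> exists f, raw_of v f = r.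
Proof.
  induction r; cbn; intros A v n hv h.
  - destruct h as [h1 h2]. destruct (hv i h1) as [a <-], (hv j h2) as [b <-].
    exists (Eq _ a b). auto.
  - destruct h as [h1 h2]. destruct (hv i h1) as [a <-], (hv j h2) as [b <-].
    exists (Mem _ a b). auto.
  - destruct (IHr A v n hv h) as [f <-]. exists (Neg f). auto.
  - destruct h as [h1 h2]. destruct (IHr1 A v n hv h1) as [f <-], (IHr2 A v n hv h2) as [g <-].
    exists (Conj f g). auto.
  - destruct (IHr (option A) (cons_env 0 (fun a => S (v a))) (S n)) as [f <-]; auto.
    + intros [|i] hi.
      * exists None. auto.
      * destruct (hv i) as [a <-]; [lia|]. exists (Some a). auto.
    + exists (All f). auto.
Qed.

Lemma fv_below_raw_of (A : Set) (v : A -> nat) f n :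
  (forall a, v a < n) -> fv_below n (raw_of v f).
Proof.
  revert v n. induction f; intros v n h; cbn; auto.
  - destruct c.
  - apply IHf. intros [a|]; cbn; [specialize (h a)|]; lia.
Qed.

Definition var1 (n : nat) : option (Fin.t n) -> nat := cons_env 0 (fun i => S (fin_val i)).

Lemma var1_lt n a : @var1 n a < S n.
Proof.
  destruct a as [i|]; cbn; [|lia]. unfold fin_val. destruct (Fin.to_nat i) as [k h]. cbn. lia.
Qed.

Lemma var1_onto n i : i < S n -> exists a, @var1 n a = i.
Proof.
  destruct i as [|i]; intros h.
  - exists None. auto.
  - exists (Some (Fin.of_nat_lt (n := n) (p := i) ltac:(lia))). cbn. unfold fin_val.
    rewrite Fin.to_nat_of_nat. auto.
Qed.

Definition raw1 (n : nat) (f : form Empty_set (option (Fin.t n))) : raw := raw_of (@var1 n) f.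

Lemma code_raw1 n (f : form Empty_set (option (Fin.t n))) : code (raw1 f) = goedel1 f.
Proof. apply code_raw_of. Qed.

Lemma raw1_onto n r : fv_below (S n) r -> exists f : form Empty_set (option (Fin.t n)), raw1 f = r.
Proof. intros h. apply raw_of_onto with (n := S n); auto. apply var1_onto. Qed.

Lemma fv_below_raw1 n (f : form Empty_set (option (Fin.t n))) : fv_below (S n) (raw1 f).
Proof. apply fv_below_raw_of. apply var1_lt. Qed.

Definition scons (T : Type) (x : T) (E : nat -> T) (n : nat) : T :=
  match n with 0 => x | S m => E m end.

(* One recursion covers truth in [M], truth in [V_al] (the worlds are ordinals and [D] bounds
   the quantifiers) and forcing (the worlds are conditions). *)
Section Kripke.
Variables (W T : Type) (Le : W -> W -> Prop) (D : W -> T -> Prop) (R : W -> T -> T -> Prop).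

Fixpoint ksat (w : W) (r : raw) (E : nat -> T) {struct r} : Prop :=
  match r with
  | rEq i j => E i = E j
  | rMem i j => R w (E i) (E j)
  | rNeg r => forall w', Le w w' -> ~ ksat w' r E
  | rConj r r' => ksat w r E /\ ksat w r' E
  | rAll r => forall z, D w z -> ksat w r (scons z E)
  end.

Lemma ksat_fv n r : forall w E E', fv_below n r -> (forall i, i < n -> E i = E' i) ->
  (ksat w r E <-> ksat w r E').
Proof.
  revert n. induction r; cbn; intros n w E E' h e.
  - rewrite (e i), (e j); tauto.
  - rewrite (e i), (e j); tauto.
  - split; intros H w' hw; rewrite (IHr n w') || rewrite <- (IHr n w'); eauto.
    + intros i hi; symmetry; auto.
  - rewrite (IHr1 n w E E'), (IHr2 n w E E'); tauto.
  - assert (H : forall z, ksat w r (scons z E) <-> ksat w r (scons z E')).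
    { intros z. apply (IHr (S n)); auto. intros [|i] hi; cbn; auto. apply e. lia. }
    split; intros H' z hz; apply H; auto.
Qed.

End Kripke.

Definition tsat (M : Type) (R : M -> M -> Prop) : raw -> (nat -> M) -> Prop :=
  ksat (W := unit) (fun _ _ => True) (fun _ _ => True) (fun _ => R) tt.

Lemma sat_raw_of (M : mstruct) (A : Set) (f : form Empty_set A) :
  forall (v : A -> nat) (e : A -> M) (E : nat -> M), (forall a, E (v a) = e a) ->
  (sat (@no_pred M) e f <-> tsat (@mem M) (raw_of v f) E).
Proof.
  unfold tsat. induction f; intros v e E h; cbn.
  - now rewrite !h.
  - now rewrite !h.
  - destruct c.
  - rewrite IHf by eauto. split; [intros H w _; destruct w; exact H|]. intros H; apply (H tt I).
  - rewrite IHf1, IHf2 by eauto. tauto.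
  - assert (H : forall x, sat (@no_pred M) (cons_env x e) f <->
      ksat (fun _ _ : unit => True) (fun _ _ => True) (fun _ => @mem M) tt
       (raw_of (cons_env 0 (fun a : A => S (v a))) f) (scons x E)).
    { intros x. apply IHf. intros [a|]; cbn; auto. }
    split; intros H' x; [intros _|]; apply H; auto.
Qed.

(** Quantifiers over the subtype [Vset be] become quantifiers over [M] bounded by the domain of the
    world [be]; this world sees only itself, so negation is classical. *)
Lemma sat_Vset_raw_of (M : mstruct) (be : M) (A : Set) (f : form Empty_set A) :
  forall (v : A -> nat) (e : A -> Vset be) (E : nat -> M), (forall a, E (v a) = proj1_sig (e a)) ->
  (sat (@no_pred (Vset be)) e f <->
   ksat eq (fun w z => in_V w z) (fun _ => @mem M) be (raw_of v f) E).
Proof.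
  assert (inj : forall u u' : Vset be, proj1_sig u = proj1_sig u' <-> u = u').
  { intros [u hu] [u' hu']. cbn. split; [|congruence]. intros ->.
    now rewrite (proof_irrelevance _ hu hu'). }
  induction f; intros v e E h; cbn.
  - rewrite !h. symmetry. apply inj.
  - now rewrite !h.
  - destruct c.
  - rewrite IHf by eauto. split; [intros H w' <-|intros H]; auto.
  - rewrite IHf1, IHf2 by eauto. tauto.
  - assert (H : forall x : Vset be, sat (@no_pred (Vset be)) (cons_env x e) f <->
      ksat eq (fun w z => in_V w z) (fun _ => @mem M) be
       (raw_of (cons_env 0 (fun a : A => S (v a))) f) (scons (proj1_sig x) E)).
    { intros x. apply IHf. intros [a|]; cbn; auto. }
    split; intros H' x.
    + intros hx. apply (H (exist _ x hx)). apply H'.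
    + apply H, H'. apply proj2_sig.
Qed.

(** * Definability *)

(* [dn N A R]: the relation [R] between assignments of the variables in [A] and further data in
   [Z] (such as class variables) is definable in the sense [N].  What is proved for every [N]
   holds both for first-order definability and in the presence of class quantifiers. *)
Record notion (M : mstruct) (Z : Type) : Type := Notion {
  dn :> forall A : Set, (Z -> (A -> M) -> Prop) -> Prop;
  dn_ext : forall (A : Set) (R R' : Z -> (A -> M) -> Prop),
    (forall z e, R' z e <-> R z e) -> dn R -> dn R';
  dn_eq : forall (A : Set) (a b : A), dn (fun _ e => e a = e b);
  dn_mem : forall (A : Set) (a b : A), dn (fun _ e => e a \in e b);
  dn_not : forall (A : Set) (R : Z -> (A -> M) -> Prop), dn R -> dn (fun z e => ~ R z e);
  dn_and : forall (A : Set) (R R' : Z -> (A -> M) -> Prop),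
    dn R -> dn R' -> dn (fun z e => R z e /\ R' z e);
  dn_all' : forall (A : Set) (R : Z -> (option A -> M) -> Prop),
    dn R -> dn (fun z e => forall x : M, R z (cons_env x e)) }.

Section Closure.
Variables (M : mstruct) (Z : Type) (N : notion M Z) (A : Set).
Implicit Types R P Q : Z -> (A -> M) -> Prop.

Lemma dn_all (Q : Z -> (A -> M) -> M -> Prop) :
  N (option A) (fun z e => Q z (fun a => e (Some a)) (e None)) ->
  N A (fun z e => forall x, Q z e x).
Proof. exact (@dn_all' _ _ N A (fun z e => Q z (fun a => e (Some a)) (e None))). Qed.

Lemma dn_ex (Q : Z -> (A -> M) -> M -> Prop) :
  N (option A) (fun z e => Q z (fun a => e (Some a)) (e None)) ->
  N A (fun z e => exists x, Q z e x).
Proof.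
  intros h. generalize (dn_not (dn_all (Q := fun z e x => ~ Q z e x) (dn_not h))). apply dn_ext.
  intros z e. split; [firstorder|]. intros H. apply NNPP. intros n. apply H.
  intros x q. eauto.
Qed.

Lemma dn_or P Q : N A P -> N A Q -> N A (fun z e => P z e \/ Q z e).
Proof.
  intros h h'. apply dn_not in h. apply dn_not in h'. generalize (dn_not (dn_and h h')).
  apply dn_ext. intros z e. tauto.
Qed.

Lemma dn_imp P Q : N A P -> N A Q -> N A (fun z e => P z e -> Q z e).
Proof.
  intros h h'. apply dn_not in h. generalize (dn_or h h').
  apply dn_ext. intros z e. tauto.
Qed.

Lemma dn_iff P Q : N A P -> N A Q -> N A (fun z e => P z e <-> Q z e).
Proof. intros h h'. apply dn_and; apply dn_imp; auto. Qed.

Lemma dn_false : N A (fun _ _ => False).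
Proof.
  generalize (dn_not (dn_all (Q := fun _ _ x => x = x) (@dn_eq _ _ N _ None None))).
  apply dn_ext. intros z e. split; [tauto|]. intros H. apply H. auto.
Qed.

Lemma dn_true : N A (fun _ _ => True).
Proof. generalize (dn_not dn_false). apply dn_ext. tauto. Qed.

Lemma dn_exu (Q : Z -> (A -> M) -> M -> Prop) :
  N A (fun z e => exists x, Q z e x /\ forall y, Q z e y -> x = y) ->
  N A (fun z e => exists! x, Q z e x).
Proof. auto. Qed.

End Closure.

(** Definability of a relation applied to variables. Being classes, these facts are found by
    instance search when [dtac] reaches a named relation. *)
Class D1 M Z (N : notion M Z) (R : M -> Prop) : Prop :=
  d1 : forall (A : Set) (a : A), N A (fun _ e => R (e a)).
Class D2 M Z (N : notion M Z) (R : M -> M -> Prop) : Prop :=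
  d2 : forall (A : Set) (a b : A), N A (fun _ e => R (e a) (e b)).
Class D3 M Z (N : notion M Z) (R : M -> M -> M -> Prop) : Prop :=
  d3 : forall (A : Set) (a b c : A), N A (fun _ e => R (e a) (e b) (e c)).
Class D4 M Z (N : notion M Z) (R : M -> M -> M -> M -> Prop) : Prop :=
  d4 : forall (A : Set) (a b c d : A), N A (fun _ e => R (e a) (e b) (e c) (e d)).

(** Follows the logical shape of the goal down to named relations. Implication is tried before the
    universal quantifier, being a product as well. Class atoms are left open, since only [cl_notion]
    has them. *)
Ltac dtac := cbv beta; lazymatch goal with
  | |- dn ?N (fun z e => @?P z e /\ @?Q z e) => apply (@dn_and _ _ N _ P Q); dtac
  | |- dn ?N (fun z e => @?P z e <-> @?Q z e) => apply (@dn_iff _ _ N _ P Q); dtac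
  | |- dn ?N (fun z e => @?P z e \/ @?Q z e) => apply (@dn_or _ _ N _ P Q); dtac
  | |- dn ?N (fun z e => ~ @?P z e) => apply (@dn_not _ _ N _ P); dtac
  | |- dn ?N (fun z e => False) => apply (@dn_false _ _ N)
  | |- dn ?N (fun z e => True) => apply (@dn_true _ _ N)
  | |- @dn ?M _ ?N _ (fun z e => exists x : car ?M, @?Q z e x) => apply (@dn_ex _ _ N _ Q); dtac
  | |- dn ?N (fun z e => exists! x, @?Q z e x) => apply (@dn_exu _ _ N _ Q); dtac
  | |- dn ?N (fun z e => @?P z e -> @?Q z e) => apply (@dn_imp _ _ N _ P Q); dtac
  | |- dn ?N (fun z e => forall x, @?Q z e x) => apply (@dn_all _ _ N _ Q); dtac
  | |- dn _ (fun z e => proj1_sig (z ?b) (e ?a)) => idtac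
  | |- dn ?N (fun z e => ?R (e ?a) (e ?b) (e ?c) (e ?d)) => refine (@d4 _ _ N R _ _ a b c d)
  | |- dn ?N (fun z e => ?R (e ?a) (e ?b) (e ?c)) => refine (@d3 _ _ N R _ _ a b c)
  | |- dn ?N (fun z e => ?R (e ?a) (e ?b)) => refine (@d2 _ _ N R _ _ a b)
  | |- dn ?N (fun z e => ?R (e ?a)) => refine (@d1 _ _ N R _ _ a)
  | |- dn _ _ => idtac
  end.

Section Basic.
Variables (M : mstruct) (Z : Type) (N : notion M Z).

#[export] Instance d_mem : D2 N (@mem M).
Proof. intros A a b. apply dn_mem. Qed.
#[export] Instance d_eq : D2 N (@eq M).
Proof. intros A a b. apply dn_eq. Qed.
#[export] Instance d_is_empty : D1 N (@is_empty M).
Proof. intros A a. unfold is_empty. dtac. Qed.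
#[export] Instance d_incl : D2 N (@incl M).
Proof. intros A a b. unfold incl. dtac. Qed.
#[export] Instance d_is_upair : D3 N (@is_upair M).
Proof. intros A a b c. unfold is_upair. dtac. Qed.
#[export] Instance d_is_succ : D2 N (@is_succ M).
Proof. intros A a b. unfold is_succ. dtac. Qed.
#[export] Instance d_is_opair : D3 N (@is_opair M).
Proof. intros A a b c. unfold is_opair. dtac. Qed.
#[export] Instance d_is_num n : D1 N (@is_num M n).
Proof. induction n; intros A a; cbn [is_num]; dtac. Qed.
#[export] Instance d_transitive_set : D1 N (@transitive_set M).
Proof. intros A a. unfold transitive_set. dtac. Qed.
#[export] Instance d_ordinal : D1 N (@ordinal M).
Proof. intros A a. unfold ordinal. dtac. Qed.
#[export] Instance d_limit_ordinal : D1 N (@limit_ordinal M).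
Proof. intros A a. unfold limit_ordinal. dtac. Qed.
#[export] Instance d_condition : D1 N (@condition M).
Proof. intros A a. unfold condition. dtac. Qed.

End Basic.

(** * Natural numbers, sequences and formula numbers as elements of the model *)

Section Coding.
Variable M : mstruct.
Hypothesis ZM : ZFC M.
Variables (Z : Type) (N : notion M Z).
Implicit Types x y z a b s t i j k : M.

Local Notation num := (num ZM).
Local Notation opair := (opair ZM).
Local Notation seqc := (seqc ZM).

Definition is_nat x := exists n, x = num n.

(** The numerals are the elements common to all inductive sets, and they form such a set
    themselves. *)
#[export] Instance d_is_nat : D1 N is_nat.
Proof.
  intros A a.
  apply (@dn_ext _ _ N A (fun _ e => forall w : M,
    (forall x, is_empty x -> x \in w) ->
    (forall x y, x \in w -> is_succ x y -> y \in w) -> e a \in w)).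
  2: dtac.
  intros _ e. split.
  - intros [n ->] w h1 h2. induction n as [|n IH]; cbn.
    + apply h1. now apply is_emptyE with (ZM := ZM).
    + apply (h2 _ _ IH). now apply is_succE with (ZM := ZM).
  - intros H. destruct (small_num ZM) as [w hw]. apply hw. apply H.
    + intros x h. apply is_emptyE with (ZM := ZM) in h. apply hw. exists 0. auto.
    + intros x y h1 h2. apply is_succE with (ZM := ZM) in h2. apply hw in h1.
      destruct h1 as [n ->]. apply hw. exists (S n). auto.
Qed.

Definition at_pos s i x := exists p : M, is_opair i x p /\ p \in s.

Lemma at_posE s i x : at_pos s i x <-> opair i x \in s.
Proof.
  unfold at_pos. split.
  - intros [p [h1 h2]]. apply is_opairE with (ZM := ZM) in h1. now subst.
  - intros h. exists (opair i x). split; auto. now apply is_opairE with (ZM := ZM).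
Qed.

Lemma at_pos_seqc E i x : at_pos (seqc E) i x <-> exists n, i = num n /\ x = E n.
Proof.
  rewrite at_posE, in_seqc. split; intros [n h]; exists n.
  - now apply opair_inj in h.
  - destruct h as [-> ->]. auto.
Qed.

Lemma at_pos_num E n x : at_pos (seqc E) (num n) x <-> x = E n.
Proof. rewrite at_posE. apply opair_seqc. Qed.

#[export] Instance d_at_pos : D3 N at_pos.
Proof. intros A a b c. unfold at_pos. dtac. Qed.

Definition is_seqc s := exists E, s = seqc E.

Lemma is_seqcE s : is_seqc s <->
  (forall p, p \in s -> exists i x, is_nat i /\ is_opair i x p) /\
  (forall i, is_nat i -> exists! x, at_pos s i x).
Proof.
  split.
  - intros [E ->]. split.
    + intros p hp. apply in_seqc in hp. destruct hp as [n ->].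
      exists (num n), (E n). split; [exists n; auto|]. now apply is_opairE with (ZM := ZM).
    + intros i [n ->]. exists (E n). split.
      * apply at_pos_seqc. eauto.
      * intros y hy. apply at_pos_seqc in hy. destruct hy as [m [e ->]].
        apply num_inj in e. now subst.
  - intros [h1 h2].
    destruct (choice_fun (R := fun n x => at_pos s (num n) x)) as [E hE].
    { intros n. destruct (h2 (num n)) as [x [hx _]]; eauto. exists n; auto. }
    exists E. apply (set_ext ZM). intros p. rewrite in_seqc. split.
    + intros hp. destruct (h1 p hp) as [i [x [[n ->] h]]]. exists n.
      apply is_opairE with (ZM := ZM) in h. subst p. f_equal.
      destruct (h2 (num n)) as [y [_ hy]]; [exists n; auto|].
      rewrite <- (hy x), <- (hy (E n)); auto. now apply at_posE.
    + intros [n ->]. apply at_posE. auto.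
Qed.

#[export] Instance d_is_seqc : D1 N is_seqc.
Proof. intros A a. eapply dn_ext; [intros z e; apply is_seqcE|]. dtac. Qed.

Definition cons_seq x s s' := exists E, s = seqc E /\ s' = seqc (scons x E).

Lemma cons_seqE x s s' : cons_seq x s s' <->
  is_seqc s /\ is_seqc s' /\ (forall o, is_num 0 o -> at_pos s' o x) /\
  (forall i j y, is_succ i j -> at_pos s i y -> at_pos s' j y).
Proof.
  split.
  - intros [E [-> ->]]. split; [exists E; auto|]. split; [exists (scons x E); auto|]. split.
    + intros o ho. apply is_numE with (ZM := ZM) in ho. subst o. apply at_pos_seqc. exists 0. auto.
    + intros i j y h1 h2. apply is_succE with (ZM := ZM) in h1. apply at_pos_seqc in h2.
      destruct h2 as [n [-> ->]]. subst j. apply at_pos_seqc. exists (S n). auto.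
  - intros [[E ->] [[E' ->] [h1 h2]]]. exists E. split; auto. f_equal.
    apply functional_extensionality. intros [|n]; cbn.
    + assert (h : at_pos (seqc E') (num 0) x) by (apply h1; now apply is_numE with (ZM := ZM)).
      apply at_pos_seqc in h. destruct h as [m [e ->]]. apply num_inj in e. now subst.
    + assert (h : at_pos (seqc E') (num (S n)) (E n)).
      { apply h2 with (i := num n); [now apply is_succE with (ZM := ZM)|]. apply at_pos_seqc. eauto. }
      apply at_pos_seqc in h. destruct h as [m [e ->]]. apply num_inj in e. now subst.
Qed.

#[export] Instance d_cons_seq : D3 N cons_seq.
Proof. intros A a b c. eapply dn_ext; [intros z e; apply cons_seqE|]. dtac. Qed.

(** Unary functions are padded with a dummy argument, so that composition and recursion need a
    single shape. *)
Definition graph (f : nat -> nat -> nat) x y z :=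
  exists n m, x = num n /\ y = num m /\ z = num (f n m).

Lemma graph_num f n m z : graph f (num n) (num m) z <-> z = num (f n m).
Proof.
  split; [|intros ->; exists n, m; auto].
  intros [n' [m' [e [e' ->]]]]. apply num_inj in e, e'. now subst.
Qed.

Lemma d_graph_ext f g : (forall n m, f n m = g n m) -> D3 N (graph f) -> D3 N (graph g).
Proof.
  intros e. replace g with f; auto. apply functional_extensionality. intros n.
  apply functional_extensionality. auto.
Qed.

Instance d_graph_comp f g h : D3 N (graph f) -> D3 N (graph g) -> D3 N (graph h) ->
  D3 N (graph (fun n m => f (g n m) (h n m))).
Proof.
  intros df dg dh A a b c.
  apply (@dn_ext _ _ N A (fun _ e => exists u v, graph g (e a) (e b) u /\ graph h (e a) (e b) v /\
     graph f u v (e c))).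
  2: dtac.
  intros _ e. split.
  - intros [n [m [-> [-> ->]]]]. exists (num (g n m)), (num (h n m)). now rewrite !graph_num.
  - intros [u [v [[n [m [-> [-> ->]]]] [h1 h2]]]]. rewrite graph_num in h1. subst v.
    rewrite graph_num in h2. exists n, m. auto.
Qed.

Instance d_graph_l : D3 N (graph (fun n m => n)).
Proof.
  intros A a b c.
  apply (@dn_ext _ _ N A (fun _ e => is_nat (e a) /\ is_nat (e b) /\ e c = e a)).
  2: dtac.
  intros _ e. split.
  - intros [n [m [-> [-> ->]]]]. split; [exists n; auto|]. split; [exists m; auto|auto].
  - intros [[n ->] [[m ->] ->]]. exists n, m. auto.
Qed.

Instance d_graph_r : D3 N (graph (fun n m => m)).
Proof.
  intros A a b c.
  apply (@dn_ext _ _ N A (fun _ e => is_nat (e a) /\ is_nat (e b) /\ e c = e b)).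
  2: dtac.
  intros _ e. split.
  - intros [n [m [-> [-> ->]]]]. split; [exists n; auto|]. split; [exists m; auto|auto].
  - intros [[n ->] [[m ->] ->]]. exists n, m. auto.
Qed.

Instance d_graph_const (k : nat) : D3 N (graph (fun n m => k)).
Proof.
  intros A a b c.
  apply (@dn_ext _ _ N A (fun _ e => is_nat (e a) /\ is_nat (e b) /\ is_num k (e c))).
  2: dtac.
  intros _ e. rewrite is_numE with (ZM := ZM). split.
  - intros [n [m [-> [-> ->]]]]. split; [exists n; auto|]. split; [exists m; auto|auto].
  - intros [[n ->] [[m ->] ->]]. exists n, m. auto.
Qed.

Instance d_graph_S : D3 N (graph (fun n m => S n)).
Proof.
  intros A a b c.
  apply (@dn_ext _ _ N A (fun _ e => is_nat (e a) /\ is_nat (e b) /\ is_succ (e a) (e c))).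
  2: dtac.
  intros _ e. rewrite is_succE with (ZM := ZM). split.
  - intros [n [m [-> [-> ->]]]]. split; [exists n; auto|]. split; [exists m; auto|auto].
  - intros [[n ->] [[m ->] ->]]. exists n, m. auto.
Qed.

(* Every set of pairs closed under the recursion step contains the graph, and the graph itself
   is such a set. *)
Lemma d_graph_rec f g h : (forall n, f n 0 = g n n) -> (forall n m, f n (S m) = h m (f n m)) ->
  D3 N (graph g) -> D3 N (graph h) -> D3 N (graph f).
Proof.
  intros f0 fS dg dh A a b c.
  apply (@dn_ext _ _ N A (fun _ e => is_nat (e a) /\ is_nat (e b) /\ forall s : M,
    (forall o v, is_num 0 o -> graph g (e a) (e a) v -> at_pos s o v) ->
    (forall i v u j, at_pos s i v -> graph h i v u -> is_succ i j -> at_pos s j u) ->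
    at_pos s (e b) (e c))).
  2: dtac.
  intros _ e. split.
  - intros [n [m [-> [-> ->]]]]. split; [exists n; auto|]. split; [exists m; auto|].
    intros s h1 h2. induction m as [|m IH].
    + apply h1; [now apply is_numE with (ZM := ZM)|]. rewrite f0. now apply graph_num.
    + apply (h2 (num m) (num (f n m))); auto.
      * rewrite fS. now apply graph_num.
      * now apply is_succE with (ZM := ZM).
  - intros [[n ->] [[m ->] H]].
    assert (h1 : at_pos (seqc (fun m => num (f n m))) (num m) (e c)).
    { apply H.
      - intros o v ho hv. apply is_numE with (ZM := ZM) in ho. apply graph_num in hv. subst.
        apply at_pos_seqc. exists 0. now rewrite f0.
      - intros i v u j h1 h2 h3. apply at_pos_seqc in h1. destruct h1 as [i' [-> ->]].
        apply graph_num in h2. apply is_succE with (ZM := ZM) in h3. subst.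
        apply at_pos_seqc. exists (S i'). now rewrite fS. }
    apply at_pos_seqc in h1. destruct h1 as [m' [e1 ->]]. apply num_inj in e1. subst m'.
    exists n, m. auto.
Qed.

Instance d_graph_add : D3 N (graph Nat.add).
Proof.
  apply d_graph_rec with (g := fun n m => n) (h := fun n m => S m).
  - intros; lia.
  - intros; lia.
  - exact _.
  - exact (d_graph_comp d_graph_S d_graph_r d_graph_l).
Qed.

Lemma d_graph_add' f g : D3 N (graph f) -> D3 N (graph g) -> D3 N (graph (fun n m => f n m + g n m)).
Proof. intros. exact (@d_graph_comp Nat.add f g _ _ _). Qed.

Lemma d_graph_5 f (k : nat) : D3 N (graph f) -> D3 N (graph (fun n m => 5 * f n m + k)).
Proof.
  intros df. pose proof (d_graph_add' df df) as d2. pose proof (d_graph_add' d2 d2) as d4.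
  pose proof (d_graph_add' (d_graph_add' d4 df) (d_graph_const k)) as d5.
  revert d5. apply d_graph_ext. intros. lia.
Qed.

(** Cantor pairing of [n] and [m] is [m] plus the triangular number of [m + n], and triangular
    numbers arise by primitive recursion. *)
Instance d_graph_to_nat : D3 N (graph (fun n m => Cantor.to_nat (n, m))).
Proof.
  assert (dt : D3 N (graph (fun _ n => nat_rec (fun _ => nat) 0 (fun n m => S n + m) n))).
  { apply d_graph_rec with (g := fun _ _ => 0) (h := fun n m => S (n + m)); auto.
    - exact _.
    - exact (d_graph_comp d_graph_S d_graph_add d_graph_l). }
  exact (d_graph_add' d_graph_r
    (d_graph_comp dt d_graph_l (d_graph_add' d_graph_r d_graph_l))).
Qed.

Definition code_eq := graph (fun n m => code (rEq n m)).
Definition code_mem := graph (fun n m => code (rMem n m)).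
Definition code_neg x y := graph (fun n m => 5 * n + 2) x x y.
Definition code_conj := graph (fun n m => 5 * Cantor.to_nat (n, m) + 3).
Definition code_all x y := graph (fun n m => 5 * n + 4) x x y.

#[export] Instance d_code_eq : D3 N code_eq.
Proof.
  generalize (d_graph_5 0 d_graph_to_nat). apply d_graph_ext. intros; cbn [code]; lia.
Qed.
#[export] Instance d_code_mem : D3 N code_mem.
Proof. exact (d_graph_5 1 d_graph_to_nat). Qed.
#[export] Instance d_code_conj : D3 N code_conj.
Proof. exact (d_graph_5 3 d_graph_to_nat). Qed.
#[export] Instance d_code_neg : D2 N code_neg.
Proof. pose proof (d_graph_5 2 d_graph_l). intros A a b. unfold code_neg. dtac. Qed.
#[export] Instance d_code_all : D2 N code_all.
Proof. pose proof (d_graph_5 4 d_graph_l). intros A a b. unfold code_all. dtac. Qed.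

Definition is_code (r : raw) k := k = num (code r).

Lemma code_neg_num r k : code_neg (num (code r)) k <-> is_code (rNeg r) k.
Proof. apply graph_num. Qed.
Lemma code_all_num r k : code_all (num (code r)) k <-> is_code (rAll r) k.
Proof. apply graph_num. Qed.
Lemma code_conj_num r r' k : code_conj (num (code r)) (num (code r')) k <-> is_code (rConj r r') k.
Proof. apply graph_num. Qed.

Definition fvc k n := exists r m, is_code r k /\ n = num m /\ fv_below m r.

(** [fvc] is the least relation closed under the clauses of [fv_below]; it is a set, since both
    arguments are numerals, so quantifying over sets suffices. *)
#[export] Instance d_fvc : D2 N fvc.
Proof.
  intros A a b.
  apply (@dn_ext _ _ N A (fun _ e => is_nat (e b) /\ forall s : M,
    (forall i j k n, is_nat n -> code_eq i j k -> i \in n -> j \in n -> at_pos s k n) ->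
    (forall i j k n, is_nat n -> code_mem i j k -> i \in n -> j \in n -> at_pos s k n) ->
    (forall k k' n, is_nat n -> code_neg k k' -> at_pos s k n -> at_pos s k' n) ->
    (forall k l k' n, is_nat n -> code_conj k l k' -> at_pos s k n -> at_pos s l n -> at_pos s k' n) ->
    (forall k k' n n', is_nat n -> code_all k k' -> is_succ n n' -> at_pos s k n' -> at_pos s k' n) ->
    at_pos s (e a) (e b))).
  2: dtac.
  intros _ e. split.
  - intros [r [m [hr [-> h]]]]. split; [exists m; auto|]. intros s h1 h2 h3 h4 h5.
    revert h. unfold is_code in hr. rewrite hr. clear hr. revert m.
    assert (hn : forall m, is_nat (num m)) by (intros m; exists m; auto).
    induction r; intros m; cbn [fv_below]; intros h.
    + apply (h1 (num i) (num j)); auto; [exists i, j; auto| |]; apply num_lt; tauto.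
    + apply (h2 (num i) (num j)); auto; [exists i, j; auto| |]; apply num_lt; tauto.
    + apply (h3 (num (code r))); auto. now apply code_neg_num.
    + apply (h4 (num (code r1)) (num (code r2))); try tauto; auto.
      * now apply code_conj_num.
      * now apply IHr1.
      * now apply IHr2.
    + apply (h5 (num (code r)) _ (num m) (num (S m))); auto.
      * now apply code_all_num.
      * now apply is_succE with (ZM := ZM).
  - intros [[m hm] H].
    assert (hs : small (fun p => exists r m, p = opair (num (code r)) (num m) /\ fv_below m r)).
    { apply small_sub with (2 := small_prod ZM (small_num ZM) (small_num ZM)); auto.
      intros p [r [n [-> _]]]. exists (num (code r)), (num n). eauto. }
    destruct hs as [s hs].
    assert (hs' : forall k n, at_pos s k n <-> fvc k n).
    { intros k n. rewrite at_posE, hs. unfold fvc, is_code. split.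
      - intros [r [n' [e1 h]]]. apply opair_inj in e1. destruct e1. eauto 6.
      - intros [r [n' [-> [-> h]]]]. eauto. }
    apply hs'. apply H.
    + intros i j k n [n' ->] [i' [j' [-> [-> ->]]]] hi hj. apply hs'. rewrite num_lt in hi, hj.
      exists (rEq i' j'), n'. repeat split; auto.
    + intros i j k n [n' ->] [i' [j' [-> [-> ->]]]] hi hj. apply hs'. rewrite num_lt in hi, hj.
      exists (rMem i' j'), n'. repeat split; auto.
    + intros k k' n _ h1 h2. rewrite hs' in *. destruct h2 as [r [n' [-> [-> h]]]].
      apply code_neg_num in h1. exists (rNeg r), n'. auto.
    + intros k l k' n _ h1 h2 h3. rewrite hs' in *. destruct h2 as [r [n' [-> [-> h]]]].
      destruct h3 as [r' [n'' [-> [e1 h']]]]. apply num_inj in e1. subst n''.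
      apply code_conj_num in h1. exists (rConj r r'), n'. repeat split; auto.
    + intros k k' n n2 [n' ->] h1 h2 h3. rewrite hs' in *. apply is_succE with (ZM := ZM) in h2. subst n2.
      destruct h3 as [r [n'' [-> [e1 h]]]]. change (succ ZM (num n')) with (num (S n')) in e1.
      apply num_inj in e1. subst n''. apply code_all_num in h1. exists (rAll r), n'. auto.
Qed.

(** [in_V] is an inductive predicate with too large an extension to be a set. Restricted to a
    transitive set [t] containing both arguments it is a set, and the least relation on [t] closed
    under the rule. *)
#[export] Instance d_in_V : D2 N (@in_V M).
Proof.
  intros A a b.
  apply (@dn_ext _ _ N A (fun _ e => forall t s : M, transitive_set t -> e a \in t -> e b \in t ->
    (forall al x be, al \in t -> x \in t -> be \in al ->
      (forall y, y \in x -> at_pos s be y) -> at_pos s al x) -> at_pos s (e a) (e b))).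
  2: dtac.
  intros _ e. split.
  - intros h t s ht. induction h as [al x be h1 h2 IH]. intros h3 h4 h5.
    apply (h5 al x be); auto. intros y hy. apply IH; auto.
    + apply (ht al); auto.
    + apply (ht x); auto.
  - intros H. destruct (trcl ZM (upair ZM (e a) (e b))) as [t [ht h]].
    destruct (small_sub ZM (Q := fun p => exists al x, al \in t /\ x \in t /\ p = opair al x /\ in_V al x)
      (small_prod ZM (small_mem t) (small_mem t))) as [s hs].
    { intros p [al [x h']]. exists al, x. tauto. }
    assert (hs' : forall al x, at_pos s al x <-> al \in t /\ x \in t /\ in_V al x).
    { intros al x. rewrite at_posE, hs. split.
      - intros [al' [x' [h1 [h2 [e1 h3]]]]]. apply opair_inj in e1. destruct e1; subst. auto.
      - intros [h1 [h2 h3]]. eauto 6. }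
    apply (hs' (e a) (e b)). apply (H t); auto.
    + apply (ht _ h). apply in_upair. auto.
    + apply (ht _ h). apply in_upair. auto.
    + intros al x be h1 h2 h3 h4. apply hs'. repeat split; auto.
      apply In_V with (be := be); auto. intros y hy. apply hs'. auto.
Qed.

End Coding.

(** * Partial satisfaction classes *)

Section Notions.
Variable M : mstruct.

Definition fo_definable (A : Set) (R : unit -> (A -> M) -> Prop) : Prop :=
  exists f : form Empty_set A, forall z e, R z e <-> sat (@no_pred M) e f.

Definition fo_notion : notion M unit.
Proof.
  refine (@Notion M unit fo_definable _ _ _ _ _ _).
  - intros A R R' h [f hf]. exists f. intros z e. now rewrite h.
  - intros A a b. exists (Eq _ a b). reflexivity.
  - intros A a b. exists (Mem _ a b). reflexivity.
  - intros A R [f hf]. exists (Neg f). intros z e. cbn. now rewrite hf.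
  - intros A R R' [f hf] [g hg]. exists (Conj f g). intros z e. cbn. now rewrite hf, hg.
  - intros A R [f hf]. exists (All f). intros z e. cbn.
    split; intros H x; apply (hf z); auto.
Defined.

Lemma fo_Def n (R : M -> (Fin.t n -> M) -> Prop) (a : Fin.t n -> M) :
  fo_notion (option (Fin.t n)) (fun _ e => R (e None) (fun i => e (Some i))) ->
  Def (fun x => R x a).
Proof. intros [f hf]. exists n, f, a. intros x. apply (hf tt (cons_env x a)). Qed.

Lemma fo_Def0 (R : M -> Prop) : D1 fo_notion R -> Def R.
Proof.
  intros d. apply (@fo_Def 0 (fun x _ => R x) (fun i => Fin.case0 (fun _ => car M) i)).
  exact (@d1 _ _ _ _ d (option (Fin.t 0)) None).
Qed.

Lemma fo_Def1 (R : M -> M -> Prop) (a : M) : D2 fo_notion R -> Def (fun x => R x a).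
Proof.
  intros d. apply (@fo_Def 1 (fun x p => R x (p Fin.F1)) (fun _ => a)).
  exact (@d2 _ _ _ _ d (option (Fin.t 1)) None (Some Fin.F1)).
Qed.

Variable X : (M -> Prop) -> Prop.
Let S := class_structure X.

Definition mkctx (A B : Set) : ctx :=
  fun s => match s with set_sort => A | class_sort => B end.

Definition mkenv (A B : Set) (b : B -> {P : M -> Prop | X P}) (e : A -> M) : env (mkctx A B) S :=
  fun s => match s with set_sort => e | class_sort => b end.

Definition cl_definable (B A : Set) (R : (B -> {P : M -> Prop | X P}) -> (A -> M) -> Prop) : Prop :=
  exists f : cform (mkctx A B), forall b e, R b e <-> csat (mkenv b e) f.

(** Formulas may quantify over classes here. That closure is the separate lemma [cl_ex_class], as it
    changes the type [B] of class variables. *)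
Definition cl_notion (B : Set) : notion M (B -> {P : M -> Prop | X P}).
Proof.
  refine (@Notion M _ (@cl_definable B) _ _ _ _ _ _).
  - intros A R R' h [f hf]. exists f. intros z e. now rewrite h.
  - intros A a b. exists (@CEq (mkctx A B) set_sort a b). reflexivity.
  - intros A a b. exists (@CMem (mkctx A B) set_sort a b). reflexivity.
  - intros A R [f hf]. exists (CNeg f). intros z e. cbn. now rewrite hf.
  - intros A R R' [f hf] [g hg]. exists (CConj f g). intros z e. cbn. now rewrite hf, hg.
  - intros A R [f hf]. exists (@CAll (mkctx A B) set_sort f). intros z e.
    split; intros H x.
    + exact (proj1 (hf z (cons_env x e)) (H x)).
    + exact (proj2 (hf z (cons_env x e)) (H x)).
Defined.

Lemma cl_class_atom (B A : Set) (b : B) (a : A) :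
  cl_notion B A (fun z e => proj1_sig (z b) (e a)).
Proof. exists (@CMem (mkctx A B) class_sort a b). reflexivity. Qed.

Lemma cl_ex_class (B A : Set) (Q : (option B -> {P : M -> Prop | X P}) -> (A -> M) -> Prop) :
  cl_notion (option B) A Q -> cl_notion B A (fun z e => exists F, Q (cons_env F z) e).
Proof.
  intros [f hf].
  exists (CNeg (@CAll (mkctx A B) class_sort (CNeg f))). intros z e.
  split.
  - intros [F hF] H. apply (H F). exact (proj1 (hf (cons_env F z) e) hF).
  - intros H. apply NNPP. intros n. apply H. intros F h. apply n. exists F.
    exact (proj2 (hf (cons_env F z) e) h).
Qed.

End Notions.

(** * Definability of the recursion [ksat], for one formula and uniformly *)

Section KripkeDefinable.
Variable M : mstruct.
Hypothesis ZM : ZFC M.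
Variables (Le : M -> M -> Prop) (D : M -> M -> Prop) (R : M -> M -> M -> Prop).
Hypothesis dLe : forall Z (N : notion M Z), D2 N Le.
Hypothesis dD : forall Z (N : notion M Z), D2 N D.
Hypothesis dR : forall Z (N : notion M Z), D3 N R.

Local Notation num := (num ZM).
Local Notation opair := (opair ZM).
Local Notation seqc := (seqc ZM).
Local Notation ks := (ksat Le D R).

Definition ksat_at (r : raw) (w s : M) := exists E, s = seqc E /\ ks w r E.

Lemma ksat_at_seqc r w E : ksat_at r w (seqc E) <-> ks w r E.
Proof.
  split; [|exists E; auto]. intros [E' [e h]].
  assert (E = E') by (apply functional_extensionality, (seqc_inj e)). now subst.
Qed.

(** [ksat_at] fixes the formula in the metatheory and is definable by recursion on it; here the
    formula number is an element of [M], and first-order definability is lost in general. *)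
Definition kripke (w k s : M) := exists r, is_code ZM r k /\ ksat_at r w s.

Lemma kripke_code r w s : kripke w (num (code r)) s <-> ksat_at r w s.
Proof.
  split; [|exists r; split; [reflexivity|auto]].
  intros [r' [e h]]. apply num_inj, code_inj in e. now subst.
Qed.

#[export] Instance d_ksat_at Z (N : notion M Z) r : D2 N (ksat_at r).
Proof.
  induction r; intros A a b.
  - apply (@dn_ext _ _ N A (fun _ e => is_seqc ZM (e b) /\ exists i' j' x,
      is_num i i' /\ is_num j j' /\ at_pos (e b) i' x /\ at_pos (e b) j' x)).
    2: dtac.
    intros _ e. split.
    + intros [E [-> h]]. cbn in h. split; [exists E; auto|].
      exists (num i), (num j), (E i). rewrite !(is_numE ZM), !at_pos_seqc. eauto 8.
    + intros [[E he] [i' [j' [x [h1 [h2 [h3 h4]]]]]]]. rewrite he in *.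
      apply ksat_at_seqc. cbn. rewrite !(is_numE ZM) in *. rewrite at_pos_seqc in *.
      destruct h3 as [n [e1 ->]], h4 as [m [e2 e3]]. subst.
      apply num_inj in e1, e2. now subst.
  - apply (@dn_ext _ _ N A (fun _ e => is_seqc ZM (e b) /\ exists i' j' x y,
      is_num i i' /\ is_num j j' /\ at_pos (e b) i' x /\ at_pos (e b) j' y /\ R (e a) x y)).
    2: dtac.
    intros _ e. split.
    + intros [E [-> h]]. cbn in h. split; [exists E; auto|].
      exists (num i), (num j), (E i), (E j). rewrite !(is_numE ZM), !at_pos_seqc. eauto 12.
    + intros [[E he] [i' [j' [x [y [h1 [h2 [h3 [h4 h5]]]]]]]]]. rewrite he in *.
      apply ksat_at_seqc. cbn. rewrite !(is_numE ZM) in *. rewrite at_pos_seqc in *.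
      destruct h3 as [n [e1 ->]], h4 as [m [e2 ->]]. subst.
      apply num_inj in e1, e2. now subst.
  - apply (@dn_ext _ _ N A (fun _ e => is_seqc ZM (e b) /\
      forall w', Le (e a) w' -> ~ ksat_at r w' (e b))).
    2: dtac.
    intros _ e. split.
    + intros [E [-> h]]. split; [exists E; auto|]. intros w' hw. rewrite ksat_at_seqc. auto.
    + intros [[E ->] h]. apply ksat_at_seqc. intros w' hw. rewrite <- ksat_at_seqc. auto.
  - apply (@dn_ext _ _ N A (fun _ e => ksat_at r1 (e a) (e b) /\ ksat_at r2 (e a) (e b))).
    2: dtac.
    intros _ e. split.
    + intros [E [-> h]]. now rewrite !ksat_at_seqc.
    + intros [[E [-> h1]] h2]. rewrite ksat_at_seqc in *. now split.
  - apply (@dn_ext _ _ N A (fun _ e => is_seqc ZM (e b) /\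
      forall z, D (e a) z -> forall s', cons_seq ZM z (e b) s' -> ksat_at r (e a) s')).
    2: dtac.
    intros _ e. split.
    + intros [E [-> h]]. split; [exists E; auto|]. intros z hz s' [E' [h1 ->]].
      assert (E = E') by (apply functional_extensionality, (seqc_inj h1)). subst E'.
      apply ksat_at_seqc. now apply h.
    + intros [[E ->] h]. apply ksat_at_seqc. intros z hz. apply ksat_at_seqc.
      apply (h z hz). exists E. auto.
Qed.

Definition kripke_below (n : nat) (w k s : M) :=
  exists r, code r < n /\ is_code ZM r k /\ ksat_at r w s.

(** Only finitely many formulas have a number below [n], so the relation is a finite disjunction of
    relations [ksat_at r]. *)
#[export] Instance d_kripke_below Z (N : notion M Z) n : D3 N (kripke_below n).
Proof.
  induction n as [|n IH]; intros A a b c.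
  - apply (@dn_ext _ _ N A (fun _ e => False)); [|dtac].
    intros _ e. split; [|tauto]. intros [r [h _]]. lia.
  - destruct (code_onto n) as [r hr].
    apply (@dn_ext _ _ N A (fun _ e => kripke_below n (e a) (e b) (e c) \/
      is_num n (e b) /\ ksat_at r (e a) (e c))); [|dtac].
    intros _ e. rewrite (is_numE ZM). split.
    + intros [r' [h1 [h2 h3]]]. destruct (Nat.eq_dec (code r') n) as [h4|h4].
      * rewrite <- hr in h4. apply code_inj in h4. subst r'. right. split; auto. subst n. exact h2.
      * left. exists r'. repeat split; auto. lia.
    + intros [[r' [h1 h2]]|[h1 h2]].
      * exists r'. split; auto.
      * exists r. split; [lia|]. split; auto. unfold is_code. congruence.
Qed.

Definition triple_in (F : M -> Prop) (w k s : M) :=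
  exists u t, is_opair k s u /\ is_opair w u t /\ F t.

Lemma triple_inE F w k s : triple_in F w k s <-> F (opair w (opair k s)).
Proof.
  unfold triple_in. split.
  - intros [u [t [h1 [h2 h3]]]]. rewrite (is_opairE ZM) in h1, h2. now subst.
  - intros h. exists (opair k s), (opair w (opair k s)). now rewrite !(is_opairE ZM).
Qed.

(** The clauses of [ksat] for all formula numbers up to [n]. Immediate subformulas have smaller
    numbers, so the clauses refer only to entries that they govern themselves. *)
Definition kripke_clauses (F : M -> Prop) (n : M) :=
  forall k, is_nat ZM k -> k \in n \/ k = n -> forall w s, is_seqc ZM s ->
    (forall i j, code_eq ZM i j k ->
      (triple_in F w k s <-> exists x, at_pos s i x /\ at_pos s j x)) /\
    (forall i j, code_mem ZM i j k ->
      (triple_in F w k s <-> exists x y, at_pos s i x /\ at_pos s j y /\ R w x y)) /\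
    (forall l, code_neg ZM l k ->
      (triple_in F w k s <-> forall w', Le w w' -> ~ triple_in F w' l s)) /\
    (forall l m, code_conj ZM l m k ->
      (triple_in F w k s <-> triple_in F w l s /\ triple_in F w m s)) /\
    (forall l, code_all ZM l k ->
      (triple_in F w k s <-> forall z, D w z -> forall s', cons_seq ZM z s s' -> triple_in F w l s')).

Lemma kripke_clauses_sound F r0 : kripke_clauses F (num (code r0)) ->
  forall r, code r <= code r0 -> forall w E,
  triple_in F w (num (code r)) (seqc E) <-> ks w r E.
Proof.
  intros H.
  (* The clauses at the number of [r] and the assignment [E], their statement being left to
     unification. *)
  assert (H' : forall r, code r <= code r0 -> forall w E, _) by
   (intros r hr w E; refine (H (num (code r)) _ _ w (seqc E) _);
    [exists (code r); auto| |exists E; auto];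
    destruct (Nat.eq_dec (code r) (code r0)) as [h|h]; [right; congruence|left; apply num_lt; lia]).
  clear H. induction r; intros hr w E; specialize (H' _ hr w E); cbn [ksat].
  - destruct H' as [H' _]. rewrite (H' (num i) (num j)); [|exists i, j; auto].
    split.
    + intros [x [h1 h2]]. rewrite at_pos_num in h1, h2. congruence.
    + intros h. exists (E i). rewrite !at_pos_num. auto.
  - destruct H' as [_ [H' _]]. rewrite (H' (num i) (num j)); [|exists i, j; auto].
    split.
    + intros [x [y [h1 [h2 h3]]]]. rewrite at_pos_num in h1, h2. now subst.
    + intros h. exists (E i), (E j). rewrite !at_pos_num. auto.
  - destruct H' as [_ [_ [H' _]]]. rewrite (H' (num (code r))); [|now apply code_neg_num].
    assert (hr' : code r <= code r0) by (cbn [code] in hr; lia).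
    split; intros h w' hw; specialize (h w' hw); rewrite IHr in *; auto.
  - destruct H' as [_ [_ [_ [H' _]]]].
    rewrite (H' (num (code r1)) (num (code r2))); [|now apply code_conj_num].
    pose proof (to_nat_bounds (code r1) (code r2)).
    rewrite IHr1, IHr2; [tauto| |]; cbn [code] in hr; lia.
  - destruct H' as [_ [_ [_ [_ H']]]]. rewrite (H' (num (code r))); [|now apply code_all_num].
    assert (hr' : code r <= code r0) by (cbn [code] in hr; lia).
    split.
    + intros h z hz. apply IHr; auto. apply (h z hz). exists E. auto.
    + intros h z hz s' [E' [e ->]].
      assert (E = E') by (apply functional_extensionality, (seqc_inj e)). subst E'.
      apply IHr; auto.
Qed.

Lemma kripke_clauses_complete (F : M -> Prop) r0 :
  (forall w k s, triple_in F w k s <-> kripke_below (S (code r0)) w k s) ->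
  kripke_clauses F (num (code r0)).
Proof.
  intros HF.
  assert (HF' : forall r w E, code r <= code r0 -> (triple_in F w (num (code r)) (seqc E) <-> ks w r E)).
  { intros r w E hr. rewrite HF, <- ksat_at_seqc. split.
    - intros [r' [h1 [h2 h3]]]. apply num_inj, code_inj in h2. now subst.
    - intros h. exists r. repeat split; auto. lia. }
  intros k hk hk' w s [E ->].
  assert (Hk : forall r, is_code ZM r k -> code r <= code r0).
  { intros r ->. destruct hk' as [h|h]; [apply num_lt in h; lia|apply num_inj in h; lia]. }
  refine (conj _ (conj _ (conj _ (conj _ _)))).
  - intros i j [n [m [-> [-> hc]]]]. pose proof (Hk (rEq n m) hc) as hr. rewrite hc.
    rewrite HF' by auto. cbn [ksat]. split.
    + intros h. exists (E n). rewrite !at_pos_num. auto.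
    + intros [x [h1 h2]]. rewrite at_pos_num in h1, h2. congruence.
  - intros i j [n [m [-> [-> hc]]]]. pose proof (Hk (rMem n m) hc) as hr. rewrite hc.
    rewrite HF' by auto. cbn [ksat]. split.
    + intros h. exists (E n), (E m). rewrite !at_pos_num. auto.
    + intros [x [y [h1 [h2 h3]]]]. rewrite at_pos_num in h1, h2. now subst.
  - intros l [n [m [-> [_ hc]]]]. destruct (code_onto n) as [r <-].
    pose proof (Hk (rNeg r) hc) as hr. change (k = num (code (rNeg r))) in hc. rewrite hc, HF' by auto.
    cbn [code] in hr. cbn [ksat].
    split; intros h w' hw; specialize (h w' hw); rewrite HF' in * by lia; auto.
  - intros l l' [n [m [-> [-> hc]]]]. destruct (code_onto n) as [r <-], (code_onto m) as [r' <-].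
    pose proof (Hk (rConj r r') hc) as hr. change (k = num (code (rConj r r'))) in hc. rewrite hc, HF' by auto.
    pose proof (to_nat_bounds (code r) (code r')). cbn [code] in hr. cbn [ksat].
    rewrite !HF' by lia. tauto.
  - intros l [n [m [-> [_ hc]]]]. destruct (code_onto n) as [r <-].
    pose proof (Hk (rAll r) hc) as hr. change (k = num (code (rAll r))) in hc. rewrite hc, HF' by auto.
    cbn [code] in hr. cbn [ksat]. split.
    + intros h z hz s' [E' [e ->]].
      assert (E = E') by (apply functional_extensionality, (seqc_inj e)). subst E'.
      apply HF'; [lia|auto].
    + intros h z hz. rewrite <- HF' by lia. apply (h z hz). exists E. auto.
Qed.

Lemma kripke_class r0 : exists F, Def F /\
  forall w k s, triple_in F w k s <-> kripke_below (S (code r0)) w k s.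
Proof.
  exists (fun t => exists w k s u, is_opair k s u /\ is_opair w u t /\ kripke_below (S (code r0)) w k s).
  split.
  - apply fo_Def0. intros A a. dtac.
  - intros w k s. rewrite triple_inE. split.
    + intros [w' [k' [s' [u [h1 [h2 h3]]]]]]. rewrite (is_opairE ZM) in h1, h2. subst u.
      apply opair_inj in h2. destruct h2 as [-> h2]. apply opair_inj in h2. destruct h2 as [-> ->]. auto.
    + intros h. exists w, k, s, (opair k s). now rewrite !(is_opairE ZM).
Qed.

Variable X : (M -> Prop) -> Prop.
Hypothesis HX : forall P, Def P -> X P.

(* For formulas up to a given number the relation is a class in [Def M], and the recursion
   clauses determine it; as all formula numbers of [M] are standard, quantification over classes
   defines the whole relation. *)
Lemma kripkeE w k s : kripke w k s <-> is_seqc ZM s /\ is_nat ZM k /\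
  exists F : {P : M -> Prop | X P},
    kripke_clauses (proj1_sig F) k /\ triple_in (proj1_sig F) w k s.
Proof.
  split.
  - intros [r [hr [E [-> h]]]]. split; [exists E; auto|]. split; [exists (code r); auto|].
    destruct (kripke_class r) as [F [dF hF]]. exists (exist _ F (HX dF)). cbn. rewrite hr. split.
    + now apply kripke_clauses_complete.
    + apply hF. exists r. repeat split; auto. exists E; auto.
  - intros [[E ->] [[n ->] [F [h1 h2]]]]. destruct (code_onto n) as [r <-].
    exists r. split; [reflexivity|]. apply ksat_at_seqc.
    apply (kripke_clauses_sound h1); auto.
Qed.

(** This holds for every [X] that includes [Def M], hence in both class structures. *)
#[export] Instance d_kripke (B : Set) : D3 (cl_notion X B) kripke.
Proof.
  intros A a b c. eapply dn_ext; [intros z e; apply kripkeE|].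
  dtac. apply (@cl_ex_class M X B A (fun z e => kripke_clauses (proj1_sig (z None)) (e b) /\
    triple_in (proj1_sig (z None)) (e a) (e b) (e c))).
  unfold kripke_clauses, triple_in. dtac; apply cl_class_atom.
Qed.

End KripkeDefinable.

(** * The HOD-order and the generic sequence *)

Section HodOrder.
Variable M : mstruct.
Hypothesis ZM : ZFC M.
Implicit Types x y be al : M.

(** [lt_triple] with formulas replaced by their numbers, so that incomparable triples are equal and
    leastness determines a triple. *)
Definition lt3 (p q : M * (nat * M)) : Prop :=
  fst p \in fst q \/ (fst p = fst q /\ (fst (snd p) < fst (snd q) \/
    (fst (snd p) = fst (snd q) /\ snd (snd p) \in snd (snd q)))).

Lemma lt3_wf : well_founded lt3.
Proof.
  intros [be [n al]]. revert n al. induction (mem_wf ZM be) as [be _ IH1].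
  intros n. induction n as [n IH2] using (well_founded_induction lt_wf).
  intros al. induction (mem_wf ZM al) as [al _ IH3].
  constructor. intros [be' [n' al']] [h|[e [h|[e' h]]]]; cbn in *.
  - auto.
  - subst. auto.
  - subst. auto.
Qed.

Definition V_sat (be : M) : raw -> (nat -> M) -> Prop :=
  ksat eq (fun w z => in_V w z) (fun _ => @mem M) be.

(** [od_by] for raw formulas: variable 0 is the element being defined, variable 1 the ordinal, which
    also fills the rest of the assignment. *)
Definition od3 x (p : M * (nat * M)) : Prop :=
  ordinal (fst p) /\ ordinal (snd (snd p)) /\ in_V (fst p) x /\ in_V (fst p) (snd (snd p)) /\
  exists r, code r = fst (snd p) /\ fv_below 2 r /\ forall y, in_V (fst p) y ->
    (V_sat (fst p) r (scons y (fun _ => snd (snd p))) <-> y = x).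

Lemma od_by_raw x be f al : od_by x be f al <->
  ordinal be /\ ordinal al /\ in_V be x /\ in_V be al /\ forall y, in_V be y ->
    (V_sat be (raw1 f) (scons y (fun _ => al)) <-> y = x).
Proof.
  assert (H : forall y al' : Vset be,
    sat (@no_pred (Vset be)) (cons_env y (fun _ => al')) f <->
    V_sat be (raw1 f) (scons (proj1_sig y) (fun _ => proj1_sig al'))).
  { intros y al'. apply sat_Vset_raw_of. intros [i|]; reflexivity. }
  unfold od_by. split.
  - intros [h1 [h2 [x' [al' [<- [<- h]]]]]].
    do 2 (split; auto). split; [apply proj2_sig|]. split; [apply proj2_sig|].
    intros y hy. rewrite <- (H (exist _ y hy) al'), h. split; [now intros <-|].
    destruct x' as [x' hx']; cbn. intros ->. now rewrite (proof_irrelevance _ hx' hy).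
  - intros [h1 [h2 [h3 [h4 h]]]]. do 2 (split; auto).
    exists (exist _ x h3), (exist _ al h4). do 2 (split; auto).
    intros [y hy]. rewrite H. cbn. rewrite (h y hy). split; [intros ->|intros e; now inversion e].
    now rewrite (proof_irrelevance _ hy h3).
Qed.

Lemma od3E x be n al : od3 x (be, (n, al)) <-> exists f, od_by x be f al /\ goedel1 f = n.
Proof.
  unfold od3. cbn [fst snd]. split.
  - intros [h1 [h2 [h3 [h4 [r [<- [h5 h]]]]]]]. destruct (raw1_onto h5) as [f <-].
    exists f. rewrite od_by_raw, code_raw1. auto 10.
  - intros [f [h <-]]. rewrite od_by_raw in h. destruct h as [h1 [h2 [h3 [h4 h]]]].
    do 4 (split; auto). exists (raw1 f). rewrite code_raw1. repeat split; auto.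
    + apply fv_below_raw1.
    + apply h; auto.
    + apply h; auto.
Qed.

Lemma od3_unique x y p : od3 x p -> od3 y p -> x = y.
Proof.
  intros [_ [_ [h1 [_ [r [e [_ h]]]]]]] [_ [_ [_ [_ [r' [e' [_ h']]]]]]].
  rewrite <- e' in e. apply code_inj in e. subst r'.
  apply h'; auto. apply h; auto.
Qed.

Definition least3 x p := od3 x p /\ forall q, od3 x q -> ~ lt3 q p.

Lemma lt3_trichotomy x y p q : od3 x p -> od3 y q -> lt3 p q \/ p = q \/ lt3 q p.
Proof.
  destruct p as [be [n al]], q as [be' [n' al']]. unfold lt3, od3. cbn.
  intros [o1 [o2 _]] [o1' [o2' _]].
  destruct (ordinal_total ZM o1 o1') as [h|[->|h]]; auto.
  destruct (lt_eq_lt_dec n n') as [[h| ->]|h]; auto 10.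
  destruct (ordinal_total ZM o2 o2') as [h|[->|h]]; auto 10.
Qed.

Lemma least3_unique x p q : least3 x p -> least3 x q -> p = q.
Proof.
  intros [h1 h2] [h3 h4]. destruct (lt3_trichotomy h1 h3) as [h|[h|h]]; auto; exfalso.
  - exact (h4 p h1 h).
  - exact (h2 q h3 h).
Qed.

Lemma lt3_trans p q s : ordinal (fst s) -> ordinal (snd (snd s)) -> lt3 p q -> lt3 q s -> lt3 p s.
Proof.
  destruct p as [be [n al]], q as [be' [n' al']], s as [be2 [n2 al2]]. unfold lt3. cbn.
  intros o1 o2 [h|[-> [h|[-> h]]]] [h'|[-> [h'|[-> h']]]];
    try solve [left; eauto using ordinal_trans]; right; split; auto;
    try solve [left; lia]; right; split; auto; eauto using ordinal_trans.
Qed.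

Lemma hod_lt_least3 x y : hod_lt x y <-> exists p q, least3 x p /\ least3 y q /\ lt3 p q.
Proof.
  assert (H : forall x be f al, least_od_by x be f al <-> od_by x be f al /\ least3 x (be, (goedel1 f, al))).
  { intros x' be f al. unfold least_od_by, least3. rewrite od3E. split.
    - intros [h1 h2]. split; auto. split; eauto. intros [be' [n' al']] h3 h4.
      apply od3E in h3. destruct h3 as [f' [h3 <-]]. exact (h2 be' f' al' h3 h4).
    - intros [h1 [_ h2]]. split; auto. intros be' f' al' h3 h4.
      apply (h2 (be', (goedel1 f', al'))); [|exact h4]. apply od3E. eauto. }
  split.
  - intros [be [f [al [be' [f' [al' [h1 [h2 h3]]]]]]]]. rewrite H in h1, h2.
    exists (be, (goedel1 f, al)), (be', (goedel1 f', al')).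
    exact (conj (proj2 h1) (conj (proj2 h2) h3)).
  - intros [[be [n al]] [[be' [n' al']] [h1 [h2 h3]]]].
    destruct (proj1 (od3E _ _ _ _) (proj1 h1)) as [f [h4 <-]].
    destruct (proj1 (od3E _ _ _ _) (proj1 h2)) as [f' [h5 <-]].
    exists be, f, al, be', f', al'. rewrite !H. auto.
Qed.

Hypothesis AllOD : forall x, OD x.

Lemma least3_exists x : exists p, least3 x p.
Proof.
  destruct (AllOD x) as [be [f [al h]]].
  destruct (wf_minimal (P := od3 x) lt3_wf) as [p [h1 h2]].
  - exists (be, (goedel1 f, al)). apply od3E. eauto.
  - exists p. split; auto.
Qed.

Lemma hod_lt_wf : well_founded (@hod_lt M).
Proof.
  destruct (choice_fun least3_exists) as [key hkey].
  assert (H : forall x y, hod_lt x y -> lt3 (key x) (key y)).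
  { intros x y h. apply hod_lt_least3 in h. destruct h as [p [q [h1 [h2 h3]]]].
    now rewrite (least3_unique (hkey x) h1), (least3_unique (hkey y) h2). }
  intros x. remember (key x) as k eqn:e. revert x e.
  induction (lt3_wf k) as [k _ IH]. intros x ->. constructor. intros y h.
  exact (IH (key y) (H _ _ h) y eq_refl).
Qed.

Lemma hod_lt_total x y : hod_lt x y \/ x = y \/ hod_lt y x.
Proof.
  destruct (least3_exists x) as [p hp], (least3_exists y) as [q hq].
  destruct (lt3_trichotomy (proj1 hp) (proj1 hq)) as [h|[e|h]].
  - left. apply hod_lt_least3. eauto.
  - right. left. subst q. exact (od3_unique (proj1 hp) (proj1 hq)).
  - right. right. apply hod_lt_least3. eauto.
Qed.

Lemma hod_lt_trans x y z : hod_lt x y -> hod_lt y z -> hod_lt x z.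
Proof.
  rewrite !hod_lt_least3. intros [p [q [h1 [h2 h3]]]] [q' [s [h4 [h5 h6]]]].
  assert (q' = q) by exact (least3_unique h4 h2). subst q'.
  exists p, s. split; [auto|]. split; [auto|]. destruct h5 as [[o1 [o2 _]] _].
  exact (lt3_trans o1 o2 h3 h6).
Qed.

Lemma hod_lt_irrefl x : ~ hod_lt x x.
Proof. induction (hod_lt_wf x) as [x _ IH]. intros h. exact (IH x h h). Qed.

(** A predecessor of [y] is defined over a stage no later than that of [y], hence belongs to that
    [V_be]. *)
Lemma small_hod_lt y : small (fun x => hod_lt x y).
Proof.
  destruct (least3_exists y) as [q hq].
  apply (small_sub ZM (small_V ZM (fst q))).
  intros x h. apply hod_lt_least3 in h. destruct h as [p [q' [h1 [h2 h3]]]].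
  rewrite (least3_unique h2 hq) in h3.
  destruct (proj1 h1) as [_ [_ [h4 _]]]. destruct (proj1 hq) as [o _].
  destruct h3 as [h3|[h3 _]].
  - eapply in_V_mono; eauto.
  - now rewrite <- h3.
Qed.

Lemma hod_least_exists (Q : M -> Prop) : (exists x, Q x) -> exists x, hod_least Q x.
Proof. intros h. exact (wf_minimal hod_lt_wf h). Qed.

Lemma hod_least_unique (Q : M -> Prop) x y : hod_least Q x -> hod_least Q y -> x = y.
Proof.
  intros [h1 h2] [h3 h4]. destruct (hod_lt_total x y) as [h|[h|h]]; auto; exfalso.
  - exact (h4 x h1 h).
  - exact (h2 y h3 h).
Qed.

(** * Class codes and the enumeration of the dense classes *)

Local Notation num := (num ZM).
Local Notation opair := (opair ZM).

Lemma small_fseq (n : nat) (a : nat -> M) : small (fun z => exists i, i < n /\ z = opair (num i) (a i)).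
Proof. apply (small_sub ZM (small_seq ZM a)). intros z [i [_ h]]. eauto. Qed.

Definition fseq n a := setof (small_fseq n a).

Lemma in_fseq n a z : z \in fseq n a <-> exists i, i < n /\ z = opair (num i) (a i).
Proof. apply in_setof. Qed.

Lemma fseq_inj n a m b : fseq n a = fseq m b -> n = m /\ forall i, i < n -> a i = b i.
Proof.
  assert (H : forall n a m b, fseq n a = fseq m b -> forall i, i < n -> i < m /\ a i = b i).
  { clear. intros n a m b e i hi. assert (h : opair (num i) (a i) \in fseq m b).
    { rewrite <- e. apply in_fseq. eauto. }
    apply in_fseq in h. destruct h as [j [hj h]]. apply opair_inj in h. destruct h as [h1 h2].
    apply num_inj in h1. now subst. }
  intros e. split; [|intros i hi; apply (H _ _ _ _ e i hi)].
  destruct (lt_eq_lt_dec n m) as [[h|h]|h]; auto; exfalso.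
  - destruct (H _ _ _ _ (eq_sym e) n h). lia.
  - destruct (H _ _ _ _ e m h). lia.
Qed.

(** Only the first [n] entries of [a] enter the code; [code_memE] shows that the coded class does
    not depend on the others. *)
Definition code_of n r a c := fv_below (S n) r /\ c = opair (num (code r)) (fseq n a).
Definition code_valid c := exists n r a, code_of n r a c.
Definition code_mem_of c x := exists n r a, code_of n r a c /\ tsat (@mem M) r (scons x a).

Lemma code_memE n r a c x : code_of n r a c -> (code_mem_of c x <-> tsat (@mem M) r (scons x a)).
Proof.
  intros h. split; [|exists n, r, a; auto].
  intros [n' [r' [a' [h' H]]]]. destruct h as [h e], h' as [h' e'].
  rewrite e in e'. apply opair_inj in e'. destruct e' as [e1 e2].
  apply num_inj, code_inj in e1. subst r'. apply fseq_inj in e2. destruct e2 as [<- e2].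
  unfold tsat in *. eapply ksat_fv with (n := S n); [exact h| |exact H].
  intros [|i] hi; cbn; auto. rewrite e2; auto. lia.
Qed.

(** By extensionality a class is equal to the one described by its code. Classes can thus be
    eliminated in favour of codes, which are sets. *)
Lemma class_codeE D c : class_code D c <-> code_valid c /\ D = code_mem_of c.
Proof.
  split.
  - intros [n [f [a [k [s [h1 [h2 [h3 h4]]]]]]]].
    destruct (env_of_Fin ZM a) as [a' ha].
    assert (hc : code_of n (raw1 f) a' c).
    { split; [apply fv_below_raw1|]. rewrite code_raw1.
      rewrite (is_numE ZM) in h2. rewrite (is_opairE ZM) in h4. subst c k. f_equal.
      apply (set_ext ZM). intros z. rewrite (h3 z), in_fseq. split.
      - intros [i [k [e1 e2]]]. rewrite (is_numE ZM) in e1. rewrite (is_opairE ZM) in e2. subst.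
        exists (@fin_val n i). rewrite ha. split; auto. unfold fin_val. destruct (Fin.to_nat i); auto.
      - intros [i [hi ->]]. exists (Fin.of_nat_lt hi), (num i).
        rewrite (is_numE ZM), (is_opairE ZM), <- ha. unfold fin_val.
        rewrite Fin.to_nat_of_nat. auto. }
    split; [exists n, (raw1 f), a'; auto|].
    apply functional_extensionality. intros x. apply propositional_extensionality.
    rewrite (code_memE x hc), (h1 x). apply sat_raw_of. intros [i|]; cbn; auto.
  - intros [[n [r [a [h1 h2]]]] ->]. destruct (raw1_onto h1) as [f <-].
    exists n, f, (fun i : Fin.t n => a (fin_val i)), (num (code (raw1 f))), (fseq n a).
    rewrite (is_numE ZM), (is_opairE ZM), code_raw1. repeat split; auto.
    + rewrite (@code_memE n (raw1 f) a); [|split; auto]. apply sat_raw_of. intros [i|]; cbn; auto.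
    + rewrite (@code_memE n (raw1 f) a); [|split; auto]. apply sat_raw_of. intros [i|]; cbn; auto.
    + rewrite in_fseq. intros [i [hi ->]]. exists (Fin.of_nat_lt hi), (num i).
      rewrite (is_numE ZM), (is_opairE ZM). unfold fin_val. rewrite Fin.to_nat_of_nat. auto.
    + rewrite in_fseq. intros [i [k [e1 e2]]]. rewrite (is_numE ZM) in e1. rewrite (is_opairE ZM) in e2.
      subst. exists (@fin_val n i). split; auto. unfold fin_val. destruct (Fin.to_nat i); auto.
    + rewrite h2, code_raw1. auto.
Qed.

(** Coded classes are compared by their members, so that, given [code_mem_of] and [hod_lt], the
    definition quantifies over sets only. *)
Definition dcode c := code_valid c /\ dense (code_mem_of c) /\
  forall c', code_valid c' -> (forall x, code_mem_of c' x <-> code_mem_of c x) -> ~ hod_lt c' c.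

Lemma dense_codeE D c : dense_code D c <-> dcode c /\ D = code_mem_of c.
Proof.
  unfold dense_code, hod_least, dcode. rewrite class_codeE. split.
  - intros [h1 [[h2 ->] h3]]. repeat split; auto; try apply h1.
    intros c' h4 h5. apply h3. rewrite class_codeE. split; auto.
    apply functional_extensionality. intros x. apply propositional_extensionality. now rewrite h5.
  - intros [[h1 [h2 h3]] ->]. repeat split; auto; try apply h2. intros c' h. rewrite class_codeE in h.
    destruct h as [h4 h5]. apply h3; auto. intros x. now rewrite h5.
Qed.

Lemma dense_has_code D : dense D -> Def D -> exists c, dcode c /\ D = code_mem_of c.
Proof.
  intros h [n [f [a H]]].
  destruct (@hod_least_exists (class_code D)) as [c hc].
  - destruct (env_of_Fin ZM a) as [a' ha].
    exists (opair (num (code (raw1 f))) (fseq n a')). rewrite class_codeE.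
    assert (hc : code_of n (raw1 f) a' (opair (num (code (raw1 f))) (fseq n a'))).
    { split; [apply fv_below_raw1|auto]. }
    split; [exists n, (raw1 f), a'; auto|].
    apply functional_extensionality. intros x. apply propositional_extensionality.
    rewrite (code_memE x hc), (H x). apply sat_raw_of. intros [i|]; cbn; auto.
  - exists c. apply dense_codeE. split; auto.
Qed.

(** The Mostowski collapse of [hod_lt] on the codes of dense classes: [pos c] is the order type of
    those preceding [c]. The recursion runs along the whole order and skips other sets. *)
Definition pos : M -> M :=
  Fix hod_lt_wf (fun _ => car M) (fun c rec =>
    epsilon (inhabits c) (fun s => forall z, z \in s <-> exists d (h : hod_lt d c), dcode d /\ z = rec d h)).

Lemma in_pos c z : z \in pos c <-> exists d, hod_lt d c /\ dcode d /\ z = pos d.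
Proof.
  unfold pos at 1. rewrite Fix_eq.
  - fold pos. assert (E : exists s : M, forall z, z \in s <-> exists d (h : hod_lt d c), dcode d /\ z = pos d).
    { assert (hsm : small (fun d => hod_lt d c /\ dcode d)).
      { apply (small_sub ZM (small_hod_lt c)). tauto. }
      destruct (small_image ZM pos hsm) as [s hs]. exists s. intros z'. rewrite hs. split; [intros [d [[h1 h2] h3]]|intros [d [h1 [h2 h3]]]]; eauto 6. }
    rewrite (epsilon_spec (inhabits c) _ E z). split; intros [d [h1 h2]]; eauto.
  - intros x f g e. f_equal. apply functional_extensionality. intros s. apply propositional_extensionality.
    split; intros H z'; rewrite H; split; intros [d [h1 [h2 h3]]]; exists d, h1; split; auto;
    rewrite h3; auto.
Qed.

Lemma ordinal_pos c : ordinal (pos c).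
Proof.
  induction (hod_lt_wf c) as [c _ IH]. apply ordinal_of_elems.
  - intros y hy. apply in_pos in hy. destruct hy as [d [h1 [_ ->]]]. auto.
  - intros y z hy hz. apply in_pos in hy. destruct hy as [d [h1 [h2 ->]]].
    apply in_pos in hz. destruct hz as [d' [h3 [h4 ->]]]. apply in_pos.
    exists d'. eauto using hod_lt_trans.
Qed.

Lemma pos_inj c d : dcode c -> dcode d -> pos c = pos d -> c = d.
Proof.
  intros hc hd e. destruct (hod_lt_total c d) as [h|[h|h]]; auto; exfalso.
  - apply (@mem_irrefl M ZM (pos c)). rewrite e at 2. apply in_pos. eauto.
  - apply (@mem_irrefl M ZM (pos d)). rewrite <- e at 2. apply in_pos. eauto.
Qed.

Definition enum_below (f : M -> M) xi c :=
  (forall eta eta', eta \in xi -> eta' \in xi -> eta \in eta' -> hod_lt (f eta) (f eta')) /\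
  (forall d, (exists eta, eta \in xi /\ f eta = d) <-> dcode d /\ hod_lt d c).

(** Any order isomorphism [f] as in [nth_dense] is inverted by [pos], by induction on the index; so
    the index of a dense class is determined by its code. *)
Lemma enum_below_pos f xi c : ordinal xi -> enum_below f xi c -> xi = pos c.
Proof.
  intros o [h1 h2].
  assert (H : forall eta, eta \in xi -> pos (f eta) = eta).
  { intros eta. induction (mem_wf ZM eta) as [eta _ IH]. intros he.
    apply (set_ext ZM). intros z. rewrite in_pos. split.
    - intros [d [h3 [h4 ->]]].
      assert (h5 : hod_lt (f eta) c) by (apply (proj1 (h2 (f eta))); eauto).
      destruct (proj2 (h2 d)) as [eta' [h6 <-]]; [eauto using hod_lt_trans|].
      destruct (ordinal_total ZM (ordinal_mem o he) (ordinal_mem o h6)) as [h|[->|h]].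
      + exfalso. apply (@hod_lt_irrefl (f eta)). eauto using hod_lt_trans.
      + exfalso. eapply hod_lt_irrefl; eauto.
      + rewrite IH; auto.
    - intros hz. assert (hz' : z \in xi) by eauto using ordinal_trans.
      exists (f z). split; [auto|]. split.
      + apply (proj1 (h2 (f z))). eauto.
      + rewrite IH; auto. }
  apply (set_ext ZM). intros z. rewrite in_pos. split.
  - intros hz. destruct (proj1 (h2 (f z))) as [h3 h4]; [eauto|]. exists (f z). rewrite H; auto.
  - intros [d [h3 [h4 ->]]]. destruct (proj2 (h2 d)) as [eta [h5 <-]]; auto. rewrite H; auto.
Qed.

Lemma pos_enum_below c : exists f, enum_below f (pos c) c.
Proof.
  destruct (choice_on (B := M) c (P := fun eta => eta \in pos c)
    (R := fun eta d => hod_lt d c /\ dcode d /\ eta = pos d)) as [f hf].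
  { intros eta h. now apply in_pos in h. }
  exists f. split.
  - intros eta eta' h h' he.
    destruct (hf eta h) as [h1 [h2 h3]], (hf eta' h') as [h4 [h5 h6]].
    rewrite h3, h6 in he. apply in_pos in he. destruct he as [d [h7 [h8 h9]]].
    apply pos_inj in h9; auto. now rewrite h9.
  - intros d. split.
    + intros [eta [h <-]]. destruct (hf eta h) as [h1 [h2 h3]]. auto.
    + intros [h1 h2]. assert (h : pos d \in pos c) by (apply in_pos; eauto).
      exists (pos d). split; auto. destruct (hf _ h) as [h3 [h4 h5]]. symmetry. apply pos_inj; auto.
Qed.

Lemma nth_denseE (xi : M) D : nth_dense xi D <-> exists c, dcode c /\ xi = pos c /\ D = code_mem_of c.
Proof.
  assert (H : forall f xi' c, enum_below f xi' c <-> (forall eta eta', eta \in xi' -> eta' \in xi' -> eta \in eta' ->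
       hod_lt (f eta) (f eta')) /\
    (forall d, (exists eta, eta \in xi' /\ f eta = d) <->
       (exists D', dense_code D' d) /\ hod_lt d c)).
  { assert (H : forall d, (exists D', dense_code D' d) <-> dcode d).
    { intros d. split; [intros [D' h]; now apply dense_codeE in h|].
      intros h. exists (code_mem_of d). now apply dense_codeE. }
    intros f xi' c. unfold enum_below. split; intros [h1 h2]; split; auto; intros d; rewrite (h2 d), (H d); tauto. }
  unfold nth_dense. split.
  - intros [o [c [h1 [f h2]]]]. apply dense_codeE in h1. destruct h1 as [h1 ->].
    apply H in h2. apply (enum_below_pos o) in h2. eauto.
  - intros [c [h1 [-> ->]]]. split; [apply ordinal_pos|]. exists c. split; [now apply dense_codeE|].
    destruct (pos_enum_below c) as [f hf]. exists f. now apply H.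
Qed.

Lemma nth_dense_unique (xi : M) D D' : nth_dense xi D -> nth_dense xi D' -> D = D'.
Proof.
  rewrite !nth_denseE. intros [c [h1 [-> ->]]] [c' [h2 [e ->]]]. apply pos_inj in e; auto. now subst.
Qed.

(** * The generic sequence *)

Lemma succ_not_limit (xi eta : M) : is_succ xi eta -> ~ limit_ordinal eta.
Proof. intros h [_ [_ h']]. eauto. Qed.

Lemma succ_not_empty (xi eta : M) : is_succ xi eta -> ~ is_empty eta.
Proof. intros h h'. apply (h' xi). apply h. auto. Qed.

(** The constructors apply to indices of different shapes, and [nth_dense] and [hod_least] determine
    the objects that they introduce. *)
Lemma generic_seq_unique (xi p p' : M) : generic_seq xi p -> generic_seq xi p' -> p = p'.
Proof.
  intros h. revert p'. induction h as [xi p h1 h2|xi xi' p q D h1 IH h2 h3 h4|eta p f h1 h2 IH h3];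
    intros p' h'; inversion h' as [xi2 p2 k1 k2|xi2 xi2' p2 q2 D2 k1 k2 k3 k4|eta2 p2 f2 k1 k2 k3]; subst;
    try (exfalso; eapply succ_not_empty; eassumption);
    try (exfalso; eapply succ_not_limit; eassumption);
    try (exfalso; exact (proj1 (proj2 h1) k1)); try (exfalso; exact (proj1 (proj2 k1) h1)).
  - apply is_emptyE with (ZM := ZM) in h2, k2. congruence.
  - apply is_succE with (ZM := ZM) in h2, k2. rewrite h2 in k2. apply succ_inj in k2. subst xi2.
    rewrite (IH _ k1) in h4. rewrite (nth_dense_unique h3 k3) in h4. exact (hod_least_unique h4 k4).
  - apply (set_ext ZM). intros z. rewrite h3, k3.
    split; intros [xi [hx hz]]; exists xi; split; auto; specialize (IH xi hx _ (k2 xi hx)); congruence.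
Qed.

Lemma ordinal_generic_seq (xi p : M) : generic_seq xi p -> ordinal xi.
Proof.
  intros [xi' p' h1 h2|xi' xi2 p' q D h1 h2 h3 h4|eta p' f h1 h2 h3].
  - apply is_emptyE with (ZM := ZM) in h1. subst. apply ordinal_empty.
  - apply is_succE with (ZM := ZM) in h2. subst. apply ordinal_succ. apply h3.
  - apply h1.
Qed.

Lemma condition_empty (p : M) : is_empty p -> condition p.
Proof.
  intros h. exists (empty ZM). split; [apply ordinal_empty|]. split.
  - intros z hz. destruct (h z hz).
  - intros xi hx. destruct (in_empty hx).
Qed.

(** The domain is the union of the domains. Two values at the same ordinal already occur in the
    larger of two comparable conditions. *)
Lemma condition_Union (I p : M) (f : M -> M) :
  (forall xi, xi \in I -> condition (f xi)) ->
  (forall xi eta, xi \in I -> eta \in I -> incl (f xi) (f eta) \/ incl (f eta) (f xi)) ->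
  (forall z, z \in p <-> exists xi, xi \in I /\ z \in f xi) -> condition p.
Proof.
  intros h1 h2 h3.
  destruct (choice_on (B := M) p h1) as [al hal].
  destruct (small_Union ZM (Q := fun xi z => z \in al xi) (small_mem I)) as [A hA].
  { intros xi _. apply small_mem. }
  exists A. split; [|split].
  - apply ordinal_of_elems.
    + intros y hy. apply hA in hy. destruct hy as [xi [hx hy]]. apply (ordinal_mem (x := al xi)); auto.
      apply hal; auto.
    + intros y z hy hz. apply hA in hy. destruct hy as [xi [hx hy]]. apply hA. exists xi.
      split; auto. apply (ordinal_trans (y := y)); auto. apply hal; auto.
  - intros z hz. apply h3 in hz. destruct hz as [xi [hx hz]].
    destruct (hal xi hx) as [_ [h4 _]]. destruct (h4 z hz) as [eta [i [h5 h6]]].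
    exists eta, i. split; auto. apply hA. eauto.
  - intros eta he. apply hA in he. destruct he as [xi [hx he]].
    destruct (hal xi hx) as [_ [_ h4]]. destruct (h4 eta he) as [i [[z [h5 h6]] h7]].
    exists i. split.
    + exists z. split; auto. apply h3. eauto.
    + intros j [z' [k1 k2]]. apply h3 in k2. destruct k2 as [xi' [hx' k2]].
      destruct (h2 xi xi' hx hx') as [s|s].
      * destruct (hal xi' hx') as [_ [k3 k4]].
        destruct (k3 z' k2) as [eta' [j' [k5 [_ k6]]]].
        rewrite (is_opairE ZM) in k1, k6. rewrite k1 in k6. apply opair_inj in k6. destruct k6; subst eta' j'.
        destruct (k4 eta k5) as [j' [_ k7]]. rewrite <- (k7 i), <- (k7 j); auto.
        -- exists z'. now rewrite (is_opairE ZM).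
        -- exists z. auto.
      * apply h7. exists z'. auto.
Qed.

(** Both claims go in one induction: at a limit, the union is a condition because the earlier ones
    form a chain. *)
Lemma generic_seq_chain (xi p : M) : generic_seq xi p ->
  condition p /\ forall eta, eta \in xi -> exists q, generic_seq eta q /\ incl q p.
Proof.
  intros h. induction h as [xi p h1 h2|xi xi' p q D h1 IH h2 h3 h4|eta p f h1 h2 IH h3].
  - split; [now apply condition_empty|]. intros eta he. destruct (h1 eta he).
  - split; [apply h4|]. intros eta he. apply h2 in he. destruct he as [he| ->].
    + destruct IH as [_ IH]. destruct (IH eta he) as [q' [k1 k2]]. exists q'. split; auto.
      intros z hz. apply (proj1 h4). auto.
    + exists p. split; auto. apply h4.
  - assert (H : forall xi xi', xi \in eta -> xi' \in eta -> xi \in xi' -> incl (f xi) (f xi')).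
    { intros xi xi' k1 k2 k3. destruct (IH xi' k2) as [_ k4]. destruct (k4 xi k3) as [q [k5 k6]].
      now rewrite (generic_seq_unique (h2 xi k1) k5). }
    split.
    + apply (@condition_Union eta p f); auto.
      * intros xi hx. apply IH; auto.
      * intros xi xi' k1 k2. destruct h1 as [o _].
        destruct (ordinal_total ZM (ordinal_mem o k1) (ordinal_mem o k2)) as [h|[->|h]]; auto.
        left. intros z; auto.
    + intros xi hx. exists (f xi). split; auto. intros z hz. apply h3. eauto.
Qed.

Definition generic (p : M) := exists xi, generic_seq xi p.

Lemma generic_condition p : generic p -> condition p.
Proof. intros [xi h]. apply (generic_seq_chain h). Qed.

Lemma generic_total p q : generic p -> generic q -> incl p q \/ incl q p.
Proof.
  intros [xi h] [eta k].
  destruct (ordinal_total ZM (ordinal_generic_seq h) (ordinal_generic_seq k)) as [e|[e|e]].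
  - left. destruct (generic_seq_chain k) as [_ H]. destruct (H xi e) as [q' [h1 h2]].
    now rewrite (generic_seq_unique h h1).
  - subst. rewrite (generic_seq_unique h k). left. intros z; auto.
  - right. destruct (generic_seq_chain h) as [_ H]. destruct (H eta e) as [q' [h1 h2]].
    now rewrite (generic_seq_unique k h1).
Qed.

Lemma generic_step (xi p c : M) : generic_seq xi p -> dcode c -> xi = pos c ->
  exists q, generic_seq (succ ZM xi) q /\ code_mem_of c q.
Proof.
  intros h hc e. destruct (proj1 (proj2 hc)) as [h1 h2]. pose proof (proj1 (generic_seq_chain h)) as hp.
  pose proof (proj1 (proj2 hc)) as [hd1 hd2].
  destruct (hd2 p hp) as [r [hr1 hr2]].
  destruct (@hod_least_exists (fun r => condition r /\ incl p r /\ code_mem_of c r)) as [q hq]; [eauto|].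
  exists q. split; [|apply hq].
  apply generic_succ with (xi := xi) (p := p) (D := code_mem_of c); auto.
  - now rewrite (is_succE ZM).
  - apply nth_denseE. eauto.
Qed.

(** A successor step at [xi] needs a dense class with index [xi], and every ordinal in [pos c] is
    the index of one. *)
Lemma generic_seq_exists c eta : eta \in succ ZM (pos c) -> exists p, generic_seq eta p.
Proof.
  induction (mem_wf ZM eta) as [eta _ IH]. intros he.
  assert (o : ordinal eta) by (apply (ordinal_mem (ordinal_succ ZM (ordinal_pos c)) he)).
  assert (hsub : forall xi, xi \in eta -> xi \in pos c).
  { intros xi hx. apply in_succ in he. destruct he as [he| ->]; auto.
    apply (ordinal_trans (ordinal_pos c) he hx). }
  destruct (ordinal_cases ZM o) as [->|[[xi [hx ->]]|l]].
  - exists (empty ZM). apply generic_zero; now rewrite (is_emptyE ZM).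
  - destruct (IH xi hx) as [p hp]; [apply in_succ; auto|].
    pose proof (hsub xi hx) as hx'. apply in_pos in hx'. destruct hx' as [d [h1 [h2 h3]]].
    destruct (generic_step hp h2 h3) as [q [hq _]]. eauto.
  - destruct (choice_on (B := M) c (P := fun xi => xi \in eta) (R := @generic_seq M)) as [f hf].
    { intros xi hx. apply IH; auto. apply in_succ; auto. }
    destruct (small_Union ZM (Q := fun xi z => z \in f xi) (small_mem eta)) as [p hp].
    { intros xi _. apply small_mem. }
    exists p. apply generic_limit with (f := f); auto.
Qed.

(** The dense class with code [c] is met one step after the index [pos c]. *)
Lemma generic_meets D : dense D -> Def D -> exists p, generic p /\ D p.
Proof.
  intros h h'. destruct (dense_has_code h h') as [c [hc ->]].
  destruct (@generic_seq_exists c (pos c)) as [p hp]; [apply in_succ; auto|].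
  destruct (generic_step hp hc eq_refl) as [q [hq1 hq2]]. exists q. split; auto. exists (succ ZM (pos c)). auto.
Qed.

End HodOrder.

(** * Definability of the generic sequence *)

(** [kripke] takes its worlds from [M]. Plain truth is obtained by letting every element of [M] be a
    world that sees only itself and has no influence. *)
Lemma ksat_tsat (M W : Type) (R : M -> M -> Prop) (w : W) r E :
  ksat eq (fun _ _ => True) (fun _ => R) w r E <-> tsat R r E.
Proof.
  unfold tsat. revert E. induction r; intros E; cbn; [tauto|tauto| | |].
  - split.
    + intros h [] _. rewrite <- IHr. auto.
    + intros h w' <-. rewrite IHr. apply (h tt I).
  - rewrite IHr1, IHr2. tauto.
  - split; intros h z hz; apply IHr; auto.
Qed.

Section GenericDefinable.
Variable M : mstruct.
Hypothesis ZM : ZFC M.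
Hypothesis AllOD : forall x : M, OD x.

Local Notation num := (num ZM).
Local Notation opair := (opair ZM).
Local Notation seqc := (seqc ZM).

(** Up to [d_generic] everything is first-order in two relations: truth in the [V_al], from which
    the HOD-order is built, and truth in [M], from which the coded classes are read. *)
Definition kripke_V := kripke ZM eq (fun w z : M => in_V w z) (fun _ => @mem M).
Definition kripke_truth := kripke ZM eq (fun _ _ : M => True) (fun _ => @mem M).

Variables (Z : Type) (N : notion M Z).
Hypothesis dV : D3 N kripke_V.
Hypothesis dT : D3 N kripke_truth.

Instance d_in_V_ZM : D2 N (@in_V M) := d_in_V ZM N.

Definition od4 (x be k al : M) := exists n, k = num n /\ od3 x (be, (n, al)).

(** The conditions on [s] say that it is the assignment [y, al, al, ...]; numeral 2 bounds the free
    variables. *)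
Lemma od4E x be k al : od4 x be k al <->
  ordinal be /\ ordinal al /\ in_V be x /\ in_V be al /\ (exists t, is_num 2 t /\ fvc ZM k t) /\
  forall y, in_V be y -> forall s, is_seqc ZM s ->
    (forall o, is_num 0 o -> at_pos s o y) ->
    (forall i j, is_nat ZM i -> is_succ i j -> at_pos s j al) ->
    (kripke_V be k s <-> y = x).
Proof.
  assert (H : forall s y, is_seqc ZM s /\ (forall o, is_num 0 o -> at_pos s o y) /\
    (forall i j, is_nat ZM i -> is_succ i j -> at_pos s j al) <-> s = seqc (scons y (fun _ => al))).
  { intros s y. split.
    - intros [[E ->] [h1 h2]]. f_equal. apply functional_extensionality. intros [|i]; cbn.
      + symmetry. apply at_pos_num with (ZM := ZM). apply h1. now apply is_numE with (ZM := ZM).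
      + symmetry. apply at_pos_num with (ZM := ZM). apply (h2 (num i)); [exists i; auto|].
        now apply is_succE with (ZM := ZM).
    - intros ->. split; [eexists; reflexivity|]. split.
      + intros o ho. apply is_numE with (ZM := ZM) in ho. subst o. now apply at_pos_num.
      + intros i j [n ->] hj. apply is_succE with (ZM := ZM) in hj. subst j.
        now apply (at_pos_num ZM (scons y (fun _ => al)) (S n)). }
  unfold od4, od3. cbn [fst snd]. split.
  - intros [n [-> [h1 [h2 [h3 [h4 [r [<- [h5 h6]]]]]]]]].
    do 4 (split; [assumption|]). split.
    + exists (num 2). rewrite (is_numE ZM). split; auto. exists r, 2. repeat split; auto.
    + intros y hy s k1 k2 k3. rewrite (proj1 (H s y) (conj k1 (conj k2 k3))).
      unfold kripke_V. rewrite kripke_code, ksat_at_seqc. apply h6; auto.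
  - intros [h1 [h2 [h3 [h4 [[t [ht h5]] h6]]]]].
    apply is_numE with (ZM := ZM) in ht. subst t.
    destruct h5 as [r [m [-> [e h5]]]]. apply num_inj in e. subst m.
    exists (code r). split; auto. do 4 (split; [assumption|]). exists r. do 2 (split; auto).
    intros y hy. destruct (proj2 (H (seqc (scons y (fun _ => al))) y) eq_refl) as [k1 [k2 k3]].
    rewrite <- (h6 y hy _ k1 k2 k3). unfold kripke_V. rewrite kripke_code, ksat_at_seqc. reflexivity.
Qed.

Instance d_od4 : D4 N od4.
Proof. intros A a b c d. eapply dn_ext; [intros z e; apply od4E|]. dtac. Qed.

Definition least4 (x be k al : M) := od4 x be k al /\ forall be' k' al', od4 x be' k' al' ->
  ~ (be' \in be \/ be' = be /\ (k' \in k \/ k' = k /\ al' \in al)).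

Instance d_least4 : D4 N least4.
Proof. intros A a b c d. unfold least4. dtac. Qed.

Lemma least4E x be n al : least4 x be (num n) al <-> least3 x (be, (n, al)).
Proof.
  unfold least4, least3. split.
  - intros [[n' [e h1]] h2]. apply num_inj in e. subst n'. split; auto.
    intros [be' [n' al']] h3 h4. apply (h2 be' (num n') al'); [exists n'; auto|].
    unfold lt3 in h4. cbn in h4. rewrite num_lt. intuition congruence.
  - intros [h1 h2]. split; [exists n; auto|]. intros be' k' al' [n' [-> h3]] h4.
    apply (h2 _ h3). unfold lt3. cbn. rewrite num_lt in h4. intuition eauto using num_inj.
Qed.

#[export] Instance d_hod_lt : D2 N (@hod_lt M).
Proof.
  intros A a b.
  apply (@dn_ext _ _ N A (fun _ e => exists be k al be' k' al', least4 (e a) be k al /\ least4 (e b) be' k' al' /\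
     (be \in be' \/ be = be' /\ (k \in k' \/ k = k' /\ al \in al')))).
  2: dtac.
  intros _ e. rewrite hod_lt_least3. split.
  - intros [[be [n al]] [[be' [n' al']] [h1 [h2 h3]]]].
    exists be, (num n), al, be', (num n'), al'. rewrite !least4E, num_lt.
    unfold lt3 in h3. cbn in h3. intuition congruence.
  - intros [be [k [al [be' [k' [al' [h1 [h2 h3]]]]]]]].
    destruct (proj1 h1) as [n [-> _]], (proj1 h2) as [n' [-> _]].
    exists (be, (n, al)), (be', (n', al')). rewrite least4E in h1, h2. rewrite num_lt in h3.
    split; auto. split; auto. unfold lt3. cbn. intuition eauto using num_inj.
Qed.

Definition is_fseq (n s : M) := exists m a, n = num m /\ s = fseq ZM m a.

Lemma at_pos_fseq n a i x : at_pos (fseq ZM n a) i x <-> exists m, m < n /\ i = num m /\ x = a m.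
Proof.
  rewrite (at_posE ZM), in_fseq. split; intros [m h]; exists m.
  - destruct h as [h e]. apply opair_inj in e. tauto.
  - destruct h as [h [-> ->]]. auto.
Qed.

Instance d_is_fseq : D2 N is_fseq.
Proof.
  intros A a b.
  apply (@dn_ext _ _ N A (fun _ e => is_nat ZM (e a) /\
    (forall p, p \in e b -> exists i x, i \in e a /\ is_opair i x p) /\
    (forall i, i \in e a -> exists! x, at_pos (e b) i x))).
  2: dtac.
  intros _ e. split.
  - intros [n [f [-> ->]]]. split; [exists n; auto|]. split.
    + intros p hp. apply in_fseq in hp. destruct hp as [i [hi ->]]. exists (num i), (f i).
      rewrite num_lt. split; auto. now apply is_opairE with (ZM := ZM).
    + intros i hi. apply in_num in hi. destruct hi as [m [hm ->]]. exists (f m). split.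
      * apply at_pos_fseq. eauto.
      * intros x hx. apply at_pos_fseq in hx. destruct hx as [m' [_ [e1 ->]]].
        apply num_inj in e1. now subst.
  - intros [[n hn] [h1 h2]]. rewrite hn in *.
    destruct (choice_on (empty ZM) (P := fun m => m < n) (R := fun m x => at_pos (e b) (num m) x)) as [f hf].
    { intros m hm. destruct (h2 (num m)) as [x [hx _]]; [now apply num_lt|eauto]. }
    exists n, f. split; auto. apply (set_ext ZM). intros p. rewrite in_fseq. split.
    + intros hp. destruct (h1 p hp) as [i [x [hi hx]]]. apply in_num in hi. destruct hi as [m [hm ->]].
      exists m. split; auto. apply is_opairE with (ZM := ZM) in hx. subst p. f_equal.
      destruct (h2 (num m)) as [y [_ hy]]; [now apply num_lt|].
      rewrite <- (hy x), <- (hy (f m)); auto. now apply at_posE with (ZM := ZM).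
    + intros [m [hm ->]]. apply at_posE. auto.
Qed.

Definition code_parts (k s n c : M) :=
  is_opair k s c /\ is_fseq n s /\ exists n', is_succ n n' /\ fvc ZM k n'.

Instance d_code_parts : D4 N code_parts.
Proof. intros A a b c d. unfold code_parts. dtac. Qed.

Lemma code_partsE k s n c : code_parts k s n c <-> exists m r a,
  k = num (code r) /\ s = fseq ZM m a /\ n = num m /\ code_of ZM m r a c.
Proof.
  unfold code_parts, code_of. split.
  - intros [h1 [[m [a [-> ->]]] [n' [h2 [r [m' [-> [-> h3]]]]]]]].
    apply is_opairE with (ZM := ZM) in h1. apply is_succE with (ZM := ZM) in h2.
    change (num m' = num (S m)) in h2. apply num_inj in h2. subst m'.
    exists m, r, a. auto.
  - intros [m [r [a [-> [-> [-> [h1 h2]]]]]]]. split; [now apply is_opairE with (ZM := ZM)|].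
    split; [exists m, a; auto|]. exists (num (S m)). split; [now apply is_succE with (ZM := ZM)|].
    exists r, (S m). repeat split; auto.
Qed.

Instance d_code_valid : D1 N (code_valid ZM).
Proof.
  intros A a. apply (@dn_ext _ _ N A (fun _ e => exists k s n, code_parts k s n (e a))).
  2: dtac.
  intros _ e. split.
  - intros [m [r [f h]]]. exists (num (code r)), (fseq ZM m f), (num m). apply code_partsE. eauto 8.
  - intros [k [s [n h]]]. apply code_partsE in h. destruct h as [m [r [f h]]]. exists m, r, f. tauto.
Qed.

(** Entries of [t] beyond the parameters are left free, as the formula does not read them. The first
    argument of [kripke_truth] is a dummy world, filled with [t]. *)
Instance d_code_mem_of : D2 N (code_mem_of ZM).
Proof.
  intros A a b. apply (@dn_ext _ _ N A (fun _ e => exists k s n, code_parts k s n (e a) /\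
    exists t, is_seqc ZM t /\ (forall o, is_num 0 o -> at_pos t o (e b)) /\
      (forall i j y, i \in n -> is_succ i j -> at_pos s i y -> at_pos t j y) /\ kripke_truth t k t)).
  2: dtac.
  intros _ e. split.
  - intros [m [r [f [h1 h2]]]]. exists (num (code r)), (fseq ZM m f), (num m). split.
    + apply code_partsE. eauto 8.
    + exists (seqc (scons (e b) f)). split; [eexists; reflexivity|]. split; [|split].
      * intros o ho. apply is_numE with (ZM := ZM) in ho. subst o. now apply at_pos_num.
      * intros i j y hi hj hy. apply is_succE with (ZM := ZM) in hj.
        apply at_pos_fseq in hy. destruct hy as [i' [_ [-> ->]]]. subst j.
        now apply (at_pos_num ZM (scons (e b) f) (S i')).
      * unfold kripke_truth. rewrite kripke_code, ksat_at_seqc, ksat_tsat. auto.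
  - intros [k [s [n [h1 [t [[E ->] [h2 [h3 h4]]]]]]]].
    apply code_partsE in h1. destruct h1 as [m [r [f [-> [-> [-> h1]]]]]].
    exists m, r, f. split; auto. unfold kripke_truth in h4.
    rewrite kripke_code, ksat_at_seqc, ksat_tsat in h4. unfold tsat in *.
    eapply ksat_fv with (n := S m); [exact (proj1 h1)| |exact h4].
    intros [|i] hi; cbn.
    + apply at_pos_num with (ZM := ZM). apply h2. now apply is_numE with (ZM := ZM).
    + apply at_pos_num with (ZM := ZM). apply (h3 (num i)).
      * apply num_lt. lia.
      * now apply is_succE with (ZM := ZM).
      * apply at_pos_fseq. exists i. repeat split; auto. lia.
Qed.

Instance d_dcode : D1 N (dcode ZM).
Proof. intros A a. unfold dcode, dense. dtac. Qed.

Definition nth_code (xi c : M) := dcode ZM c /\ xi = pos ZM AllOD c.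

(** The recursion for [pos] is replaced by the existence of an enumeration, given as a set [g] of
    pairs; [enum_below_pos] shows that it determines the index. *)
Instance d_nth_code : D2 N nth_code.
Proof.
  intros A a b. apply (@dn_ext _ _ N A (fun _ e => ordinal (e a) /\ dcode ZM (e b) /\ exists g,
    (forall eta, eta \in e a -> exists d, at_pos g eta d) /\
    (forall eta d d', at_pos g eta d -> at_pos g eta d' -> d = d') /\
    (forall eta eta' d d', eta \in e a -> eta' \in e a -> eta \in eta' ->
       at_pos g eta d -> at_pos g eta' d' -> hod_lt d d') /\
    (forall d, (exists eta, eta \in e a /\ at_pos g eta d) <-> dcode ZM d /\ hod_lt d (e b)))).
  2: dtac.
  intros _ e. split.
  - intros [h ->]. split; [apply ordinal_pos|]. split; auto.
    destruct (pos_enum_below ZM AllOD (e b)) as [f [h1 h2]].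
    destruct (small_image ZM (fun eta => opair eta (f eta)) (small_mem (pos ZM AllOD (e b)))) as [g hg].
    assert (hg' : forall eta d, at_pos g eta d <-> eta \in pos ZM AllOD (e b) /\ d = f eta).
    { intros eta d. rewrite (at_posE ZM), hg. split.
      - intros [eta' [k1 k2]]. apply opair_inj in k2. destruct k2; subst. auto.
      - intros [k1 ->]. eauto. }
    exists g. split; [|split; [|split]].
    + intros eta he. exists (f eta). apply hg'. auto.
    + intros eta d d' k1 k2. rewrite hg' in *. destruct k1, k2. congruence.
    + intros eta eta' d d' k1 k2 k3 k4 k5. rewrite hg' in *. destruct k4, k5. subst. auto.
    + intros d. rewrite <- h2. split; intros [eta k]; exists eta; rewrite hg' in *; intuition.
  - intros [o [h [g [h1 [h2 [h3 h4]]]]]]. split; auto.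
    destruct (choice_on (empty ZM) h1) as [f hf].
    apply (@enum_below_pos M ZM AllOD f); auto. split.
    + intros eta eta' k1 k2 k3. apply (h3 eta eta'); auto.
    + intros d. rewrite <- h4. split.
      * intros [eta [k <-]]. eauto.
      * intros [eta [k1 k2]]. exists eta. split; auto. apply (h2 eta); auto.
Qed.

Lemma nth_code_dense xi D : nth_dense xi D <-> exists c, nth_code xi c /\ D = code_mem_of ZM c.
Proof. rewrite (nth_denseE ZM AllOD). unfold nth_code. split; intros [c h]; exists c; tauto. Qed.

Definition generic_clause (g eta q : M) :=
  (is_empty eta /\ is_empty q) \/
  (exists xi p c, is_succ xi eta /\ at_pos g xi p /\ nth_code xi c /\
    hod_least (fun r => condition r /\ incl p r /\ code_mem_of ZM c r) q) \/
  (limit_ordinal eta /\ (forall xi, xi \in eta -> exists p, at_pos g xi p) /\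
    forall z, z \in q <-> exists xi p, xi \in eta /\ at_pos g xi p /\ z \in p).

(** If each pair in [g] follows from pairs in [g] by a rule, induction on the index shows that all
    of them belong to the sequence. Conversely the sequence up to [xi] is such a set. *)
Lemma generic_seqE xi p : generic_seq xi p <->
  exists g, at_pos g xi p /\ forall eta q, at_pos g eta q -> generic_clause g eta q.
Proof.
  split.
  - intros h. pose proof (ordinal_generic_seq ZM h) as o.
    destruct (small_rel ZM (P := fun eta => eta \in succ ZM xi)
      (R := fun eta z => exists q, generic_seq eta q /\ z = opair eta q) (small_mem _)) as [g hg].
    { intros eta z z' _ [q [h1 ->]] [q' [h2 ->]]. now rewrite (generic_seq_unique ZM AllOD h1 h2). }
    assert (hg' : forall eta q, at_pos g eta q <-> eta \in succ ZM xi /\ generic_seq eta q).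
    { intros eta q. rewrite (at_posE ZM), hg. split.
      - intros [eta' [h1 [q' [h2 e]]]]. apply opair_inj in e. destruct e; subst. auto.
      - intros [h1 h2]. eauto. }
    exists g. split; [apply hg'; split; auto; apply in_succ; auto|].
    intros eta q hq. apply hg' in hq. destruct hq as [he hq].
    assert (hdown : forall xi', xi' \in eta -> xi' \in succ ZM xi).
    { intros xi' k. apply (ordinal_trans (ordinal_succ ZM o) he k). }
    inversion hq as [xi2 p2 k1 k2|xi2 xi2' p2 q2 D2 k1 k2 k3 k4|eta2 p2 f2 k1 k2 k3]; subst.
    + left. auto.
    + right. left. apply nth_code_dense in k3. destruct k3 as [c [k3 ->]].
      exists xi2, p2, c. split; auto. split; auto. apply hg'. split; auto.
      apply hdown. apply k2. auto.
    + right. right. split; auto. split.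
      * intros xi' k. exists (f2 xi'). apply hg'. auto.
      * intros z. rewrite k3. split.
        -- intros [xi' [k4 k5]]. exists xi', (f2 xi'). rewrite hg'. auto.
        -- intros [xi' [p' [k4 [k5 k6]]]]. apply hg' in k5. exists xi'. split; auto.
           now rewrite (generic_seq_unique ZM AllOD (k2 xi' k4) (proj2 k5)).
  - intros [g [h1 h2]]. revert p h1. induction (mem_wf ZM xi) as [xi _ IH]. intros p h1.
    destruct (h2 xi p h1) as [[k1 k2]|[[xi' [p' [c [k1 [k2 [k3 k4]]]]]]|[k1 [k2 k3]]]].
    + apply generic_zero; auto.
    + apply generic_succ with (xi := xi') (p := p') (D := code_mem_of ZM c); auto.
      * apply IH; auto. apply k1. auto.
      * apply nth_code_dense. eauto.
    + destruct (choice_on (empty ZM) k2) as [f hf].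
      assert (hgen : forall xi', xi' \in xi -> generic_seq xi' (f xi')) by auto.
      apply generic_limit with (f := f); auto. intros z. rewrite k3. split.
      * intros [xi' [p' [k4 [k5 k6]]]]. exists xi'. split; auto.
        now rewrite (generic_seq_unique ZM AllOD (IH xi' k4 _ (hf xi' k4)) (IH xi' k4 _ k5)).
      * intros [xi' [k4 k5]]. exists xi', (f xi'). auto.
Qed.

#[export] Instance d_generic : D1 N (@generic M).
Proof.
  intros A a. apply (@dn_ext _ _ N A (fun _ e => exists xi,
    exists g, at_pos g xi (e a) /\ forall eta q, at_pos g eta q -> generic_clause g eta q)).
  - intros _ e. unfold generic. split; intros [xi h]; exists xi; now apply generic_seqE.
  - unfold generic_clause, hod_least. dtac.
Qed.

End GenericDefinable.

(** * Forcing *)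

Section Forcing.
Variable M : mstruct.
Hypothesis ZM : ZFC M.
Hypothesis AllOD : forall x : M, OD x.

Local Notation num := (num ZM).
Local Notation opair := (opair ZM).
Local Notation seqc := (seqc ZM).
Local Notation C := (@canonical_generic M).

Definition value_one (p x : M) := exists i z, is_num 1 i /\ is_opair x i z /\ z \in p.
(** The stronger condition comes second, as the order of worlds in [ksat] requires. *)
Definition extends (p q : M) := condition q /\ incl p q.
(* The density clause makes [forces_weak] true of atomic formulas. *)
Definition forces_in (p x : M) := forall q, extends p q -> exists s, extends q s /\ value_one s x.
Definition forces_mem (p x y : M) := x \in y \/ (x = y /\ forces_in p x).

#[export] Instance d_value_one Z (N : notion M Z) : D2 N value_one.
Proof. intros A a b. unfold value_one. dtac. Qed.
#[export] Instance d_extends Z (N : notion M Z) : D2 N extends.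
Proof. intros A a b. unfold extends. dtac. Qed.
#[export] Instance d_forces_mem Z (N : notion M Z) : D3 N forces_mem.
Proof. intros A a b c. unfold forces_mem, forces_in. dtac. Qed.
Lemma d_true2 Z (N : notion M Z) : D2 N (fun _ _ => True).
Proof. intros A a b. dtac. Qed.

(* The conditions add no sets, so the elements of [M] serve as their own names. *)
Definition forces : M -> raw -> (nat -> M) -> Prop := ksat extends (fun _ _ => True) forces_mem.

Lemma extends_trans p q s : extends p q -> extends q s -> extends p s.
Proof. intros [h1 h2] [h3 h4]. split; auto. intros z hz. auto. Qed.

Lemma extends_refl p : condition p -> extends p p.
Proof. intros h. split; auto. intros z; auto. Qed.

Lemma forces_mono r : forall p q E, extends p q -> forces p r E -> forces q r E.
Proof.
  unfold forces. induction r; intros p q E h; cbn; auto.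
  - intros [h'|[h1 h2]]; [left; auto|right; split; auto].
    intros s hs. apply h2. eauto using extends_trans.
  - intros h' s hs. apply h'. eauto using extends_trans.
  - intros [h1 h2]. eauto.
  - intros h' z _. eauto.
Qed.

(** For membership, either [\in] settles the matter or [forces_in] does, which is itself a density
    statement. For a negation, an extension forcing [r] would have a further one forcing both [r]
    and its negation. *)
Lemma forces_weak r : forall p E, condition p ->
  (forall q, extends p q -> exists s, extends q s /\ forces s r E) -> forces p r E.
Proof.
  unfold forces. induction r; intros p E hp h; cbn.
  - destruct (h p (extends_refl hp)) as [s [_ h']]. exact h'.
  - destruct (classic (E i \in E j)) as [h1|h1]; [left; auto|].
    right. split.
    + destruct (h p (extends_refl hp)) as [s [_ [h'|[h' _]]]]; [contradiction|exact h'].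
    + intros q hq. destruct (h q hq) as [s [h2 [h'|[_ h']]]]; [contradiction|].
      destruct (h' s (extends_refl (proj1 h2))) as [t [h3 h4]].
      exists t. eauto using extends_trans.
  - intros q hq hf. destruct (h q hq) as [s [h1 h2]]. cbn in h2.
    apply (h2 s (extends_refl (proj1 h1))). exact (forces_mono h1 hf).
  - split; [apply IHr1|apply IHr2]; auto; intros q hq; destruct (h q hq) as [s [h1 [h2 h3]]]; eauto.
  - intros z _. apply IHr; auto. intros q hq. destruct (h q hq) as [s [h1 h2]]. exists s. split; auto.
Qed.

(* No set is a member of itself, so [C] can be coded into the membership relation; the formulas
   then need no predicate symbol. *)
Definition mem_or_generic (x y : M) := x \in y \/ (x = y /\ C x).

Lemma canonical_genericE x : C x <-> exists p, generic p /\ value_one p x.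
Proof.
  unfold canonical_generic, generic_function, generic, value_one. split.
  - intros [i [z [h1 [h2 [xi [p [h3 h4]]]]]]]. eauto 8.
  - intros [p [[xi h3] [i [z [h1 [h2 h4]]]]]]. eauto 10.
Qed.

Lemma generic_extends p q : generic p -> generic q -> exists s, generic s /\ extends p s /\ extends q s.
Proof.
  intros hp hq. pose proof (generic_condition ZM AllOD hp). pose proof (generic_condition ZM AllOD hq).
  destruct (generic_total ZM AllOD hp hq) as [h|h].
  - exists q. repeat split; auto. intros z; auto.
  - exists p. repeat split; auto. intros z; auto.
Qed.

(** Genericity in the form used below: one parameter is enough, since it can be a whole assignment
    coded by [seqc]. *)
Lemma generic_meets_rel (R : M -> M -> Prop) (a : M) : D2 (fo_notion M) R ->
  (forall p, condition p -> exists q, extends p q /\ R q a) -> exists p, generic p /\ R p a.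
Proof.
  intros dR h.
  destruct (generic_meets ZM AllOD (D := fun p => condition p /\ R p a)) as [p [h1 [h2 h3]]].
  - split; [tauto|]. intros p hp. destruct (h p hp) as [q [h1 h2]]. exists q. split; [|apply h1].
    split; [apply h1|auto].
  - apply (fo_Def1 (R := fun p b => condition p /\ R p b)). intros A b c. dtac.
  - eauto.
Qed.

(** In each direction from truth to forcing that is not immediate, a dense class of conditions
    deciding the matter is met. It lies in [Def M] because [r] is fixed in the metatheory, so that
    [ksat_at] is first-order definable. *)
Lemma truth_lemma r : forall E,
  tsat mem_or_generic r E <-> exists p, generic p /\ forces p r E.
Proof.
  pose (d_true := fun Z (N : notion M Z) => d_true2 N).
  pose (dF := fun r => @d_ksat_at M ZM extends (fun _ _ => True) forces_mem
     (@d_extends) (@d_true) (@d_forces_mem) unit (fo_notion M) r).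
  assert (HF : forall r p E, ksat_at ZM extends (fun _ _ => True) forces_mem r p (seqc E) <-> forces p r E).
  { intros. apply ksat_at_seqc. }
  induction r; intros E.
  - unfold tsat, forces. cbn. split; [|intros [p [_ h]]; auto]. intros h.
    (* The class of all conditions is dense; this merely provides some generic condition. *)
    destruct (@generic_meets_rel (fun p _ => condition p) (empty ZM)) as [p [hp _]].
    + intros A a b. dtac.
    + intros p hp. exists p. auto using extends_refl.
    + eauto.
  - unfold tsat, forces. cbn. split.
    + intros [h|[h1 h2]].
      * destruct (@generic_meets_rel (fun p _ => condition p) (empty ZM)) as [p [hp _]].
        -- intros A a b. dtac.
        -- intros p hp. exists p. auto using extends_refl.
        -- exists p. split; auto. left. auto.
      * apply canonical_genericE in h2. destruct h2 as [p [hp h2]]. exists p. split; auto.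
        right. split; auto. intros q hq. exists q. split; [apply extends_refl, hq|].
        destruct h2 as [u [z [k1 [k2 k3]]]]. exists u, z. repeat split; auto. apply hq. auto.
    + intros [p [hp [h|[h1 h2]]]]; [left; auto|right; split; auto].
      (* Conditions that give [E i] the value one or have no extension doing so. The second
         alternative is impossible below a condition satisfying [forces_in]. *)
      destruct (@generic_meets_rel (fun q x => value_one q x \/ ~ exists s, extends q s /\ value_one s x) (E i))
        as [q [hq h3]].
      * intros A a b. dtac.
      * intros q hq. destruct (classic (exists s, extends q s /\ value_one s (E i))) as [[s [k1 k2]]|n].
        -- exists s. auto.
        -- exists q. auto using extends_refl.
      * apply canonical_genericE. destruct h3 as [h3|h3]; [eauto|].
        destruct (generic_extends hp hq) as [s [hs [k1 k2]]].
        destruct (h2 s k1) as [t [k3 k4]]. exfalso. apply h3. exists t. eauto using extends_trans.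
  - unfold tsat in *. cbn. split.
    + intros h.
      (* Conditions that force [r] or its negation. *)
      destruct (@generic_meets_rel (fun p s => ksat_at ZM extends (fun _ _ => True) forces_mem r p s \/
         ksat_at ZM extends (fun _ _ => True) forces_mem (rNeg r) p s) (seqc E)) as [p [hp h']].
      * intros A a b. pose proof (dF r). pose proof (dF (rNeg r)). dtac.
      * intros p hp. destruct (classic (exists q, extends p q /\ forces q r E)) as [[q [k1 k2]]|n].
        -- exists q. rewrite HF. auto.
        -- exists p. split; [auto using extends_refl|]. right. rewrite HF. intros q hq hf. eauto.
      * exists p. split; auto. rewrite !HF in h'. destruct h' as [h'|h']; auto.
        exfalso. apply (h tt I). apply IHr. eauto.
    + intros [p [hp h]] w _ h'. destruct w. apply IHr in h'. destruct h' as [q [hq h']].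
      destruct (generic_extends hp hq) as [s [hs [k1 k2]]].
      apply (h s k1). exact (forces_mono k2 h').
  - unfold tsat, forces in *. cbn. rewrite IHr1, IHr2. split.
    + intros [[p [hp h1]] [q [hq h2]]]. destruct (generic_extends hp hq) as [s [hs [k1 k2]]].
      exists s. split; auto. split; [exact (forces_mono k1 h1)|exact (forces_mono k2 h2)].
    + intros [p [hp [h1 h2]]]. split; exists p; auto.
  - unfold tsat in *. cbn. split.
    + intros h.
      (* Conditions that force the universal formula or the negation of an instance. If no extension
         of [p] does the latter, [forces_weak] gives every instance at [p]. *)
      destruct (@generic_meets_rel (fun p s => ksat_at ZM extends (fun _ _ => True) forces_mem (rAll r) p s \/
         exists z s', cons_seq ZM z s s' /\
         ksat_at ZM extends (fun _ _ => True) forces_mem (rNeg r) p s') (seqc E)) as [p [hp h']].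
      * intros A a b. pose proof (dF (rAll r)). pose proof (dF (rNeg r)). dtac.
      * intros p hp. destruct (classic (exists z q, extends p q /\ forces q (rNeg r) (scons z E)))
          as [[z [q [k1 k2]]]|n].
        -- exists q. split; auto. right. exists z, (seqc (scons z E)). rewrite HF. split; auto.
           exists E. auto.
        -- exists p. split; [auto using extends_refl|]. left. rewrite HF. intros z _.
           apply forces_weak; auto. intros q hq. apply NNPP. intros n'. apply n. exists z, q.
           split; auto. intros s hs hf. apply n'. eauto.
      * exists p. split; auto. destruct h' as [h'|[z [s' [[E' [e ->]] h']]]]; [now rewrite HF in h'|].
        assert (E = E') by (apply functional_extensionality, (seqc_inj e)). subst E'.
        exfalso. rewrite HF in h'. destruct (proj1 (IHr _) (h z I)) as [q [hq h2]].
        destruct (generic_extends hp hq) as [s [hs [k1 k2]]]. apply (h' s k1). exact (forces_mono k2 h2).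
    + intros [p [hp h]] z _. apply IHr. exists p. split; auto.
Qed.

(** The diagonal of [mem_or_generic] is [C]; the rest of the relation is membership. *)
Fixpoint raw_of_C (A : Set) (v : A -> nat) (f : form unit A) {struct f} : raw :=
  match f with
  | Eq _ x y => rEq (v x) (v y)
  | Mem _ x y => rConj (rMem (v x) (v y)) (rNeg (rEq (v x) (v y)))
  | Pred _ x => rMem (v x) (v x)
  | Neg f => rNeg (raw_of_C v f)
  | Conj f g => rConj (raw_of_C v f) (raw_of_C v g)
  | All f => rAll (raw_of_C (cons_env 0 (fun a => S (v a))) f)
  end.

Lemma sat_raw_of_C (A : Set) (f : form unit A) :
  forall (v : A -> nat) (e : A -> M) (E : nat -> M), (forall a, E (v a) = e a) ->
  (sat (fun _ : unit => C) e f <-> tsat mem_or_generic (raw_of_C v f) E).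
Proof.
  unfold tsat. induction f; intros v e E h; cbn; rewrite ?h.
  - tauto.
  - unfold mem_or_generic. split.
    + intros H. split; auto. intros _ _ e'. rewrite e' in H. exact (mem_irrefl ZM H).
    + intros [[H|[H _]] H']; auto. exfalso. exact (H' tt I H).
  - unfold mem_or_generic. split; [auto|]. intros [H|[_ H]]; auto. destruct (mem_irrefl ZM H).
  - rewrite IHf by eauto. split; [intros H [] _; exact H|]. intros H; apply (H tt I).
  - rewrite IHf1, IHf2 by eauto. tauto.
  - assert (H : forall x, sat (fun _ : unit => C) (cons_env x e) f <->
      tsat mem_or_generic (raw_of_C (cons_env 0 (fun a : A => S (v a))) f) (scons x E)).
    { intros x. apply IHf. intros [a|]; cbn; auto. }
    split; intros H' x; [intros _; apply H; exact (H' x)|apply H; exact (H' x I)].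
Qed.

Lemma raw_to_C r : forall (A : Set) (v : A -> nat) n,
  (forall i, i < n -> exists a, v a = i) -> fv_below n r -> exists f : form unit A,
  forall e E, (forall a, E (v a) = e a) ->
    (sat (fun _ : unit => C) e f <-> tsat mem_or_generic r E).
Proof.
  unfold tsat. induction r; cbn; intros A v n hv h.
  - destruct h as [h1 h2]. destruct (hv i h1) as [a <-], (hv j h2) as [b <-].
    exists (Eq _ a b). intros e E h. cbn. rewrite !h. tauto.
  - destruct h as [h1 h2]. destruct (hv i h1) as [a <-], (hv j h2) as [b <-].
    exists (Neg (Conj (Neg (Mem _ a b)) (Neg (Conj (Eq _ a b) (Pred tt a))))). intros e E h. cbn.
    rewrite !h. unfold mem_or_generic. tauto.
  - destruct (IHr A v n hv h) as [f hf]. exists (Neg f). intros e E h'. cbn. rewrite (hf e E h').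
    split; [intros H [] _; exact H|]. intros H; apply (H tt I).
  - destruct h as [h1 h2]. destruct (IHr1 A v n hv h1) as [f hf], (IHr2 A v n hv h2) as [g hg].
    exists (Conj f g). intros e E h'. cbn. rewrite (hf e E h'), (hg e E h'). tauto.
  - destruct (IHr (option A) (cons_env 0 (fun a => S (v a))) (S n)) as [f hf]; auto.
    + intros [|i] hi.
      * exists None. auto.
      * destruct (hv i) as [a <-]; [lia|]. exists (Some a). auto.
    + exists (All f). intros e E h'. cbn.
      assert (H : forall x, sat (fun _ : unit => C) (cons_env x e) f <->
        tsat mem_or_generic r (scons x E)).
      { intros x. apply hf. intros [a|]; cbn; auto. }
      split; intros H' x; [intros _; apply H; exact (H' x)|apply H; exact (H' x I)].
Qed.

Lemma DefWith_raw P : DefWith C P <-> exists r E, forall x, P x <-> tsat mem_or_generic r (scons x E).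
Proof.
  split.
  - intros [n [f [a h]]]. destruct (env_of_Fin ZM a) as [E hE].
    exists (raw_of_C (@var1 n) f), E. intros x. rewrite (h x). apply sat_raw_of_C.
    intros [i|]; cbn; auto.
  - intros [r [E h]]. destruct (fv_below_exists r) as [n hn].
    destruct (@raw_to_C r (option (Fin.t n)) (@var1 n) (S n)) as [f hf].
    + apply var1_onto.
    + apply fv_below_mono with (n := n); auto.
    + exists n, f, (fun i => E (fin_val i)). intros x. rewrite h. symmetry. apply hf.
      intros [i|]; cbn; auto.
Qed.

Lemma Def_raw P : Def P <-> exists r E, forall x : M, P x <-> tsat (@mem M) r (scons x E).
Proof.
  split.
  - intros [n [f [a h]]]. destruct (env_of_Fin ZM a) as [E hE].
    exists (raw1 f), E. intros x. rewrite (h x). apply sat_raw_of.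
    intros [i|]; cbn; auto.
  - intros [r [E h]]. destruct (fv_below_exists r) as [n hn].
    destruct (@raw1_onto n r) as [f <-].
    + apply fv_below_mono with (n := n); auto.
    + exists n, f, (fun i => E (fin_val i)). intros x. rewrite h. symmetry. apply sat_raw_of.
      intros [i|]; cbn; auto.
Qed.

Lemma Def_DefWith P : Def P -> DefWith C P.
Proof.
  assert (H : forall (A : Set) (f : form Empty_set A), exists g : form unit A,
    forall e, sat (@no_pred M) e f <-> sat (fun _ : unit => C) e g).
  { induction f.
    - exists (Eq _ x y). reflexivity.
    - exists (Mem _ x y). reflexivity.
    - destruct c.
    - destruct IHf as [g hg]. exists (Neg g). intros e. cbn. now rewrite hg.
    - destruct IHf1 as [g hg], IHf2 as [g' hg']. exists (Conj g g'). intros e. cbn. now rewrite hg, hg'.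
    - destruct IHf as [g hg]. exists (All g). intros e. cbn.
      split; intros h x; apply hg; auto. }
  intros [n [f [a h]]]. destruct (H _ f) as [g hg]. exists n, g, a. intros x. rewrite (h x). apply hg.
Qed.

(** * Coded classes *)

Definition kripke_forces := kripke ZM extends (fun _ _ => True) forces_mem.

(** The element [x] is put in front of the parameters [s]. The first argument of [kripke_truth] is a
    dummy world. *)
Definition in_coded (k s x : M) := exists s', cons_seq ZM x s s' /\ kripke_truth ZM s k s'.
(** By the truth lemma this is truth in the expansion by [C], expressed without a satisfaction class
    for that structure. *)
Definition in_coded_C (k s x : M) := exists p, generic p /\ exists s', cons_seq ZM x s s' /\ kripke_forces p k s'.

Lemma cons_seq_seqc x E s' : cons_seq ZM x (seqc E) s' <-> s' = seqc (scons x E).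
Proof.
  split; [|intros ->; exists E; auto]. intros [E' [e ->]].
  assert (E = E') by (apply functional_extensionality, (seqc_inj e)). now subst.
Qed.

Lemma in_codedE r E x : in_coded (num (code r)) (seqc E) x <-> tsat (@mem M) r (scons x E).
Proof.
  unfold in_coded. split.
  - intros [s' [h1 h2]]. apply cons_seq_seqc in h1. subst s'. unfold kripke_truth in h2.
    now rewrite kripke_code, ksat_at_seqc, ksat_tsat in h2.
  - intros h. exists (seqc (scons x E)). rewrite cons_seq_seqc. split; auto. unfold kripke_truth.
    now rewrite kripke_code, ksat_at_seqc, ksat_tsat.
Qed.

Lemma in_coded_CE r E x : in_coded_C (num (code r)) (seqc E) x <-> tsat mem_or_generic r (scons x E).
Proof.
  unfold in_coded_C, kripke_forces. rewrite truth_lemma. split.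
  - intros [p [hp [s' [h1 h2]]]]. apply cons_seq_seqc in h1. subst s'.
    rewrite kripke_code, ksat_at_seqc in h2. eauto.
  - intros [p [hp h]]. exists p. split; auto. exists (seqc (scons x E)). rewrite cons_seq_seqc. split; auto.
    now rewrite kripke_code, ksat_at_seqc.
Qed.

Lemma Def_coded P : Def P <-> exists k s, is_nat ZM k /\ is_seqc ZM s /\ forall x, P x <-> in_coded k s x.
Proof.
  rewrite Def_raw. split.
  - intros [r [E h]]. exists (num (code r)), (seqc E). split; [exists (code r); auto|].
    split; [exists E; auto|]. intros x. rewrite in_codedE. auto.
  - intros [k [s [[n ->] [[E ->] h]]]]. destruct (code_onto n) as [r <-]. exists r, E.
    intros x. rewrite <- in_codedE. auto.
Qed.

Lemma DefWith_coded P : DefWith C P <->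
  exists k s, is_nat ZM k /\ is_seqc ZM s /\ forall x, P x <-> in_coded_C k s x.
Proof.
  rewrite DefWith_raw. split.
  - intros [r [E h]]. exists (num (code r)), (seqc E). split; [exists (code r); auto|].
    split; [exists E; auto|]. intros x. rewrite in_coded_CE. auto.
  - intros [k [s [[n ->] [[E ->] h]]]]. destruct (code_onto n) as [r <-]. exists r, E.
    intros x. rewrite <- in_coded_CE. auto.
Qed.

Variable X : (M -> Prop) -> Prop.
Hypothesis HX : forall P, Def P -> X P.

Instance d_kripke_V (B : Set) : D3 (cl_notion X B) (kripke_V ZM).
Proof.
  apply d_kripke; auto; intros Z N A a b; [apply dn_eq| |intros c; apply dn_mem].
  apply (@d2 _ _ _ _ (d_in_V ZM N)).
Qed.

Instance d_kripke_truth (B : Set) : D3 (cl_notion X B) (kripke_truth ZM).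
Proof.
  apply d_kripke; auto; intros Z N A a b; [apply dn_eq|apply dn_true|intros c; apply dn_mem].
Qed.

Instance d_kripke_forces (B : Set) : D3 (cl_notion X B) kripke_forces.
Proof.
  apply d_kripke; auto; intros Z N; try exact _. apply d_true2.
Qed.

Instance d_generic_cl (B : Set) : D1 (cl_notion X B) (@generic M).
Proof. apply d_generic with (ZM := ZM); auto; exact _. Qed.

#[export] Instance d_in_coded (B : Set) : D3 (cl_notion X B) in_coded.
Proof. intros A a b c. unfold in_coded. dtac. Qed.

#[export] Instance d_in_coded_C (B : Set) : D3 (cl_notion X B) in_coded_C.
Proof. intros A a b c. unfold in_coded_C. dtac. Qed.

End Forcing.

(** * Comprehension *)

Lemma sig_ext (T : Type) (P : T -> Prop) (x y : {t | P t}) : proj1_sig x = proj1_sig y -> x = y.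
Proof.
  destruct x as [x hx], y as [y hy]. simpl. intros ->.
  now rewrite (proof_irrelevance _ hx hy).
Qed.

Section Renaming.
Variable P : Set.

Fixpoint form_map (A B : Set) (h : A -> B) (f : form P A) {struct f} : form P B :=
  match f with
  | Eq _ x y => Eq _ (h x) (h y)
  | Mem _ x y => Mem _ (h x) (h y)
  | Pred c x => Pred c (h x)
  | Neg f => Neg (form_map h f)
  | Conj f g => Conj (form_map h f) (form_map h g)
  | All f => All (form_map (option_map h) f)
  end.

Variables (M : mstruct) (I : P -> M -> Prop).

Lemma sat_form_map (A : Set) (f : form P A) : forall (B : Set) (h : A -> B) (e : B -> M),
  sat I e (form_map h f) <-> sat I (fun a => e (h a)) f.
Proof.
  induction f; intros B h e; cbn; try tauto.
  - now rewrite IHf.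
  - now rewrite IHf1, IHf2.
  - assert (H : forall x, sat I (cons_env x e) (form_map (option_map h) f) <->
      sat I (cons_env x (fun a => e (h a))) f).
    { intros x. rewrite IHf. replace (fun a => cons_env x e (option_map h a)) with (cons_env x (fun a => e (h a))).
      - tauto.
      - apply functional_extensionality. intros [a|]; reflexivity. }
    split; intros h' x; apply H; auto.
Qed.

(** A formula depends on finitely many variables. The weight [w] is general because [All] adds a
    variable; it receives weight 0, and the bound for the others is unchanged. *)
Lemma sat_local (A : Set) (f : form P A) : forall w : A -> nat, exists n, forall e e' : A -> M,
  (forall a, w a < n -> e a = e' a) -> (sat I e f <-> sat I e' f).
Proof.
  induction f; intros w.
  - exists (S (w x + w y)). intros e e' h. cbn. rewrite !h by lia. tauto.
  - exists (S (w x + w y)). intros e e' h. cbn. rewrite !h by lia. tauto.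
  - exists (S (w x)). intros e e' h. cbn. rewrite !h by lia. tauto.
  - destruct (IHf w) as [n hn]. exists n. intros e e' h. cbn. rewrite (hn e e' h). tauto.
  - destruct (IHf1 w) as [n hn], (IHf2 w) as [m hm]. exists (n + m). intros e e' h. cbn.
    rewrite (hn e e'), (hm e e'); [tauto| |]; intros a ha; apply h; lia.
  - destruct (IHf (cons_env 0 w)) as [n hn]. exists n. intros e e' h. cbn.
    assert (H : forall x, sat I (cons_env x e) f <-> sat I (cons_env x e') f).
    { intros x. apply hn. intros [a|]; cbn; auto. }
    split; intros h' x; apply H; auto.
Qed.

Lemma definable_nat (f : form P (option nat)) (a : nat -> M) :
  definable I (fun x => sat I (cons_env x a) f).
Proof.
  destruct (sat_local f (cons_env 0 (fun i => i))) as [n hn].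
  (* Taking [S n] parameters makes [Fin.F1] available as default for the variables beyond the
     bound. *)
  pose (h := fun i => match lt_dec i (S n) with
    left l => Fin.of_nat_lt l | right _ => Fin.F1 end).
  exists (S n), (form_map (option_map h) f), (fun i => a (fin_val i)). intros x.
  rewrite sat_form_map. apply hn. intros [i|] hi; cbn in *; auto.
  unfold h. destruct (lt_dec i (S n)) as [l|l]; [|lia]. unfold fin_val. now rewrite Fin.to_nat_of_nat.
Qed.

End Renaming.

Section Comprehension.
Variable M : mstruct.
Hypothesis ZM : ZFC M.
Variables (P : Set) (I : P -> M -> Prop).
Let S := class_structure (definable I).

Definition split_env (G : ctx) (b : G class_sort -> {Q : M -> Prop | definable I Q})
  (e : G set_sort -> M) : env G S :=
  fun t => match t return G t -> S t with set_sort => e | class_sort => b end.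

Definition sum_env (A B : Set) (e : A -> M) (a : B -> M) (v : A + B) : M :=
  match v with inl x => e x | inr y => a y end.

(** Merges the parameters of two formulas into one sequence when the formulas are combined. *)
Lemma interleave (a a' : nat -> M) : exists b, forall n, b (2 * n) = a n /\ b (2 * n + 1) = a' n.
Proof.
  exists (fun n => if Nat.even n then a (Nat.div2 n) else a' (Nat.div2 n)). intros n. split.
  - rewrite Nat.even_even. now rewrite Nat.div2_double.
  - rewrite Nat.even_odd. now rewrite Nat.add_1_r, Nat.div2_succ_double.
Qed.

(** Each class parameter is replaced by a formula defining it, and the parameters of all these
    formulas are gathered in [a]. *)
Lemma first_order_to_form (G : ctx) (f : cform G) : first_order f -> forall b,
  exists (a : nat -> M) (g : form P (G set_sort + nat)), forall e,
    csat (split_env b e) f <-> sat I (sum_env e a) g.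
Proof.
  pose (m := empty ZM).
  induction f as [G s x y|G s x y|G f IH|G f IHf g IHg|G s f IH]; cbn [first_order]; intros fo b.
  - destruct s.
    + exists (fun _ => m), (Eq _ (inl x) (inl y)). intros e. reflexivity.
    (* Equality of two class parameters does not depend on [e], so it becomes a formula that is
       always true or always false. *)
    + destruct (classic (b x = b y)) as [h|h].
      * exists (fun _ => m), (All (Eq _ None None)). intros e. cbn. tauto.
      * exists (fun _ => m), (Neg (All (Eq _ None None))). intros e. cbn.
        split; [tauto|]. intros H. exfalso. apply H. auto.
  - destruct s.
    + exists (fun _ => m), (Mem _ (inl x) (inl y)). intros e. reflexivity.
    + destruct (b y) as [Q [n [g [a hg]]]] eqn:E.
      destruct (env_of_Fin ZM a) as [a' ha'].
      exists a', (form_map (fun v => match v with None => inl x | Some i => inr (fin_val i) end) g).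
      intros e. rewrite sat_form_map. cbn. rewrite E. cbn. rewrite (hg (e x)).
      replace (fun a0 : option (Fin.t n) => sum_env e a' match a0 with Some i => inr (fin_val i) | None => inl x end)
        with (cons_env (e x) a); [tauto|].
      apply functional_extensionality. intros [i|]; cbn; auto.
  - destruct (IH fo b) as [a [g h]]. exists a, (Neg g). intros e. cbn. now rewrite h.
  - destruct fo as [fo1 fo2]. destruct (IHf fo1 b) as [a1 [g1 h1]], (IHg fo2 b) as [a2 [g2 h2]].
    destruct (interleave a1 a2) as [a ha].
    exists a, (Conj (form_map (fun v => match v with inl x => inl x | inr n => inr (2 * n) end) g1)
                    (form_map (fun v => match v with inl x => inl x | inr n => inr (2 * n + 1) end) g2)).
    intros e. cbn [csat sat]. rewrite !sat_form_map, h1, h2.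
    replace (fun v => sum_env e a match v with inl x => inl x | inr n => inr (2 * n) end) with (sum_env e a1).
    replace (fun v => sum_env e a match v with inl x => inl x | inr n => inr (2 * n + 1) end) with (sum_env e a2).
    + tauto.
    + apply functional_extensionality. intros [x|n]; cbn [sum_env]; auto. now rewrite (proj2 (ha n)).
    + apply functional_extensionality. intros [x|n]; cbn [sum_env]; auto. now rewrite (proj1 (ha n)).
  - destruct fo as [-> fo]. destruct (IH fo b) as [a [g h]].
    exists a, (All (form_map (fun v => match v with
      inl None => None | inl (Some x) => Some (inl x) | inr n => Some (inr n) end) g)).
    intros e. cbn [sat].
    assert (H : forall x, csat (@ext_env S set_sort _ x (split_env b e)) f <->
      sat I (cons_env x (sum_env e a)) (form_map (fun v => match v with
      inl None => None | inl (Some x) => Some (inl x) | inr n => Some (inr n) end) g)).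
    { intros x. rewrite sat_form_map. etransitivity; [exact (h (cons_env x e))|].
      replace (fun a0 => cons_env x (sum_env e a) match a0 with
         inl None => None | inl (Some x) => Some (inl x) | inr n => Some (inr n) end)
         with (sum_env (cons_env x e) a).
      - reflexivity.
      - apply functional_extensionality. intros [[y|]|n]; reflexivity. }
    split; intros h' x; apply H, h'.
Qed.

Lemma first_order_definable Q : fo_predicate (definable I) Q -> definable I Q.
Proof.
  intros [d [f [e [fo h]]]].
  destruct (first_order_to_form fo (e class_sort)) as [a [g hg]].
  destruct (env_of_Fin ZM (e set_sort)) as [a' ha'].
  destruct (interleave a' a) as [c hc].
  replace Q with (fun x => sat I (cons_env x c) (form_map (fun v => match v with
    | inl None => None | inl (Some i) => Some (2 * fin_val i) | inr n => Some (2 * n + 1) end) g)).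
  { apply definable_nat. }
  apply functional_extensionality. intros x. apply propositional_extensionality.
  rewrite (h x), sat_form_map.
  transitivity (csat (split_env (G := ext set_sort (fin_ctx d)) (e class_sort) (cons_env x (e set_sort))) f).
  - rewrite (hg (cons_env x (e set_sort))).
    match goal with |- sat I ?u g <-> sat I ?v g => replace u with v; [tauto|] end.
    apply functional_extensionality. intros [[i|]|n]; cbn [sum_env cons_env]; auto.
    + rewrite (proj1 (hc _)). auto.
    + now rewrite (proj2 (hc n)).
  - match goal with |- csat ?u f <-> csat ?v f => replace u with v; [tauto|] end.
    apply functional_extensionality_dep. intros [|]; reflexivity.
Qed.

(** The schemata and Class Replacement are instances of the full schemata of [M]; Comprehension is
    the substitution of class parameters carried out above. *)
Lemma GB_definable : GB (definable I).
Proof.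
  split.
  - split; try apply ZM.
    + intros Q _. apply (zfc_separation ZM). exact Logic.I.
    + intros R _. apply (zfc_replacement ZM). exact Logic.I.
  - intros A B h. apply sig_ext. apply functional_extensionality. intros x.
    apply propositional_extensionality. exact (h x).
  - intros F R hR a. apply (zfc_replacement ZM); auto.
  - intros Q hQ. exists (exist _ Q (first_order_definable hQ)). intros x. reflexivity.
Qed.

End Comprehension.

(** * Bi-interpretation *)

Definition ext_map (s : sort) (G H : ctx) (h : forall t, G t -> H t) : forall t, ext s G t -> ext s H t :=
  match s return forall t, ext s G t -> ext s H t with
  | set_sort => fun t => match t return ext set_sort G t -> ext set_sort H t with
      | set_sort => option_map (h set_sort) | class_sort => h class_sort end
  | class_sort => fun t => match t return ext class_sort G t -> ext class_sort H t with
      | set_sort => h set_sort | class_sort => option_map (h class_sort) end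
  end.

Fixpoint cform_map (G H : ctx) (h : forall t, G t -> H t) (f : cform G) {struct f} : cform H :=
  match f with
  | CEq x y => CEq (h _ x) (h _ y)
  | CMem x y => CMem (h _ x) (h _ y)
  | CNeg f => CNeg (cform_map h f)
  | CConj f g => CConj (cform_map h f) (cform_map h g)
  | CAll f => CAll (cform_map (ext_map h) f)
  end.

Lemma csat_cform_map (S : structure) (G : ctx) (f : cform G) :
  forall (H : ctx) (h : forall t, G t -> H t) (e : env H S),
  csat e (cform_map h f) <-> csat (fun t a => e t (h t a)) f.
Proof.
  induction f as [G s x y|G s x y|G f IH|G f IHf g IHg|G s f IH]; intros H h e; cbn [cform_map csat].
  - tauto.
  - tauto.
  - now rewrite IH.
  - now rewrite IHf, IHg.
  - assert (E : forall x : S s, csat (ext_env x e) (cform_map (ext_map h) f) <->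
      csat (ext_env x (fun t a => e t (h t a))) f).
    { intros x. rewrite IH.
      replace (fun t (a : ext s G t) => ext_env x e (ext_map h a)) with (ext_env x (fun t a => e t (h t a))).
      - reflexivity.
      - apply functional_extensionality_dep. intros t. apply functional_extensionality. intros a.
        destruct s, t; try reflexivity; destruct a; reflexivity. }
    split; intros h' x; apply E, h'.
Qed.

(** A context is a function on sorts and agrees with [mkctx] only pointwise, so the formula is
    renamed along the identity. *)
Lemma cl_formula (M : mstruct) (X : (M -> Prop) -> Prop) (G : ctx)
  (R : (G class_sort -> {P : M -> Prop | X P}) -> (G set_sort -> M) -> Prop) :
  cl_notion X (G class_sort) (G set_sort) R ->
  exists f : cform G, forall e : env G (class_structure X), csat e f <-> R (e class_sort) (e set_sort).
Proof.
  intros [f hf].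
  exists (cform_map (fun t => match t return mkctx (G set_sort) (G class_sort) t -> G t with
     set_sort => fun a => a | class_sort => fun a => a end) f).
  intros e. rewrite csat_cform_map, hf.
  match goal with |- csat ?u f <-> csat ?v f => replace u with v; [tauto|] end.
  apply functional_extensionality_dep. intros [|]; reflexivity.
Qed.

(** A functional form of isomorphism modulo [eqr]. Surjectivity makes formulas invariant, so such a
    map can be lifted through interpretations. *)
Record is_hom (S T : structure) (d : forall s, S s -> T s) : Prop := {
  hom_surj : forall s y, exists x, d s x = y;
  hom_eq : forall s x y, eqr x y <-> eqr (d s x) (d s y);
  hom_mem : forall s x y, memr x y <-> memr (d set_sort x) (d s y) }.

Lemma csat_hom (S T : structure) (d : forall s, S s -> T s) : is_hom d ->
  forall (G : ctx) (f : cform G) (e : env G S), csat e f <-> csat (fun t a => d t (e t a)) f.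
Proof.
  intros hd G f. induction f as [G s x y|G s x y|G f IH|G f IHf g IHg|G s f IH]; intros e; cbn [csat].
  - apply hd.
  - apply hd.
  - now rewrite IH.
  - now rewrite IHf, IHg.
  - assert (E : forall x : S s, csat (ext_env x e) f <->
      csat (ext_env (d s x) (fun t a => d t (e t a))) f).
    { intros x. rewrite IH.
      replace (fun t (a : ext s G t) => d t (ext_env x e a)) with (ext_env (d s x) (fun t a => d t (e t a))).
      - reflexivity.
      - apply functional_extensionality_dep. intros t. apply functional_extensionality. intros a.
        destruct s, t; try reflexivity; destruct a; reflexivity. }
    split; intros h x.
    + destruct (hom_surj hd x) as [x' <-]. apply E, h.
    + apply E, h.
Qed.

Lemma hom_comp (S T W : structure) (d : forall s, S s -> T s) (d' : forall s, T s -> W s) :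
  is_hom d -> is_hom d' -> is_hom (fun s x => d' s (d s x)).
Proof.
  intros h h'. split.
  - intros s z. destruct (hom_surj h' z) as [y <-], (hom_surj h y) as [x <-]. eauto.
  - intros s x y. now rewrite (hom_eq h), (hom_eq h').
  - intros s x y. now rewrite (hom_mem h), (hom_mem h').
Qed.

Section MapInterpreted.
Variables (I : interpretation) (S T : structure) (d : forall s, S s -> T s).
Hypothesis hd : is_hom d.

(** Invariance of the domain formula allows decoding tuples entry by entry. This reduces an
    interpretation inside an interpreted copy to one inside the structure itself. *)
Definition map_interpreted s (x : interpreted I S s) : interpreted I T s :=
  exist _ (fun t a => d (proj1_sig x t a)) (proj1 (csat_hom hd _ (proj1_sig x)) (proj2_sig x)).

Lemma env_sum_map (G H : ctx) (e : env G S) (e' : env H S) :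
  (fun t a => d (env_sum e e' a)) = env_sum (fun t a => d (e t a)) (fun t a => d (e' t a)) :> env (ctx_sum G H) T.
Proof.
  apply functional_extensionality_dep. intros t. apply functional_extensionality. intros [a|a]; reflexivity.
Qed.

Lemma map_interpreted_hom : is_hom map_interpreted.
Proof.
  split.
  - intros s [e he].
    assert (hg : forall t a, exists x : S t, d x = e t a) by (intros; apply (hom_surj hd)).
    pose (g := (fun t a => proj1_sig (constructive_indefinite_description _ (hg t a))) : env (fin_ctx (dim I s)) S).
    assert (E : (fun t a => d (g t a)) = e).
    { apply functional_extensionality_dep. intros t. apply functional_extensionality. intros a.
      exact (proj2_sig (constructive_indefinite_description _ (hg t a))). }
    assert (hdom : csat g (dom_form I s)) by (apply (csat_hom hd); rewrite E; exact he).
    exists (exist _ g hdom). apply sig_ext. exact E.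
  - intros s x y. cbn. rewrite (csat_hom hd). now rewrite env_sum_map.
  - intros s x y. cbn. rewrite (csat_hom hd). now rewrite env_sum_map.
Qed.

End MapInterpreted.

Lemma hom_isomorphism (S T : structure) (d : forall s, S s -> T s) :
  (forall s (x y : T s), eqr x y <-> x = y) -> is_hom d -> is_isomorphism (fun s x y => d s x = y).
Proof.
  intros hT h. split.
  - eauto.
  - intros s y. exact (hom_surj h y).
  - intros s x y x' y' e e' <-. apply (hom_eq h), hT in e. apply hT in e'. congruence.
  - intros s x y x' y' <- <-. apply h.
  - intros s x y x' y' <- <-. apply h.
Qed.

Lemma hom_isomorphism_inv (S T : structure) (d : forall s, S s -> T s) (F : forall s, T s -> S s -> Prop) :
  (forall s (x y : T s), eqr x y <-> x = y) -> is_hom d ->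
  (forall s y x, F s y x <-> d s x = y) -> is_isomorphism F.
Proof.
  intros hT h hF. split.
  - intros s y. destruct (hom_surj h y) as [x hx]. exists x. now apply hF.
  - intros s x. exists (d s x). now apply hF.
  - intros s y x y' x' e e'. rewrite !hF. intros <-. apply (hom_eq h), hT in e'. apply hT in e. congruence.
  - intros s y x y' x'. rewrite !hF. intros <- <-. symmetry. apply h.
  - intros s y x y' x'. rewrite !hF. intros <- <-. symmetry. apply h.
Qed.

Lemma sort_choice (T : sort -> Type) (Q : forall s, T s -> Prop) :
  (forall s, exists f, Q s f) -> exists F : forall s, T s, forall s, Q s (F s).
Proof.
  intros h. exists (fun s => proj1_sig (constructive_indefinite_description _ (h s))).
  intros s. exact (proj2_sig (constructive_indefinite_description _ (h s))).
Qed.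

(** * The two interpretations and their composites *)

Section BiInterpretation.
Variable M : mstruct.
Hypothesis ZM : ZFC M.
Hypothesis AllOD : forall x : M, OD x.

Let C := @canonical_generic M.
Let S := class_structure (@Def M).
Let T := class_structure (DefWith C).

(* A class of the larger structure is represented in the smaller one by the number of a formula
   and a sequence of parameters. *)
Definition code_dim (s t : sort) : nat :=
  match s, t with
  | set_sort, set_sort => 1
  | class_sort, set_sort => 2
  | _, class_sort => 0
  end.

(** In the other direction every object represents itself, and the domain formula selects the
    classes of [Def M]. *)
Definition sub_dim (s t : sort) : nat :=
  match s, t with
  | set_sort, set_sort | class_sort, class_sort => 1
  | _, _ => 0
  end.

Definition code_dom (s : sort) : env (fin_ctx (code_dim s)) S -> Prop :=
  match s with
  | set_sort => fun _ => True
  | class_sort => fun e => is_nat ZM (e set_sort Fin.F1) /\ is_seqc ZM (e set_sort (Fin.FS Fin.F1))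
  end.

Definition code_equal (s : sort) : env (ctx_sum (fin_ctx (code_dim s)) (fin_ctx (code_dim s))) S -> Prop :=
  match s with
  | set_sort => fun e => e set_sort (inl Fin.F1) = e set_sort (inr Fin.F1)
  | class_sort => fun e => forall x : M,
      in_coded_C ZM (e set_sort (inl Fin.F1)) (e set_sort (inl (Fin.FS Fin.F1))) x <->
      in_coded_C ZM (e set_sort (inr Fin.F1)) (e set_sort (inr (Fin.FS Fin.F1))) x
  end.

Definition code_member (s : sort) :
    env (ctx_sum (fin_ctx (code_dim set_sort)) (fin_ctx (code_dim s))) S -> Prop :=
  match s with
  | set_sort => fun e => @mem M (e set_sort (inl Fin.F1)) (e set_sort (inr Fin.F1))
  | class_sort => fun e =>
      in_coded_C ZM (e set_sort (inr Fin.F1)) (e set_sort (inr (Fin.FS Fin.F1))) (e set_sort (inl Fin.F1))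
  end.

Lemma code_dom_forms : exists f : forall s, cform (fin_ctx (code_dim s)),
  forall s (e : env (fin_ctx (code_dim s)) S), csat e (f s) <-> code_dom e.
Proof.
  apply (sort_choice (T := fun s => cform (fin_ctx (code_dim s)))
    (Q := fun s f => forall e : env _ S, csat e f <-> code_dom e)).
  intros [|].
  - apply (@cl_formula M (@Def M) (fin_ctx (code_dim set_sort)) (fun _ _ => True)). dtac.
  - apply (@cl_formula M (@Def M) (fin_ctx (code_dim class_sort))
      (fun _ e => is_nat ZM (e Fin.F1) /\ is_seqc ZM (e (Fin.FS Fin.F1)))). dtac.
Qed.

Lemma code_eq_forms : exists f : forall s, cform (ctx_sum (fin_ctx (code_dim s)) (fin_ctx (code_dim s))),
  forall s (e : env (ctx_sum (fin_ctx (code_dim s)) (fin_ctx (code_dim s))) S), csat e (f s) <-> code_equal e.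
Proof.
  apply (sort_choice (T := fun s => cform (ctx_sum (fin_ctx (code_dim s)) (fin_ctx (code_dim s))))
    (Q := fun s f => forall e : env _ S, csat e f <-> code_equal e)).
  intros [|].
  - apply (@cl_formula M (@Def M) (ctx_sum (fin_ctx (code_dim set_sort)) (fin_ctx (code_dim set_sort)))
      (fun _ e => e (inl Fin.F1) = e (inr Fin.F1))). dtac.
  - pose proof (d_in_coded_C ZM AllOD (X := @Def M) (fun P h => h)).
    apply (@cl_formula M (@Def M) (ctx_sum (fin_ctx (code_dim class_sort)) (fin_ctx (code_dim class_sort)))
      (fun _ e => forall x : M, in_coded_C ZM (e (inl Fin.F1)) (e (inl (Fin.FS Fin.F1))) x <->
         in_coded_C ZM (e (inr Fin.F1)) (e (inr (Fin.FS Fin.F1))) x)). dtac.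
Qed.

Lemma code_mem_forms : exists f : forall s, cform (ctx_sum (fin_ctx (code_dim set_sort)) (fin_ctx (code_dim s))),
  forall s (e : env (ctx_sum (fin_ctx (code_dim set_sort)) (fin_ctx (code_dim s))) S),
  csat e (f s) <-> code_member e.
Proof.
  apply (sort_choice (T := fun s => cform (ctx_sum (fin_ctx (code_dim set_sort)) (fin_ctx (code_dim s))))
    (Q := fun s f => forall e : env _ S, csat e f <-> code_member e)).
  intros [|].
  - apply (@cl_formula M (@Def M) (ctx_sum (fin_ctx (code_dim set_sort)) (fin_ctx (code_dim set_sort)))
      (fun _ e => @mem M (e (inl Fin.F1)) (e (inr Fin.F1)))). dtac.
  - pose proof (d_in_coded_C ZM AllOD (X := @Def M) (fun P h => h)).
    apply (@cl_formula M (@Def M) (ctx_sum (fin_ctx (code_dim set_sort)) (fin_ctx (code_dim class_sort)))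
      (fun _ e => in_coded_C ZM (e (inr Fin.F1)) (e (inr (Fin.FS Fin.F1))) (e (inl Fin.F1)))). dtac.
Qed.

Definition sub_dom (s : sort) : env (fin_ctx (sub_dim s)) T -> Prop :=
  match s with
  | set_sort => fun _ => True
  | class_sort => fun e => Def (proj1_sig (e class_sort Fin.F1))
  end.

(** [Def_coded] turns membership in [Def] into the existence of a code, which is a set; the partial
    satisfaction classes for reading codes exist in the larger structure by [Def_DefWith]. *)
Lemma sub_dom_forms : exists f : forall s, cform (fin_ctx (sub_dim s)),
  forall s (e : env (fin_ctx (sub_dim s)) T), csat e (f s) <-> sub_dom e.
Proof.
  apply (sort_choice (T := fun s => cform (fin_ctx (sub_dim s)))
    (Q := fun s f => forall e : env _ T, csat e f <-> sub_dom e)).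
  intros [|].
  - apply (@cl_formula M (DefWith C) (fin_ctx (sub_dim set_sort)) (fun _ _ => True)). dtac.
  - apply (@cl_formula M (DefWith C) (fin_ctx (sub_dim class_sort))
      (fun z _ => Def (proj1_sig (z Fin.F1)))).
    eapply dn_ext; [intros z e; apply (Def_coded ZM)|].
    pose proof (d_in_coded ZM (X := DefWith C) (@Def_DefWith M)).
    dtac. apply cl_class_atom.
Qed.

Definition sub_eq_form (s : sort) : cform (ctx_sum (fin_ctx (sub_dim s)) (fin_ctx (sub_dim s))) :=
  match s with
  | set_sort => @CEq (ctx_sum (fin_ctx (sub_dim set_sort)) (fin_ctx (sub_dim set_sort))) set_sort
      (inl Fin.F1) (inr Fin.F1)
  | class_sort => @CEq (ctx_sum (fin_ctx (sub_dim class_sort)) (fin_ctx (sub_dim class_sort))) class_sort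
      (inl Fin.F1) (inr Fin.F1)
  end.

Definition sub_mem_form (s : sort) : cform (ctx_sum (fin_ctx (sub_dim set_sort)) (fin_ctx (sub_dim s))) :=
  match s with
  | set_sort => @CMem (ctx_sum (fin_ctx (sub_dim set_sort)) (fin_ctx (sub_dim set_sort))) set_sort
      (inl Fin.F1) (inr Fin.F1)
  | class_sort => @CMem (ctx_sum (fin_ctx (sub_dim set_sort)) (fin_ctx (sub_dim class_sort))) class_sort
      (inl Fin.F1) (inr Fin.F1)
  end.

Section Interpretations.
Variable df : forall s, cform (fin_ctx (code_dim s)).
Variable ef : forall s, cform (ctx_sum (fin_ctx (code_dim s)) (fin_ctx (code_dim s))).
Variable mf : forall s, cform (ctx_sum (fin_ctx (code_dim set_sort)) (fin_ctx (code_dim s))).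
Variable sf : forall s, cform (fin_ctx (sub_dim s)).
Hypothesis hdf : forall s (e : env (fin_ctx (code_dim s)) S), csat e (df s) <-> code_dom e.
Hypothesis hef : forall s (e : env (ctx_sum (fin_ctx (code_dim s)) (fin_ctx (code_dim s))) S),
  csat e (ef s) <-> code_equal e.
Hypothesis hmf : forall s (e : env (ctx_sum (fin_ctx (code_dim set_sort)) (fin_ctx (code_dim s))) S),
  csat e (mf s) <-> code_member e.
Hypothesis hsf : forall s (e : env (fin_ctx (sub_dim s)) T), csat e (sf s) <-> sub_dom e.

Let I := Interpretation df ef mf.
Let J := Interpretation sf sub_eq_form sub_mem_form.

Lemma coded_DefWith (x : interpreted I S class_sort) :
  DefWith C (in_coded_C ZM (proj1_sig x set_sort Fin.F1) (proj1_sig x set_sort (Fin.FS Fin.F1))).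
Proof.
  destruct x as [e he]. destruct (proj1 (@hdf class_sort e) he) as [h1 h2].
  apply (DefWith_coded ZM AllOD). cbn. eexists _, _. split; [exact h1|]. split; [exact h2|]. reflexivity.
Qed.

Definition decode (s : sort) : interpreted I S s -> T s :=
  match s with
  | set_sort => fun x => proj1_sig x set_sort Fin.F1
  | class_sort => fun x => exist _ _ (coded_DefWith x)
  end.

Lemma decode_hom : is_hom decode.
Proof.
  split.
  - intros [|].
    + intros y. assert (h : csat ((fun t => match t return fin_ctx (code_dim set_sort) t -> S t with
        set_sort => fun _ => y | class_sort => fun i => Fin.case0 (fun _ => S class_sort) i end)
          : env (fin_ctx (code_dim set_sort)) S) (df set_sort)) by (apply hdf; exact Logic.I).
      exists (exist (fun e : env (fin_ctx (code_dim set_sort)) S => csat e (df set_sort)) _ h). reflexivity.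
    + intros [P hP]. destruct (proj1 (DefWith_coded ZM AllOD P) hP) as [k [s [h1 [h2 h3]]]].
      assert (h : csat ((fun t => match t return fin_ctx (code_dim class_sort) t -> S t with
        set_sort => fun i => Fin.caseS' i (fun _ => car M) k (fun _ => s)
        | class_sort => fun i => Fin.case0 (fun _ => S class_sort) i end)
          : env (fin_ctx (code_dim class_sort)) S) (df class_sort)) by (apply hdf; split; auto).
      exists (exist (fun e : env (fin_ctx (code_dim class_sort)) S => csat e (df class_sort)) _ h). apply sig_ext. apply functional_extensionality. intros x.
      apply propositional_extensionality. symmetry. apply h3.
  - intros [|] x y; cbn [eqr interpreted]; unfold I; cbn [eq_form]; rewrite hef; cbn.
    + reflexivity.
    + split.
      * intros h. apply sig_ext. apply functional_extensionality. intros z.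
        apply propositional_extensionality. apply h.
      * intros h z. apply (f_equal (@proj1_sig _ _)) in h.
        assert (iff_of_eq : forall P Q : Prop, P = Q -> (P <-> Q)) by (intros P Q ->; tauto).
        exact (iff_of_eq _ _ (f_equal (fun P : M -> Prop => P z) h)).
  - intros [|] x y; cbn [memr interpreted]; unfold I; cbn [mem_form]; rewrite hmf; reflexivity.
Qed.

Lemma sub_Def (x : interpreted J T class_sort) : Def (proj1_sig (proj1_sig x class_sort Fin.F1)).
Proof. destruct x as [e he]. exact (proj1 (@hsf class_sort e) he). Qed.

Definition restrict (s : sort) : interpreted J T s -> S s :=
  match s with
  | set_sort => fun x => proj1_sig x set_sort Fin.F1
  | class_sort => fun x => exist _ _ (sub_Def x)
  end.

Lemma restrict_hom : is_hom restrict.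
Proof.
  split.
  - intros [|].
    + intros y. assert (h : csat ((fun t => match t return fin_ctx (sub_dim set_sort) t -> T t with
        set_sort => fun _ => y | class_sort => fun i => Fin.case0 (fun _ => T class_sort) i end)
          : env (fin_ctx (sub_dim set_sort)) T) (sf set_sort)) by (apply hsf; exact Logic.I).
      exists (exist (fun e : env (fin_ctx (sub_dim set_sort)) T => csat e (sf set_sort)) _ h). reflexivity.
    + intros [P hP].
      assert (h : csat ((fun t => match t return fin_ctx (sub_dim class_sort) t -> T t with
        set_sort => fun i => Fin.case0 (fun _ => T set_sort) i
        | class_sort => fun _ => exist _ P (Def_DefWith hP) end)
          : env (fin_ctx (sub_dim class_sort)) T) (sf class_sort)) by (apply hsf; exact hP).
      exists (exist (fun e : env (fin_ctx (sub_dim class_sort)) T => csat e (sf class_sort)) _ h). apply sig_ext. reflexivity.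
  - intros [|] x y; cbn.
    + reflexivity.
    + split.
      * intros h. apply sig_ext. cbn. now rewrite h.
      * intros h. apply sig_ext. apply (f_equal (@proj1_sig _ _)) in h. exact h.
  - intros [|] x y; reflexivity.
Qed.

Lemma eqr_class_structure (X : (M -> Prop) -> Prop) s (x y : class_structure X s) : eqr x y <-> x = y.
Proof. reflexivity. Qed.

(** The composite decodings are homs by [hom_comp], so only their graphs must be defined: equality
    of the single entries for sets, and having the same elements as the coded class for classes. *)
Lemma code_bi_interpretable : bi_interpretable S T.
Proof.
  exists I, J. split; [|split; [|split]].
  - eexists. apply hom_isomorphism with (2 := decode_hom). apply eqr_class_structure.
  - eexists. apply hom_isomorphism with (2 := restrict_hom). apply eqr_class_structure.
  - assert (H : exists f : forall s, cform (ext s (flat_ctx I J s)), forall s (x : S s)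
      (y : interpreted J (interpreted I S) s),
      csat (ext_env x (flatten y)) (f s) <-> restrict (map_interpreted decode_hom y) = x).
    { apply (sort_choice (T := fun s => cform (ext s (flat_ctx I J s)))
       (Q := fun s f => forall (x : S s) (y : interpreted J (interpreted I S) s),
         csat (ext_env x (flatten y)) f <-> restrict (map_interpreted decode_hom y) = x)).
      intros [|].
      - destruct (@cl_formula M (@Def M) (ext set_sort (flat_ctx I J set_sort))
          (fun _ e => e (Some (existT (fun t => (Fin.t (sub_dim set_sort t) * Fin.t (code_dim t set_sort))%type)
             set_sort (Fin.F1, Fin.F1))) = e None)) as [f hf]; [dtac|].
        exists f. intros x y. exact (hf (ext_env x (flatten y))).
      - pose proof (d_in_coded_C ZM AllOD (X := @Def M) (fun P h => h)).
        destruct (@cl_formula M (@Def M) (ext class_sort (flat_ctx I J class_sort))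
          (fun z e => forall u : M, in_coded_C ZM
           (e (existT (fun t => (Fin.t (sub_dim class_sort t) * Fin.t (code_dim t set_sort))%type)
             class_sort (Fin.F1, Fin.F1)))
           (e (existT (fun t => (Fin.t (sub_dim class_sort t) * Fin.t (code_dim t set_sort))%type)
             class_sort (Fin.F1, Fin.FS Fin.F1))) u <-> proj1_sig (z None) u)) as [f hf];
          [dtac; apply cl_class_atom|].
        exists f. intros x y. etransitivity; [exact (hf (ext_env x (flatten y)))|]. split.
        + intros h. apply sig_ext. apply functional_extensionality. intros u.
          apply propositional_extensionality. exact (h u).
        + intros <- u. reflexivity. }
    destruct H as [f hf]. exists f.
    apply hom_isomorphism_inv with (d := fun s y => restrict (map_interpreted decode_hom y)).
    + apply eqr_class_structure.
    + apply (hom_comp (map_interpreted_hom J decode_hom) restrict_hom).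
    + intros s x y. apply hf.
  - assert (H : exists f : forall s, cform (ext s (flat_ctx J I s)), forall s (x : T s)
      (y : interpreted I (interpreted J T) s),
      csat (ext_env x (flatten y)) (f s) <-> decode (map_interpreted restrict_hom y) = x).
    { apply (sort_choice (T := fun s => cform (ext s (flat_ctx J I s)))
       (Q := fun s f => forall (x : T s) (y : interpreted I (interpreted J T) s),
         csat (ext_env x (flatten y)) f <-> decode (map_interpreted restrict_hom y) = x)).
      intros [|].
      - destruct (@cl_formula M (DefWith C) (ext set_sort (flat_ctx J I set_sort))
          (fun _ e => e (Some (existT (fun t => (Fin.t (code_dim set_sort t) * Fin.t (sub_dim t set_sort))%type)
             set_sort (Fin.F1, Fin.F1))) = e None)) as [f hf]; [dtac|].
        exists f. intros x y. exact (hf (ext_env x (flatten y))).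
      (* In the larger structure, too, codes are read through forcing, with partial forcing classes
         that already lie in [Def M]. *)
      - pose proof (d_in_coded_C ZM AllOD (X := DefWith C) (@Def_DefWith M)).
        destruct (@cl_formula M (DefWith C) (ext class_sort (flat_ctx J I class_sort))
          (fun z e => forall u : M, in_coded_C ZM
           (e (existT (fun t => (Fin.t (code_dim class_sort t) * Fin.t (sub_dim t set_sort))%type)
             set_sort (Fin.F1, Fin.F1)))
           (e (existT (fun t => (Fin.t (code_dim class_sort t) * Fin.t (sub_dim t set_sort))%type)
             set_sort (Fin.FS Fin.F1, Fin.F1))) u <-> proj1_sig (z None) u)) as [f hf];
          [dtac; apply cl_class_atom|].
        exists f. intros x y. etransitivity; [exact (hf (ext_env x (flatten y)))|]. split.
        + intros h. apply sig_ext. apply functional_extensionality. intros u.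
          apply propositional_extensionality. exact (h u).
        + intros <- u. reflexivity. }
    destruct H as [f hf]. exists f.
    apply hom_isomorphism_inv with (d := fun s y => decode (map_interpreted restrict_hom y)).
    + apply eqr_class_structure.
    + apply (hom_comp (map_interpreted_hom I restrict_hom) decode_hom).
    + intros s x y. apply hf.
Qed.

End Interpretations.

Lemma Def_DefWith_bi_interpretable : bi_interpretable S T.
Proof.
  destruct code_dom_forms as [df hdf], code_eq_forms as [ef hef], code_mem_forms as [mf hmf],
    sub_dom_forms as [sf hsf].
  exact (code_bi_interpretable hdf hef hmf hsf).
Qed.

End BiInterpretation.

Theorem theorem3p5 (U : mstruct) (HU : ZFC U) (kappa : U)
    (Hkappa : inaccessible kappa) (Hhod : V_eq_HOD (Vset kappa)) :
  let V := Vset kappa in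
  let C := @canonical_generic V in
  GB (@Def V) /\ GB (DefWith C) /\
  bi_interpretable (class_structure (@Def V)) (class_structure (DefWith C)).
Proof.
  intros V C.
  pose proof (ZFC_Vset HU Hkappa) as ZV.
  assert (AllOD : forall x : V, OD x) by (intros x; apply (Hhod x), rt_refl).
  split; [|split].
  - apply (GB_definable ZV).
  - apply (GB_definable ZV).
  - exact (Def_DefWith_bi_interpretable ZV AllOD).
Qed.
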